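(* Suppose that $\ell \in F_\epsilon'$ is symmetric positive semi-definite (SPSD). Then, for any $\rho \ge 0$ and $\lambda > 0$, the variational problem $$\text{find } U \in E_\pi \text{ such that } \quad B(U,v) - \rho^2 \Delta(U,v) = \ell(v) \quad \forall v \in F_\epsilon$$ has a unique solution $U \in E_\pi$. This solution is SPSD and admits the bound $$\|U\|_{\pi} \le C \, \|\ell\|_{-\epsilon} \quad\text{with}\quad C := \frac{\rho^2 e^{(\rho^2 - 2\lambda)T} - 2\lambda}{\rho^2 - 2\lambda},$$ where $C = \rho^2 T + 1$ for $\rho^2 = 2\lambda$.
   Context: Let $T>0$, $J=(0,T)$, $\lambda>0$. Let $E = L_2(J)$ with norm $\|w\|_E^2 := \lambda \|w\|_{L_2(J)}^2$, and $F = \{v\in H^1(J): v(T)=0\}$ with norm $\|v\|_F^2 := \lambda^{-1}\|v'\|_{L_2(J)}^2 + \lambda\|v\|_{L_2(J)}^2 + |v(0)|^2$ (real-valued functions; elements of $F$ are identified with their continuous representatives). Define $b(w,v) := \int_J w(t)\,(-v'(t)+\lambda v(t))\,dt$ on $E\times F$. $E_\pi := E\otimes_\pi E$ is the projective tensor product (completion of the algebraic tensor product under $\|w\|_\pi = \inf\{\sum_i \|w_i^1\|_E\|w_i^2\|_E : w=\sum_i w_i^1\otimes w_i^2\}$) and $F_\epsilon := F\otimes_\epsilon F$ is the injective tensor product (completion under $\|v\|_\epsilon = \sup\{|(g_1\otimes g_2)(v)| : g_1,g_2\in F', \|g_1\|_{F'}=\|g_2\|_{F'}=1\}$). $F_\epsilon'$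 is the dual of $F_\epsilon$ with norm $\|\cdot\|_{-\epsilon}$. $E_\pi$ is regarded as a subspace of $L_2(J\times J)$. $B$ is the unique continuous bilinear form on $E_\pi\times F_\epsilon$ with $B(w_1\otimes w_2, v_1\otimes v_2) = b(w_1,v_1)\,b(w_2,v_2)$. $\Delta$ (the trace product) is the unique continuous bilinear form on $E_\pi\times F_\epsilon$ with $\Delta(w,v)=\int_J w(t,t)v(t,t)\,dt$ for $w\in E\otimes E$, $v\in F\otimes F$ (algebraic tensor products). A function $w\in L_2(J\times J)$ is SPSD if $w(s,t)=w(t,s)$ a.e. and $\int_J\int_J w(s,t)\varphi(s)\varphi(t)\,ds\,dt\ge 0$ for all $\varphi\in L_2(J)$. A functional $\ell\in F_\epsilon'$ is SPSD if $\ell(\psi\otimes\tilde\psi)=\ell(\tilde\psi\otimes\psi)$ and $\ell(\psi\otimes\psi)\ge 0$ for all $\psi,\tilde\psi\in F$. *)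

(* Defs.v *)
From HB Require Import structures.
From mathcomp Require Import all_boot all_order all_algebra.
From mathcomp Require Import all_classical all_reals all_analysis.
From mathcomp Require Import measurable_realfun.

Set Implicit Arguments.
Unset Strict Implicit.
Unset Printing Implicit Defensive.
Import Order.TTheory GRing.Theory Num.Theory.
Import numFieldNormedType.Exports.

Local Open Scope classical_set_scope.
Local Open Scope ring_scope.

(* Tensor products of two spaces V, W with (semi)norms N, M.  A finite sequence
   s : seq (V * W) stands for the algebraic tensor \sum_(p <- s) p.1 (x) p.2,
   and two sequences stand for the same element of V (x) W iff no bilinear form
   separates them. *)
Section TensorProducts.
Context {R : realType} {V W : lmodType R}.

Definition tsum (X : lmodType R) (beta : V -> W -> X) (s : seq (V * W)) : X :=
  \sum_(p <- s) beta p.1 p.2.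

Definition tensor_eq (s t : seq (V * W)) : Prop :=
  forall beta : {bilinear V -> W -> R}, tsum beta s = tsum beta t.

Definition pi_norm (N : V -> R) (M : W -> R) (s : seq (V * W)) : R :=
  inf [set \sum_(p <- t) N p.1 * M p.2 | t in [set t | tensor_eq t s]].

Definition in_dual (U : lmodType R) (N : U -> R) (g : U -> R) : Prop :=
  exists C : R, forall u, `|g u| <= C * N u.

Definition dual_norm (U : lmodType R) (N : U -> R) (g : U -> R) : R :=
  sup [set `|g u| | u in [set u | N u <= 1]].

Definition eps_norm (N : V -> R) (M : W -> R) (s : seq (V * W)) : R :=
  sup [set r | exists (g1 : {linear V -> R}) (g2 : {linear W -> R}),
    [/\ in_dual N g1 /\ dual_norm N g1 = 1,
        in_dual M g2 /\ dual_norm M g2 = 1 &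
        r = `|\sum_(p <- s) g1 p.1 * g2 p.2| ]].

(* X, with v (x) w realized as tens v w, is a completion of V (x) W under nrm;
   it is unique up to a unique isometric isomorphism. *)
Definition tensor_completion (nrm : seq (V * W) -> R)
    (X : completeNormedModType R) (tens : {bilinear V -> W -> X}) : Prop :=
  (forall s, `|tsum tens s| = nrm s) /\ dense (range (tsum tens)).

End TensorProducts.

Section IntervalMeasure.
Context {R : realType}.

Definition muJ (T : R) : set (measurableTypeR R) -> \bar R :=
  mrestr lebesgue_measure (measurable_itv `]0, T[).

HB.instance Definition _ (T : R) := Measure.on (muJ T).

Lemma muJ_fin (T : R) : fin_num_fun (muJ T).
Proof.
apply: lty_fin_num_fun.
rewrite -[X in (X < _)%E]/(lebesgue_measure (setT `&` `]0, T[)) setTI.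
by rewrite lebesgue_measure_itv/=; case: ifPn => _; rewrite ltry.
Qed.

HB.instance Definition _ (T : R) := @Measure_isFinite.Build _ _ _ (muJ T) (@muJ_fin T).

End IntervalMeasure.

Section Spaces.
Context {R : realType} (T : R).

(* The space L_2(J), as square-integrable functions.  Its norm is a seminorm;
   functions equal a.e. on J have the same image in every completion below. *)
Definition E := LfunType (muJ T) (lee1n 2).

Definition E2 := LfunType (muJ T \x muJ T)%E (lee1n 2).

Definition L2norm (f : R -> R) : R := fine 'N[muJ T]_2%:E[EFin \o f]%E.

Definition C1c : set (R -> R) := [set phi : R -> R |
  [/\ forall t : R, derivable phi t 1, continuous (derive1 phi) &
      closure [set t | phi t != 0] `<=` `]0, T[] ].

(* Weak differentiability on J, tested against C^1 functions with compact
   support in J. *)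
Definition weak_deriv (v g : R -> R) : Prop :=
  forall phi, C1c phi ->
    \int[muJ T]_t (v t * derive1 phi t) = - \int[muJ T]_t (g t * phi t).

(* Continuous representatives on [0, T] of the elements of H^1(J) vanishing at
   T; values outside [0, T] are irrelevant and are normalized to 0. *)
Definition Fset : set (R -> R) := [set v : R -> R |
  [/\ v \in Lfun (muJ T) 2%:E /\ (exists g : E, weak_deriv v g),
      {within `[0, T], continuous v},
      v T = 0 &
      forall t, t \notin `[0, T] -> v t = 0] ].

Let muJ_out : muJ T (~` `]0, T[) = 0%E.
Proof. by rewrite /muJ /mrestr/= setICl measure0. Qed.

Lemma continuous_Lfun2 (f : R -> R) : continuous f -> f \in Lfun (muJ T) 2%:E.
Proof.
move=> cf; have mf : measurable_fun setT f by exact: continuous_measurable_fun.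
rewrite inE; apply/andP; split; rewrite inE//=.
rewrite /finite_norm unlock poweR_lty//.
have /compact_bounded[M [_ fM]] := continuous_compact
  (continuous_subspaceT cf) (@segment_compact R 0 T).
pose K := `|M| + 1.
have fK t : `]0, T[%classic t -> `|f t| <= K.
  move=> tJ; apply: (fM K); first by rewrite (le_lt_trans (ler_norm M))// ltrDl.
  by exists t => //; exact: subset_itv_oo_cc.
apply: (@le_lt_trans _ _ (\int[muJ T]_x (cst (K `^ 2)%:E x))%E).
  apply: ae_ge0_le_integral => //=.
  - apply/measurable_EFinP; apply: (measurableT_comp (measurable_powR _)) => //.
    exact: measurableT_comp.
  - by move=> x _; rewrite lee_fin powR_ge0.
  exists (~` `]0, T[%classic); split; [exact: measurableC|exact: muJ_out|].
  move=> x /= xn xJ; apply: xn => _; rewrite lee_fin.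
  by apply: ge0_ler_powR; rewrite ?nnegrE ?addr_ge0//; exact: fK.
by rewrite integral_cst//= lte_mul_pinfty ?lee_fin ?powR_ge0// (fin_num_fun_lty (@muJ_fin _ T)).
Qed.

Lemma C1c_Lfun2 phi : C1c phi ->
  phi \in Lfun (muJ T) 2%:E /\ derive1 phi \in Lfun (muJ T) 2%:E.
Proof.
move=> [dphi cphi _]; split; apply: continuous_Lfun2 => // t.
exact/differentiable_continuous/derivable1_diffP.
Qed.

Let mul_integrable (f g : R -> R) : f \in Lfun (muJ T) 2%:E -> g \in Lfun (muJ T) 2%:E ->
  (muJ T).-integrable setT (EFin \o (fun t => f t * g t)).
Proof. by move=> f2 g2; apply/Lfun1_integrable; exact: Lfun2_mul_Lfun1. Qed.

Let Rint_lin (f g h : R -> R) (a : R) : f \in Lfun (muJ T) 2%:E ->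
  g \in Lfun (muJ T) 2%:E -> h \in Lfun (muJ T) 2%:E ->
  \int[muJ T]_t ((a * f t + g t) * h t) =
  a * \int[muJ T]_t (f t * h t) + \int[muJ T]_t (g t * h t).
Proof.
move=> f2 g2 h2; rewrite -RintegralZl//; last exact: mul_integrable.
rewrite -RintegralD//.
- by apply: eq_Rintegral => t _; rewrite mulrDl mulrA.
- by have := @integrableZl _ _ _ _ _ measurableT a _ (mul_integrable f2 h2).
- exact: mul_integrable.
Qed.

Definition Fpred : {pred R -> R} := mem Fset.

Lemma Fpred_submod_closed : submod_closed Fpred.
Proof.
split.
  rewrite inE; split => //.
  - split; first exact: (LfunP (0 : E)).
    exists 0 => phi _.
    rewrite (_ : (fun t => _) = cst 0); last by apply/funext => t; rewrite mul0r.
    rewrite [in RHS](_ : (fun t => _) = cst 0); last by apply/funext => t; rewrite mul0r.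
    by rewrite Rintegral_cst// mul0r oppr0.
  - exact: cst_continuous.
move=> a f g /[!inE] -[[f2 [df hf]] cf fT fo] [[g2 [dg hg]] cg gT go]; split.
- split; first exact:
    (LfunP (a *: (Lfun_Sub (lee1n 2) f2 : E) + (Lfun_Sub (lee1n 2) g2 : E))).
  exists (a *: df + dg) => phi phiC.
  have [p2 dp2] := C1c_Lfun2 phiC.
  rewrite [LHS]Rint_lin//.
  rewrite [in RHS]Rint_lin//; try exact: LfunP.
  by rewrite hf// hg// mulrN opprD.
- move=> t; apply: continuousD; last exact: cg.
  by apply: continuousZ; [exact: cst_continuous|exact: cf].
- by rewrite -[LHS]/(a * f T + g T) fT gT mulr0 addr0.
- by move=> t tn; rewrite -[LHS]/(a * f t + g t) fo// go// mulr0 addr0.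
Qed.

HB.instance Definition _ := GRing.isSubmodClosed.Build _ _ Fpred Fpred_submod_closed.

Record F := MkF { F_fun :> R -> R ; F_funP : F_fun \in Fpred }.
HB.instance Definition _ := [isSub for F_fun].
HB.instance Definition _ := [Choice of F by <:].
HB.instance Definition _ := [SubChoice_isSubLmodule of F by <:].

(* Weak derivatives are unique up to equality a.e. on J. *)
Definition vderiv (v : F) : E := xget 0 [set g : E | weak_deriv v g].

Definition normE (lam : R) (w : E) : R := Num.sqrt (lam * L2norm w ^+ 2).

Definition normF (lam : R) (v : F) : R :=
  Num.sqrt (lam^-1 * L2norm (vderiv v) ^+ 2 + lam * L2norm v ^+ 2 + `|v 0| ^+ 2).

Definition bform (lam : R) (w : E) (v : F) : R :=
  \int[muJ T]_t (w t * (- vderiv v t + lam * v t)).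

Definition tensE_fun (s : seq (E * E)) (x : R * R) : R :=
  \sum_(p <- s) p.1 x.1 * p.2 x.2.

Definition tensF_fun (r : seq (F * F)) (x : R * R) : R :=
  \sum_(p <- r) p.1 x.1 * p.2 x.2.

Definition spsd_fun (w : E2) : Prop :=
  {ae (muJ T \x muJ T)%E, forall x, w (x.1, x.2) = w (x.2, x.1)} /\
  forall phi : E,
    0 <= \int[muJ T]_s \int[muJ T]_t (w (s, t) * phi s * phi t).

Section TensorSpaces.
Variables (Epi Feps : completeNormedModType R).
Variables (tE : {bilinear E -> E -> Epi}) (tF : {bilinear F -> F -> Feps}).

Definition B_spec (lam : R) (B : {bilinear Epi -> Feps -> R}) : Prop :=
  continuous (fun p : Epi * Feps => B p.1 p.2) /\
  forall w1 w2 v1 v2,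
    B (tE w1 w2) (tF v1 v2) = bform lam w1 v1 * bform lam w2 v2.

Definition trace_spec (Delta : {bilinear Epi -> Feps -> R}) : Prop :=
  continuous (fun p : Epi * Feps => Delta p.1 p.2) /\
  forall (s : seq (E * E)) (r : seq (F * F)),
    Delta (tsum tE s) (tsum tF r) =
    \int[muJ T]_t (tensE_fun s (t, t) * tensF_fun r (t, t)).

(* The element of L_2(J x J) with which U is identified: the inclusion of Epi
   in L_2(J x J) is the continuous extension of tsum tE s |-> tensE_fun s. *)
Definition represents (U : Epi) (w : E2) : Prop :=
  exists s : nat -> seq (E * E),
    tsum tE (s n) @[n --> \oo] --> U /\
    ('N[(muJ T \x muJ T)%E]_2%:E [EFin \o (tensE_fun (s n) \- w)%R] @[n --> \oo]
       --> 0)%E.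

Definition spsd_pi (U : Epi) : Prop := exists2 w, represents U w & spsd_fun w.

Definition spsd_functional (l : Feps -> R) : Prop :=
  (forall psi psi', l (tF psi psi') = l (tF psi' psi)) /\
  forall psi, 0 <= l (tF psi psi).

End TensorSpaces.

Definition stab_const (rho lam : R) : R :=
  if rho ^+ 2 == 2 * lam then rho ^+ 2 * T + 1
  else (rho ^+ 2 * expR ((rho ^+ 2 - 2 * lam) * T) - 2 * lam)
         / (rho ^+ 2 - 2 * lam).

End Spaces.

(* Main.v *)
(* The map v |-> (- v' + lam v) / lam is an isometry of F onto E for the inner product
   <x, y> = lam int x y; let S be its inverse.  Then b(w, S x) = <w, x>, so an element U
   of E_pi is determined by B(U, .), and a positive semidefinite functional l gives the
   positive semidefinite form L(x, y) = l(S x (x) S y) on E.  Its trace is at most the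
   norm of l, since \sum_i S f_i (x) S f_i has injective norm at most 1 for orthonormal
   f_i; hence L comes from a limit U of tensors \sum_k c_k (x) c_k in E_pi.
   The trace product only sees the diagonal D_U(h) = int U(t, t) h(t) dt, as
   Delta(U, v1 (x) v2) = D_U(v1 v2).  The evaluation v |-> v(t, t) is B(k_t (x) k_t, .)
   with k_t(s) = exp(- lam (s - t)) for s > t, and 0 otherwise.  The variational problem
   therefore amounts to the Volterra equation D_U(h) = D_U0(h) + rho^2 D_U(K h), where
   B(U0, .) = l and (K h)(t) = int_t^T exp(- 2 lam (s - t)) h(s) ds, which the resolvent
   of K solves: D_U(h) = D_U0(R h), (R h)(t) = h(t) + rho^2 int_t^T exp(m (s - t)) h(s) ds
   with m = rho^2 - 2 lam.
   Since R preserves positivity, l + rho^2 Delta(U, .) = B(U, .) is positive semidefinite,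
   so U is a limit of tensors \sum_k c_k (x) c_k.  The projective norm of such a limit is
   at most its trace lam D_U(1) = lam D_U0(R 1) <= C lam D_U0(1) <= C |l|, because
   R 1 <= C on J. *)
Require Import Defs.
From HB Require Import structures.
From mathcomp Require Import all_boot all_order all_algebra.
From mathcomp Require Import all_classical all_reals all_analysis.
Import Order.TTheory GRing.Theory Num.Theory.
Import numFieldNormedType.Exports.
Local Open Scope classical_set_scope.
Local Open Scope ring_scope.
From mathcomp Require Import ring lra measurable_realfun.
Set Implicit Arguments.
Unset Strict Implicit.
Unset Printing Implicit Defensive.

(** * Positive semidefinite forms *)

(** No spectral theorem is invoked. [E] is a space of functions, so its inner product is degenerate,
    and no eigenvectors of [L] are constructed. A greedily chosen orthonormal system replaces them:
    the finite trace of [L] forces the residuals along it to vanish. The trace product is not a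
    small perturbation of [B] for large [rho], so the problem is not treated by contraction. What
    makes it solvable for every [rho] is that K only looks at later times and has an explicit
    resolvent with nonnegative kernel. The scalar functional D_U is found first; the tensor is then
    U0 plus rho^2 times the integral of k_t (x) k_t against D_U. This is why a uniformly continuous
    function with values in [Epi] has to be integrated against a functional on bounded functions.
    The constant depends on positivity: the norm of U is bounded by its trace, and traces are
    compared through D_U0, so the triangle inequality for U0 plus the integral never enters. *)

Definition mk_bilinear (R : realType) (V W X : lmodType R) (f : V -> W -> X)
    (fl : forall c x x' y, f (c *: x + x') y = c *: f x y + f x' y)
    (fr : forall c x y y', f x (c *: y + y') = c *: f x y + f x y') :
    {bilinear V -> W -> X} :=
  HB.pack f (bilinear_isBilinear.Build R V W X _ _ f
    (conj (fun u c x y => fl c x y u) (fun u c x y => fr c u x y))).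

(** Course-of-values recursion: each value may depend on the list of all earlier ones, as in the
    Gram-Schmidt process and in the greedy choice of a basis. *)
Lemma strong_rec (V : Type) (g : nat -> seq V -> V) :
  exists f : nat -> V, forall n, f n = g n (mkseq f n).
Proof.
pose L := fix L n := if n is m.+1 then rcons (L m) (g m (L m)) else [::].
exists (fun n => g n (L n)) => n; congr (g n _).
by elim: n => [//|n IH]; rewrite /mkseq -addn1 iotaD map_cat /= -/(mkseq _ n) -IH cats1 addn1 add0n.
Qed.

(** Young's inequality with a free weight. Summed over k, it replaces products of norms by sums of
    squares, so that only traces have to be controlled. *)
Lemma amgm_eps (R : realType) (e x y : R) : 0 < e ->
  x * y <= (x ^+ 2 / e + e * y ^+ 2) / 2.
Proof.
move=> e0; rewrite -subr_ge0.
have -> : (x ^+ 2 / e + e * y ^+ 2) / 2 - x * y = (x - e * y) ^+ 2 / (2 * e).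
  by field; rewrite gt_eqF.
by rewrite divr_ge0 ?sqr_ge0 ?mulr_ge0 // ltW.
Qed.

Lemma cvg0_sqr_le (R : realType) (u v : nat -> R) :
  (forall n, u n ^+ 2 <= v n) -> v n @[n --> \oo] --> 0 -> u n @[n --> \oo] --> 0.
Proof.
move=> uv /cvgr0Pnorm_lt v0; apply/cvgr0Pnorm_lt => e e0.
apply: filterS (v0 _ (exprn_gt0 2 e0)) => n hn.
rewrite -(@ltr_pXn2r _ 2) ?nnegrE ?(ltW e0) // real_normK ?num_real //.
by apply: le_lt_trans (uv n) _; apply: le_lt_trans hn; exact: ler_norm.
Qed.

Section PsdForms.
Context {R : realType} {V : lmodType R}.

Definition psd_form (a : V -> V -> R) : Prop :=
  (forall x y, a x y = a y x) /\ forall x, 0 <= a x x.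

Section OneForm.
Variables (a : {bilinear V -> V -> R}) (pa : psd_form a).

Lemma formC x y : a x y = a y x. Proof. exact: pa.1. Qed.
Lemma form_ge0 x : 0 <= a x x. Proof. exact: pa.2. Qed.
Lemma formZl c x y : a (c *: x) y = c * a x y. Proof. by rewrite linearZl_LR. Qed.
Lemma formZr c x y : a x (c *: y) = c * a x y. Proof. by rewrite linearZr_LR. Qed.

Lemma form_suml (n : nat) (c : 'I_n -> R) (x : 'I_n -> V) y :
  a (\sum_i c i *: x i) y = \sum_i c i * a (x i) y.
Proof. by rewrite linear_sumlz; apply: eq_bigr => i _; rewrite formZl. Qed.

Lemma form_sumr (n : nat) (c : 'I_n -> R) (x : 'I_n -> V) y :
  a y (\sum_i c i *: x i) = \sum_i c i * a y (x i).
Proof. by rewrite linear_sumr; apply: eq_bigr => i _; rewrite formZr. Qed.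

(** Along the line x + c y the quadratic form is affine in c when [a y y = 0]; with a nonzero slope
    it would take the value -1 at the coefficient chosen below. *)
Lemma form_null x y : a y y = 0 -> a x y = 0.
Proof.
move=> y0; apply/eqP; apply: contraT => xy0.
have := form_ge0 (x + (- (a x x + 1) / (2 * a x y)) *: y).
rewrite linearDl !linearDr !formZl !formZr y0 (formC y x).
by rewrite [leRHS](_ : _ = - 1) ?ler0N1 //; field.
Qed.

Lemma form_CS x y : a x y ^+ 2 <= a x x * a y y.
Proof.
have [y0|y0] := eqVneq (a y y) 0; first by rewrite form_null // y0 mulr0 expr0n.
have yp : 0 < a y y by rewrite lt0r y0 form_ge0.
have := form_ge0 (x + (- a x y / a y y) *: y).
rewrite linearDl !linearDr !formZl !formZr (formC y x).
rewrite [leRHS](_ : _ = (a x x * a y y - a x y ^+ 2) / a y y); last by field.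
by rewrite pmulr_lge0 ?invr_gt0 // subr_ge0.
Qed.

(* Zero vectors are allowed, so that the Gram-Schmidt process never stops. *)
Definition onz (f : nat -> V) : Prop :=
  (forall i j, i != j -> a (f i) (f j) = 0) /\
  forall i, f i = 0 \/ a (f i) (f i) = 1.

Lemma onz_mul f i y : onz f -> a y (f i) * a (f i) (f i) = a y (f i).
Proof. by move=> [_ /(_ i)[->|->]]; rewrite ?mulr1 // linear0r mul0r. Qed.

Lemma onz_coef f n (c : 'I_n -> R) (j : 'I_n) : onz f ->
  a (\sum_i c i *: f i) (f j) = c j * a (f j) (f j).
Proof.
move=> of_; rewrite form_suml (bigD1 j) //= big1 ?addr0 // => i ij.
by rewrite of_.1 ?mulr0 // .
Qed.

Lemma onz_sqr f n (c : 'I_n -> R) : onz f ->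
  a (\sum_i c i *: f i) (\sum_i c i *: f i) <= \sum_i c i ^+ 2.
Proof.
move=> of_; rewrite form_sumr; apply: ler_sum => i _.
rewrite onz_coef // mulrA -expr2 ler_piMr ?sqr_ge0 //.
by case: (of_.2 i) => ->; rewrite ?linear0l.
Qed.

Definition onz_proj (f : nat -> V) n x := \sum_(i < n) a x (f i) *: f i.

Lemma onz_proj_orth f n x i : onz f -> (i < n)%N -> a (x - onz_proj f n x) (f i) = 0.
Proof.
move=> of_ lin; rewrite linearBl /= (onz_coef (fun i : 'I_n => a x (f i)) (Ordinal lin)) //.
by rewrite onz_mul // subrr.
Qed.

Lemma onz_pythagoras f n x : onz f ->
  a (x - onz_proj f n x) (x - onz_proj f n x) = a x x - \sum_(i < n) a x (f i) ^+ 2.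
Proof.
move=> of_; rewrite linearBr /= [X in _ - X]form_sumr big1 ?subr0; last first.
  by move=> i _; rewrite onz_proj_orth ?mulr0.
rewrite linearBl /= form_suml; congr (_ - _); apply: eq_bigr => i _.
by rewrite (formC (f i)) expr2.
Qed.

Lemma bessel f n x : onz f -> \sum_(i < n) a x (f i) ^+ 2 <= a x x.
Proof. by move=> of_; rewrite -subr_ge0 -onz_pythagoras // form_ge0. Qed.

Lemma onz_residual_le f n x : onz f ->
  a (x - onz_proj f n x) (x - onz_proj f n x) <= a x x.
Proof.
move=> of_; rewrite onz_pythagoras // gerBl sumr_ge0 // => i _; exact: sqr_ge0.
Qed.

Lemma onz_proj_le f n x : onz f -> a (onz_proj f n x) (onz_proj f n x) <= a x x.
Proof. by move=> of_; apply: (le_trans (onz_sqr _ of_)); exact: bessel. Qed.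

Lemma onz_proj_linear f n : linear (onz_proj f n).
Proof.
move=> c x y; rewrite /onz_proj scaler_sumr -big_split /=; apply: eq_bigr => i _.
by rewrite linearPl scalerDl scalerA.
Qed.

(** The expansion is stated after pairing with an arbitrary y because [a] may be degenerate: a
    residual of length zero is replaced by 0, and by [form_null] the form does not see the
    difference. *)
Lemma gram_schmidt (x : nat -> V) : exists f : nat -> V, onz f /\
  forall i y, a (x i) y = \sum_(k < i.+1) a (x i) (f k) * a (f k) y.
Proof.
pose res (y : V) (s : seq V) := y - \sum_(e <- s) a y e *: e.
pose g n (s : seq V) := let r := res (x n) s in
  if a r r == 0 then 0 else (Num.sqrt (a r r))^-1 *: r.
have [f fE] := strong_rec g.
pose r n := x n - \sum_(i < n) a (x n) (f i) *: f i.
have {}fE n : f n = if a (r n) (r n) == 0 then 0 else (Num.sqrt (a (r n) (r n)))^-1 *: r n.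
  suff rE : r n = res (x n) (mkseq f n) by rewrite {1}fE /g rE.
  rewrite /r /res /mkseq big_map; congr (_ - _).
  by rewrite -(big_mkord xpredT (fun i => a (x n) (f i) *: f i)) /index_iota subn0.
have f1 n : f n = 0 \/ a (f n) (f n) = 1.
  rewrite fE; case: ifPn => [_|n0]; [by left|right].
  rewrite formZl formZr mulrA -invfM -expr2 sqr_sqrtr ?form_ge0 //.
  by rewrite mulVf.
have orth n : forall i, (i < n)%N -> a (f n) (f i) = 0.
  elim/ltn_ind: n => n IH i lin.
  suff rf0 : a (r n) (f i) = 0.
    by rewrite fE; case: ifP => _; rewrite ?linear0l // formZl rf0 mulr0.
  rewrite linearBl /= form_suml (bigD1 (Ordinal lin)) //= big1 ?addr0.
    by case: (f1 i) => ->; rewrite ?linear0r ?mulr1 ?mulr0 subrr.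
  move=> j jni; have {}jni : val j != i by [].
  suff -> : a (f j) (f i) = 0 by rewrite mulr0.
  move: jni; rewrite neq_ltn => /orP[ji|ij]; last by apply: IH.
  by rewrite formC; apply: (IH _ lin).
have onf : onz f.
  split=> // i j; rewrite neq_ltn => /orP[ij|ji]; last exact: orth.
  by rewrite formC; apply: orth.
exists f; split=> // n y.
have rfn : a (r n) (f n) = a (x n) (f n).
  rewrite linearBl /= form_suml big1 ?subr0 // => i _.
  by rewrite (formC (f i)) orth ?mulr0.
have xE : a (x n) y = \sum_(i < n) a (x n) (f i) * a (f i) y + a (r n) y.
  by rewrite -form_suml -linearDl /r addrC subrK.
rewrite xE big_ord_recr /=; congr (_ + _).
rewrite -rfn fE; case: ifPn => [/eqP r0|n0].
  by rewrite linear0r mul0r formC form_null.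
rewrite formZl formZr mulrACA -invfM -expr2 sqr_sqrtr ?form_ge0 //.
by rewrite mulrA mulVf // mul1r.
Qed.

Lemma gram_schmidt_orth (x f : nat -> V) : onz f ->
  (forall i y, a (x i) y = \sum_(k < i.+1) a (x i) (f k) * a (f k) y) ->
  forall i k, (i < k)%N -> a (x i) (f k) = 0.
Proof.
move=> of_ xf i k ik; rewrite xf big1 // => j _.
by rewrite of_.1 ?mulr0 // neq_ltn (leq_trans (ltn_ord j) ik).
Qed.

Lemma gram_schmidt_expand (x f : nat -> V) : onz f ->
  (forall i y, a (x i) y = \sum_(k < i.+1) a (x i) (f k) * a (f k) y) ->
  forall n i y, (i < n)%N -> a (x i) y = \sum_(k < n) a (x i) (f k) * a (f k) y.
Proof.
move=> of_ xf n i y lin; rewrite xf -!(big_mkord xpredT (fun k => a (x i) (f k) * a (f k) y)).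
rewrite (@big_cat_nat _ _ _ i.+1 0 n) //= [X in _ + X]big1_seq ?addr0 //.
move=> k /andP[_]; rewrite mem_index_iota => /andP[ik _].
by rewrite (gram_schmidt_orth of_ xf) // mul0r.
Qed.

End OneForm.
End PsdForms.

(** * Greedy orthonormal systems *)

Section GreedyBasis.
Context {R : realType} {V : lmodType R}.
Variables (a L : {bilinear V -> V -> R}) (pa : psd_form a) (pL : psd_form L).
Variable M : R.
Hypothesis L_null : forall x, a x x = 0 -> L x x = 0.
Hypothesis L_trace : forall f n, onz a f -> \sum_(i < n) L (f i) (f i) <= M.

(** Including 0 keeps the set nonempty even when no unit vector is orthogonal to [s]. *)
Let cand (s : seq V) : set V :=
  [set q | (q = 0 \/ a q q = 1) /\ {in s, forall e, a q e = 0}].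

Let candL (s : seq V) : set R := [set L q q | q in cand s].

Let cand0 s : cand s 0.
Proof. by split=> [|e _]; [left|rewrite linear0l]. Qed.

(** A single candidate followed by zeros is a family satisfying [onz], so the trace bound with one
    term applies to it. *)
Let candL_ub s : ubound (candL s) M.
Proof.
move=> _ [q [q1 _] <-].
pose f n := if n is 0%N then q else 0.
have of_ : onz a f.
  split=> [[|i] [|j] //= _|[|i]]; rewrite ?linear0l ?linear0r //; by left.
by have := L_trace 1 of_; rewrite big_ord1.
Qed.

Let greedy_step s : exists q, cand s q /\ forall x, cand s x -> L x x <= 2 * L q q.
Proof.
have sc : has_sup (candL s).
  by split; [exists (L 0 0), 0|exists M; exact: candL_ub].
have [s0|s0] := lerP (sup (candL s)) 0.
  exists 0; split=> // x cx; rewrite linear0l mulr0 (le_trans _ s0) //.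
  by apply: (ub_le_sup sc.2); exists x.
have [_ [q cq <-] hq] := sup_adherent (divr_gt0 s0 (ltr0Sn R 1)) sc.
exists q; split=> // x cx; apply: (@le_trans _ _ (sup (candL s))).
  by apply: (ub_le_sup sc.2); exists x.
move: hq; rewrite {1}(splitr (sup _)) addrK => /ltW.
by rewrite ler_pdivrMr // mulrC.
Qed.

(** The supremum of L over the candidates need not be attained, hence the factor 2. Homogeneity
    extends the comparison from unit vectors to all x; vectors of length zero cannot be normalized
    and are covered by [L_null]. *)
Lemma greedy_basis : exists2 q : nat -> V, onz a q &
  forall n x, (forall i, (i < n)%N -> a x (q i) = 0) -> L x x <= 2 * a x x * L (q n) (q n).
Proof.
pose g s := proj1_sig (cid (greedy_step s)).
have gP s : cand s (g s) /\ forall x, cand s x -> L x x <= 2 * L (g s) (g s).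
  by rewrite /g; case: cid.
have [q qE] := strong_rec (fun _ s => g s).
have qP n : (q n = 0 \/ a (q n) (q n) = 1) /\ (forall i, (i < n)%N -> a (q n) (q i) = 0).
  have [[q1 q2] _] := gP (mkseq q n); rewrite -qE in q1 q2; split=> // i lin.
  by apply: q2; apply/mapP; exists i; rewrite // mem_iota.
have oq : onz a q.
  split=> [i j|i]; last exact: (qP i).1.
  rewrite neq_ltn => /orP[ij|ji]; last by apply: (qP i).2.
  by rewrite (formC pa); apply: (qP j).2.
exists q => // n x xq.
have [x0|x0] := eqVneq (a x x) 0; first by rewrite L_null // x0 mulr0 mul0r.
have xp : 0 < a x x by rewrite lt0r x0 (form_ge0 pa).
have [_ gn] := gP (mkseq q n); rewrite -qE in gn.
have /gn : cand (mkseq q n) ((Num.sqrt (a x x))^-1 *: x).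
  split.
    right; rewrite formZl formZr mulrA -invfM -expr2 sqr_sqrtr ?(form_ge0 pa) //.
    by rewrite mulVf.
  by move=> _ /mapP[i + ->]; rewrite mem_iota /= => lin; rewrite formZl xq // mulr0.
rewrite formZl formZr mulrA -invfM -expr2 sqr_sqrtr ?(form_ge0 pa) //.
by rewrite mulrC ler_pdivrMr // mulrAC.
Qed.

(** The values [L (q n) (q n)] are the terms of a series with partial sums at most [M], so they tend
    to 0. They dominate the residual, which is orthogonal to q_0, .., q_(n-1) and no longer than x.
    Convergence is measured by L alone. *)
Lemma greedy_residual (q : nat -> V) : onz a q ->
  (forall n x, (forall i, (i < n)%N -> a x (q i) = 0) ->
     L x x <= 2 * a x x * L (q n) (q n)) ->
  forall x, L (x - onz_proj a q n x) (x - onz_proj a q n x) @[n --> \oo] --> 0.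
Proof.
move=> oq qg x.
have Lq0 : L (q n) (q n) @[n --> \oo] --> 0.
  apply: cvg_series_cvg_0; apply: nondecreasing_is_cvgn.
    by apply: nondecreasing_series => i _ _; exact: (form_ge0 pL).
  by exists M => _ [n _ <-]; rewrite seriesEnat /= big_mkord; exact: L_trace.
apply: (@squeeze_cvgr _ _ _ _ (cst 0) (fun n => 2 * a x x * L (q n) (q n))).
- apply: nearW => n; rewrite (form_ge0 pL) /=.
  apply: le_trans (qg n _ _) _; first by move=> i lin; rewrite onz_proj_orth.
  by rewrite ler_wpM2r ?(form_ge0 pL) // ler_wpM2l // onz_residual_le.
- exact: cvg_cst.
- by rewrite -[X in _ --> X](mulr0 (2 * a x x)); apply: cvgMr.
Qed.

End GreedyBasis.

(** * Positive semidefinite forms of finite trace *)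

Section TraceClass.
Context {R : realType} {V : lmodType R}.
Variables (a L : {bilinear V -> V -> R}) (pa : psd_form a) (pL : psd_form L).
Variable M : R.
Hypothesis L_null : forall x, a x x = 0 -> L x x = 0.
Hypothesis L_trace : forall f n, onz a f -> \sum_(i < n) L (f i) (f i) <= M.
Variables (X : completeNormedModType R) (t : {bilinear V -> V -> X}).
Hypothesis t_le : forall x y, `|t x y| <= Num.sqrt (a x x) * Num.sqrt (a y y).

Let t_eps e x y z : 0 < e ->
  `|t x y| + `|t z x| <= a x x / e + e * (a y y + a z z).
Proof.
move=> e0; apply: le_trans (lerD (t_le _ _) (t_le _ _)) _.
rewrite [Num.sqrt (a z z) * _]mulrC.
apply: le_trans (lerD (amgm_eps _ _ e0) (amgm_eps _ _ e0)) _.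
rewrite !sqr_sqrtr ?(form_ge0 pa) //.
have yz0 : 0 <= e * (a y y + a z z) by rewrite mulr_ge0 ?addr_ge0 ?(form_ge0 pa) // ltW.
rewrite -subr_ge0 [leRHS](_ : _ = e * (a y y + a z z) / 2); last by field; rewrite gt_eqF.
by rewrite divr_ge0.
Qed.

(* A positive semidefinite form of finite trace is the limit of the compressions
   of L to the spans of q_0, .., q_(n-1); the Gram-Schmidt process for L diagonalizes
   all these compressions simultaneously. *)
Lemma psd_tensor : exists (c : nat -> nat -> V) (U : X),
  [/\ (\sum_(k < n) t (c n k) (c n k)) @[n --> \oo] --> U,
      forall n, \sum_(k < n) a (c n k) (c n k) <= M &
      forall x y, (\sum_(k < n) a (c n k) x * a (c n k) y) @[n --> \oo] --> L x y].
Proof.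
have [q oq qg] := greedy_basis pa L_null L_trace.
have q0 := greedy_residual pa pL L_trace oq qg.
have [f [of_ qf]] := gram_schmidt pL q.
have qf0 := gram_schmidt_orth of_ qf.
have qfE := gram_schmidt_expand of_ qf.
(* The numbers L(q_i, f_k) form the Cholesky factor of the Gram matrix L(q_i, q_j); [c n k] is its
   k-th column, cut off at n. By [qf0] the columns with k >= n are zero. *)
pose c n k := \sum_(i < n) L (q i) (f k) *: q i.
(* The entries gained when the cut-off moves from [m] to [n]; [e m n k] is the increment of the k-th
   column. *)
pose d m n k (i : 'I_n) := if (m <= i)%N then L (q i) (f k) else 0.
pose e m n k := \sum_(i < n) d m n k i *: q i.
have cS m n k : (m <= n)%N -> c n k = c m k + e m n k.
  move=> mn; rewrite /c -(big_mkord xpredT (fun i => L (q i) (f k) *: q i)).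
  rewrite (@big_cat_nat _ _ _ m 0 n) //= big_mkord; congr (_ + _).
  rewrite /e /d big_geq_mkord big_mkcond /=; apply: eq_bigr => i _.
  by case: ifP; rewrite ?scale0r.
pose S := series (fun i => L (q i) (q i)).
(* Orthonormality of q bounds the lengths by sums of squared coefficients. After exchanging the
   sums, Bessel's inequality for L and f leaves the tail of the series of L(q_i, q_i). *)
have tail m n N : (m <= n)%N -> \sum_(k < N) a (e m n k) (e m n k) <= S n - S m.
  move=> mn; apply: (@le_trans _ _ (\sum_(k < N) \sum_(i < n) d m n k i ^+ 2)).
    by apply: ler_sum => k _; exact: onz_sqr.
  rewrite exchange_big /S sub_series_geq //= big_geq_mkord [leRHS]big_mkcond /=.
  apply: ler_sum => i _; rewrite /d; case: ifP => _.
    exact: bessel.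
  by rewrite big1 // => k _; rewrite expr0n.
have SM n : S n <= M by rewrite /S seriesEnat /= big_mkord; exact: L_trace.
have c0 k : c 0%N k = 0 by rewrite /c big_ord0.
have cN n N : \sum_(k < N) a (c n k) (c n k) <= M.
  have S0 : S 0%N = 0 by rewrite /S seriesEnat /= big_geq.
  apply: le_trans (SM n); rewrite -[leRHS]subr0 -[X in _ - X]S0.
  apply: le_trans (tail _ _ N (leq0n n)); apply: ler_sum => k _.
  by rewrite (cS 0%N n) // c0 add0r.
pose A n := \sum_(k < n) t (c n k) (c n k).
have AE m n : (m <= n)%N -> A m = \sum_(k < n) t (c m k) (c m k).
  move=> mn; rewrite /A -!(big_mkord xpredT (fun k => t (c m k) (c m k))).
  rewrite [RHS](@big_cat_nat _ _ _ m 0 n) //= [X in _ = _ + X]big1_seq ?addr0 // => k.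
  rewrite mem_index_iota /= => /andP[mk _].
  rewrite {1}/c big1 ?linear0l // => i _.
  by rewrite qf0 ?scale0r // (leq_trans (ltn_ord i)).
(* The difference of squares is e (x) c_n + c_m (x) e. The free weight [eps] balances the small tail
   of e against the bounded traces of c_n and c_m. *)
have Adiff m n eps : (m <= n)%N -> 0 < eps ->
    `|A n - A m| <= (S n - S m) / eps + eps * (M + M).
  move=> mn e0; rewrite (AE m n) // /A -sumrB.
  apply: le_trans (ler_norm_sum _ _ _) _.
  apply: (@le_trans _ _ (\sum_(k < n) (a (e m n k) (e m n k) / eps +
      eps * (a (c n k) (c n k) + a (c m k) (c m k))))).
    apply: ler_sum => k _; apply: le_trans (t_eps _ _ _ e0).
    rewrite [X in `|X|](_ : _ = t (e m n k) (c n k) + t (c m k) (e m n k)) ?ler_normD //.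
    have eE : e m n k + c m k = c n k by rewrite addrC -cS.
    by apply/eqP; rewrite subr_eq -addrA -linearDr /= eE -linearDl eE.
  rewrite big_split /= -mulr_suml -mulr_sumr big_split /=.
  apply: lerD; first by rewrite ler_pM2r ?invr_gt0 //; exact: tail.
  by rewrite ler_pM2l //; apply: lerD; exact: cN.
have S_nd : nondecreasing_seq S.
  by apply: nondecreasing_series => i _ _; exact: (form_ge0 pL).
have S_cvg : cvgn S by apply: nondecreasing_is_cvgn => //; exists M => _ [n _ <-].
have M0 : 0 <= M by have := cN 0%N 0%N; rewrite big_ord0.
have A_cvg : cvgn A.
  apply/cauchy_cvgP/cauchy_exP => eps e0.
  (* With this weight [del * (M + M)] is at most [eps / 2]; the tail is then made smaller than
     [del * (eps / 2)]. *)
  pose del := eps / (4 * (M + 1)).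
  have M1 : 0 < M + 1 by rewrite ltr_wpDl.
  have del0 : 0 < del by rewrite divr_gt0 // mulr_gt0.
  have /cvgrPdist_lt/(_ (del * (eps / 2))) S_lim := S_cvg.
  have [|N _ hN] := S_lim; first by rewrite mulr_gt0 // divr_gt0.
  exists (A N); exists N => // n /= Nn.
  rewrite -ball_normE /ball_ /= distrC.
  apply: le_lt_trans (Adiff N n del Nn del0) _.
  have SnN : S n - S N < del * (eps / 2).
    apply: le_lt_trans (hN N _) => //=; apply: le_trans (ler_norm _).
    by rewrite lerD2r; exact: nondecreasing_cvgn_le.
  rewrite [ltRHS](splitr eps); apply: ltr_leD.
    by rewrite ltr_pdivrMr // mulrC.
  rewrite /del -mulrA; have -> : (4 * (M + 1))^-1 * (M + M) = M / (M + 1) / 2.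
    by field; rewrite gt_eqF.
  rewrite mulrA ler_pM2r ?invr_gt0 // ler_piMr ?ltW //.
  by rewrite ltr_pdivrMr // mul1r ltrDl.
exists c, (limn A); split; [exact: A_cvg|by move=> n; exact: cN|].
move=> x0 y0.
pose P := onz_proj a q.
have cE n k x : a (c n k) x = L (P n x) (f k).
  rewrite /c /P /onz_proj form_suml form_suml; apply: eq_bigr => i _.
  by rewrite mulrC (formC pa).
(* Parseval for L on the span of q_0, .., q_(n-1): the approximants represent L compressed by the
   projection [P n]. *)
have PE n x y : \sum_(k < n) a (c n k) x * a (c n k) y = L (P n x) (P n y).
  under eq_bigr do rewrite !cE.
  rewrite {3}/P /onz_proj form_suml.
  under [RHS]eq_bigr => i _ do rewrite (qfE n) ?ltn_ord // mulr_sumr.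
  rewrite exchange_big /=; apply: eq_bigr => k _.
  rewrite -[in RHS](formC pL (P n y)) {1}/P /onz_proj form_suml mulr_suml.
  by apply: eq_bigr => i _; rewrite mulrA.
under eq_cvg do rewrite PE.
(* In L(x - r x, y - r y) every term containing a residual tends to 0 by Cauchy-Schwarz for L. *)
pose r n x := x - P n x.
have rl z z' : L (r n z) z' @[n --> \oo] --> 0.
  apply: (cvg0_sqr_le (v := fun n => L (r n z) (r n z) * L z' z')).
    by move=> n; exact: form_CS.
  by rewrite -[X in _ --> X](mul0r (L z' z')); apply: cvgMl; exact: q0.
rewrite (_ : (fun n => _) =
    (fun n => L x0 y0 - L (r n x0) y0 - L (r n y0) x0 + L (r n x0) (r n y0))); last first.
  apply/funext => n; have zE z : P n z = z - r n z by rewrite /r opprB addrC subrK.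
  move: (zE x0) (zE y0) => -> ->; move: (r n x0) (r n y0) => u v.
  by rewrite linearBl !linearBr (formC pL v x0) /=; ring.
have lE : L x0 y0 - 0 - 0 + 0 = L x0 y0 by rewrite !subr0 addr0.
suff : (L x0 y0 - L (r n x0) y0 - L (r n y0) x0 + L (r n x0) (r n y0)) @[n --> \oo] -->
  L x0 y0 - 0 - 0 + 0 by rewrite lE.
apply: cvgD; last first.
  apply: (cvg0_sqr_le (v := fun n => L (r n x0) (r n x0) * L (r n y0) (r n y0))).
    by move=> n; exact: form_CS.
  by rewrite -[X in _ --> X](mulr0 (0 : R)); apply: cvgM; exact: q0.
by apply: cvgB; [apply: cvgB; [exact: cvg_cst|exact: rl]|exact: rl].
Qed.

End TraceClass.

(** * Projective tensor products *)

Section ProjectiveTensor.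
Context {R : realType} {V : lmodType R}.
Variable (N : V -> R).
Hypothesis N0 : forall x, 0 <= N x.
Variables (X : completeNormedModType R) (t : {bilinear V -> V -> X}).
Hypothesis tX : tensor_completion (pi_norm N N) t.

Definition tneg (s : seq (V * V)) := [seq (- p.1, p.2) | p <- s].

Lemma tsum_cat (Y : lmodType R) (b : V -> V -> Y) s s' :
  tsum b (s ++ s') = tsum b s + tsum b s'.
Proof. by rewrite /tsum big_cat. Qed.

Lemma tsum_neg (Y : lmodType R) (b : {bilinear V -> V -> Y}) s : tsum b (tneg s) = - tsum b s.
Proof.
by rewrite /tsum /tneg big_map -sumrN; apply: eq_bigr => p _; rewrite linearNl.
Qed.

Let piset s := [set \sum_(p <- s') N p.1 * N p.2 | s' in [set s' | tensor_eq s' s]].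

Let piset0 s : lbound (piset s) 0.
Proof. by move=> _ [s' _ <-]; apply: sumr_ge0 => p _; rewrite mulr_ge0. Qed.

Let piset_inf s : has_inf (piset s).
Proof. by split; [exists (\sum_(p <- s) N p.1 * N p.2), s|exists 0; exact: piset0]. Qed.

Lemma tensor_norm_le s s' : tensor_eq s' s -> `|tsum t s| <= \sum_(p <- s') N p.1 * N p.2.
Proof. by move=> ss'; rewrite tX.1; apply: (ge_inf (piset_inf s).2); exists s'. Qed.

Lemma tensor_le x y : `|t x y| <= N x * N y.
Proof.
have := @tensor_norm_le [:: (x, y)] [:: (x, y)] (fun _ => erefl).
by rewrite /tsum !big_seq1.
Qed.

Lemma le_tensor_norm (r : R) s :
  (forall s', tensor_eq s' s -> r <= \sum_(p <- s') N p.1 * N p.2) -> r <= `|tsum t s|.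
Proof.
move=> h; rewrite tX.1; apply: lb_le_inf; first exact: (piset_inf s).1.
by move=> _ [s' ss' <-]; exact: h.
Qed.

Lemma tensor_approx (U : X) (e : R) : 0 < e -> exists s, `|U - tsum t s| < e.
Proof.
move=> e0; have [_ tD] := tX.
have [|W [/= UW [s _ sW]]] := tD (ball U e) _ (ball_open U e).
  by exists U; exact: ballxx.
by exists s; rewrite sW; move: UW; rewrite -ball_normE.
Qed.

Lemma tensor_approx_seq (U : X) : exists s : nat -> seq (V * V), tsum t (s n) @[n --> \oo] --> U.
Proof.
have h n : exists s, `|U - tsum t s| < n.+1%:R^-1 by apply: tensor_approx.
exists (fun n => proj1_sig (cid (h n))); apply/cvgrPdist_lt => e e0.
near=> n; case: cid => s /= us; apply: lt_trans us _; near: n.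
by have := near_infty_natSinv_lt (PosNum e0).
Unshelve. all: by end_near. Qed.

(** P carries every representation of s to a representation of the image, at no larger cost. That it
    represents the image is tested on the bilinear forms [b (P x) (P y)]. *)
Lemma tensor_contract (P : V -> V) : linear P -> (forall x, N (P x) <= N x) ->
  forall s, `|tsum t [seq (P p.1, P p.2) | p <- s]| <= `|tsum t s|.
Proof.
move=> Pl PN s; apply: le_tensor_norm => s' ss'.
apply: (@le_trans _ _ (\sum_(p <- [seq (P p.1, P p.2) | p <- s']) N p.1 * N p.2)).
  apply: tensor_norm_le => b.
  have bl c x x' y : b (P (c *: x + x')) (P y) = c *: b (P x) (P y) + b (P x') (P y).
    by rewrite Pl linearPl.
  have br c x y y' : b (P x) (P (c *: y + y')) = c *: b (P x) (P y) + b (P x) (P y').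
    by rewrite Pl linearPr.
  by have := ss' (mk_bilinear bl br); rewrite /tsum !big_map.
by rewrite big_map; apply: ler_sum => p _ /=; apply: ler_pM.
Qed.

Section Extension.
Variables (b : {bilinear V -> V -> R}) (C : R).
Hypothesis C0 : 0 <= C.
Hypothesis b_le : forall x y, `|b x y| <= C * (N x * N y).

(** Every representation of s bounds [tsum b s], and [le_tensor_norm] passes to the infimum after
    division by C; hence the separate case C = 0. *)
Lemma tsum_le s : `|tsum b s| <= C * `|tsum t s|.
Proof.
have h s' : tensor_eq s' s -> `|tsum b s| <= C * \sum_(p <- s') N p.1 * N p.2.
  move=> <-; apply: le_trans (ler_norm_sum _ _ _) _.
  by rewrite mulr_sumr; apply: ler_sum => p _; exact: b_le.
move: C0; rewrite le_eqVlt => /predU1P[C_0|Cp].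
  by have := h s (fun _ => erefl); rewrite -C_0 !mul0r.
rewrite mulrC -ler_pdivrMr //; apply: le_tensor_norm => s' ss'.
by rewrite ler_pdivrMr // mulrC h.
Qed.

Lemma tsum_lip s s' : `|tsum b s - tsum b s'| <= C * `|tsum t s - tsum t s'|.
Proof. by have := tsum_le (s ++ tneg s'); rewrite !tsum_cat !tsum_neg. Qed.

(** The number r serves all approximating sequences at once; this is how a bounded bilinear form on
    V becomes a function on the completion. *)
Lemma ext_exists (U : X) : exists r : R, forall s : nat -> seq (V * V),
  tsum t (s n) @[n --> \oo] --> U -> tsum b (s n) @[n --> \oo] --> r.
Proof.
have [s0 s0U] := tensor_approx_seq U.
have lip0 s : tsum t (s n) @[n --> \oo] --> U ->
    tsum b (s n) - tsum b (s0 n) @[n --> \oo] --> 0.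
  move=> sU; apply/cvgr0Pnorm_lt => e e0.
  have h : C * `|tsum t (s n) - tsum t (s0 n)| @[n --> \oo] --> 0.
    rewrite -[X in _ --> X](mulr0 C); apply: cvgMr; rewrite -[X in _ --> X](normr0 X).
    apply: cvg_norm; rewrite -[X in _ --> X](subrr U); exact: cvgB.
  apply: filterS (cvgr0_norm_lt _ h _ e0) => n; apply: le_lt_trans.
  by apply: le_trans (tsum_lip _ _) _; exact: ler_norm.
have c0 : cvgn (fun n => tsum b (s0 n)).
  apply/cauchy_cvgP/cauchy_exP => e e0.
  have C1 : 0 < C + 1 by rewrite ltr_wpDl.
  have d0 : 0 < e / (C + 1) / 2 by rewrite !divr_gt0.
  have /cvgrPdist_lt/(_ _ d0)[n0 _ hn0] := s0U.
  exists (tsum b (s0 n0)); exists n0 => // n /= n0n.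
  rewrite -ball_normE /=; apply: le_lt_trans (tsum_lip _ _) _.
  apply: (@le_lt_trans _ _ (C * (e / (C + 1)))).
    rewrite ler_wpM2l // [leRHS]splitr.
    rewrite (_ : tsum t (s0 n0) - _ = (U - tsum t (s0 n)) - (U - tsum t (s0 n0))).
      by apply: le_trans (ler_normB _ _) _; rewrite lerD // ltW // hn0 //=.
    by rewrite opprB [RHS]addrC addrA subrK.
  by rewrite mulrCA gtr_pMr // ltr_pdivrMr // mul1r ltrDl.
exists (limn (fun n => tsum b (s0 n))) => s sU.
rewrite (_ : (fun n => _) = (fun n => (tsum b (s n) - tsum b (s0 n)) + tsum b (s0 n))).
  by rewrite -[X in _ --> X]add0r; apply: cvgD => //; exact: lip0.
by apply/funext => n; rewrite subrK.
Qed.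

End Extension.

Variable (a : {bilinear V -> V -> R}).
Hypotheses (pa : psd_form a) (Na : forall x, N x = Num.sqrt (a x x)).

Lemma tensor_null x y : N x = 0 -> t x y = 0.
Proof.
move=> x0; apply/eqP; rewrite -normr_eq0 eq_le normr_ge0 andbT.
by apply: le_trans (tensor_le _ _) _; rewrite x0 mul0r.
Qed.

Lemma tensor_null_r x y : N y = 0 -> t x y = 0.
Proof.
move=> y0; apply/eqP; rewrite -normr_eq0 eq_le normr_ge0 andbT.
by apply: le_trans (tensor_le _ _) _; rewrite y0 mulr0.
Qed.

(* Compressing to the span of the finitely many vectors of an approximating tensor
   is a contraction, and it sends U to 0. *)
Lemma tensor_separation (b : V -> V -> {linear X -> R}) (U : X) :
  (forall x y, continuous (b x y)) ->
  (forall x y w1 w2, b x y (t w1 w2) = a w1 x * a w2 y) ->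
  (forall x y, b x y U = 0) -> U = 0.
Proof.
move=> cb bt bU; apply/eqP; rewrite -normr_le0; apply/ler_addgt0Pr => e e0.
have [s sU] := tensor_approx U (divr_gt0 e0 (ltr0Sn R 1)).
(* The vectors occurring in both factors of s; past the end of the list the value is 0, which
   Gram-Schmidt tolerates. *)
pose x i := nth 0 ([seq p.1 | p <- s] ++ [seq p.2 | p <- s]) i.
pose n := size ([seq p.1 | p <- s] ++ [seq p.2 | p <- s]).
have [f [of_ xf]] := gram_schmidt pa x.
pose P := onz_proj a f n.
have Pl : linear P by exact: onz_proj_linear.
have PN z : N (P z) <= N z by rewrite !Na ler_wsqrtr // onz_proj_le.
(* P fixes the vectors of s only up to a difference of length zero. That is enough, since tensors
   with a factor of length zero vanish in X. *)
have Px z : z \in [seq p.1 | p <- s] ++ [seq p.2 | p <- s] -> N (z - P z) = 0.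
  move=> zs; rewrite -(nth_index 0 zs) -/(x _); set i := index _ _.
  have lin : (i < n)%N by rewrite index_mem.
  rewrite Na onz_pythagoras // (gram_schmidt_expand of_ xf _ lin).
  under eq_bigr => k _ do rewrite (formC pa (f k)) -expr2.
  by rewrite subrr sqrtr0.
have PsE : tsum t [seq (P p.1, P p.2) | p <- s] = tsum t s.
  rewrite /tsum big_map [LHS]big_seq [RHS]big_seq; apply: eq_bigr => p ps /=.
  have p1 : N (p.1 - P p.1) = 0 by apply: Px; rewrite mem_cat map_f.
  have p2 : N (p.2 - P p.2) = 0 by apply: Px; rewrite mem_cat map_f ?orbT.
  have := tensor_null (P p.2) p1; rewrite linearBl => /subr0_eq <-.
  by have := tensor_null_r p.1 p2; rewrite linearBr => /subr0_eq.
(* The operator P (x) P on all of X. Written with the functionals [b] it is visibly continuous and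
   kills U; on algebraic tensors it is the compression by P, so it is a contraction by density. *)
pose Q (W : X) : X := \sum_(i < n) \sum_(j < n) b (f i) (f j) W *: t (f i) (f j).
have Qs r : Q (tsum t r) = tsum t [seq (P p.1, P p.2) | p <- r].
  transitivity (\sum_(i < n) \sum_(p <- r) \sum_(j < n)
      (a p.1 (f i) * a p.2 (f j)) *: t (f i) (f j)).
    apply: eq_bigr => i _; rewrite exchange_big; apply: eq_bigr => j _.
    rewrite /tsum linear_sum scaler_suml; apply: eq_bigr => p _.
    by rewrite bt.
  rewrite exchange_big /tsum big_map; apply: eq_bigr => p _.
  rewrite [RHS]linear_sumlz; apply: eq_bigr => i _.
  rewrite linearZl_LR linear_sumr scaler_sumr; apply: eq_bigr => j _.
  by rewrite linearZr_LR /= scalerA.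
have QU : Q U = 0 by rewrite /Q big1 // => i _; rewrite big1 // => j _; rewrite bU scale0r.
have Q_lin : forall W W', Q (W - W') = Q W - Q W'.
  move=> W W'; rewrite /Q -sumrB; apply: eq_bigr => i _; rewrite -sumrB.
  by apply: eq_bigr => j _; rewrite linearB scalerBl.
have cQ : continuous Q.
  move=> W; apply: cvg_big => [|i _]; first exact: add_continuous.
  apply: cvg_big => [|j _]; first exact: add_continuous.
  by apply: cvgZr_tmp; exact: cb.
have Qle W : `|Q W| <= `|W|.
  have [r rW] := tensor_approx_seq W.
  have h1 : `|Q (tsum t (r k))| @[k --> \oo] --> `|Q W|.
    by apply: cvg_norm; apply: (cvg_comp _ _ rW); exact: cQ.
  have h2 : `|tsum t (r k)| @[k --> \oo] --> `|W| by exact: cvg_norm.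
  by apply: ler_cvg_to h1 h2 _; apply: nearW => k; rewrite Qs tensor_contract.
have sE : `|tsum t s| <= e / 2.
  rewrite -PsE -Qs -normrN -[X in `|X|]add0r -QU -Q_lin.
  by apply: le_trans (Qle _) _; exact: ltW.
rewrite add0r (splitr e) -[U](subrK (tsum t s)).
by apply: le_trans (ler_normD _ _) _; apply: lerD => //; exact: ltW.
Qed.

End ProjectiveTensor.

(** * Analysis on J *)

Section SquareIntegrable.
Context d (S : measurableType d) (R : realType) (mu : {measure set S -> \bar R}).

Lemma Lnorm2_sqr (f : S -> R) :
  ('N[mu]_2%:E[EFin \o f] `^ 2 = \int[mu]_x (f x ^+ 2)%:E)%E.
Proof.
rewrite poweR_Lnorm //; apply: eq_integral => x _ /=.
by rewrite powR_mulrn // real_normK ?num_real.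
Qed.

Lemma Lfun2_sqrP (f : S -> R) : measurable_fun setT f ->
  mu.-integrable setT (EFin \o (fun x => f x ^+ 2)) -> f \in Lfun mu 2%:E.
Proof.
move=> mf /integrableP[_ fi]; rewrite inE; apply/andP; split; rewrite inE //=.
rewrite /finite_norm unlock poweR_lty //; apply: le_lt_trans fi.
rewrite le_eqVlt; apply/orP; left; apply/eqP; apply: eq_integral => x _ /=.
by rewrite powR_mulrn // real_normK ?num_real // ger0_norm // sqr_ge0.
Qed.

Lemma Lfun2_measurable (f : S -> R) : f \in Lfun mu 2%:E -> measurable_fun setT f.
Proof. by rewrite inE => /andP[]; rewrite inE. Qed.

Lemma Lfun2_mul_integrable (f g : S -> R) : f \in Lfun mu 2%:E -> g \in Lfun mu 2%:E ->
  mu.-integrable setT (EFin \o (fun x => f x * g x)).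
Proof. by move=> f2 g2; apply/Lfun1_integrable; exact: Lfun2_mul_Lfun1. Qed.

Lemma Lfun2_abs (f : S -> R) : f \in Lfun mu 2%:E -> (fun x => `|f x|) \in Lfun mu 2%:E.
Proof.
move=> f2; apply: Lfun2_sqrP.
  by apply: measurableT_comp => //; exact: Lfun2_measurable f2.
apply: eq_integrable (Lfun2_mul_integrable f2 f2) => // x _ /=.
by rewrite real_normK ?num_real.
Qed.

End SquareIntegrable.

Section Interval.
Context {R : realType} (T : R).
Local Notation mu := (muJ T).
Local Notation J := (`]0, T[%classic : set R).
Local Notation leb := (@lebesgue_measure R).

Lemma muJ_out : mu (~` J) = 0%E.
Proof. by rewrite /muJ /mrestr /= setICl measure0. Qed.

(** [muJ] is a measure on the whole line concentrated on J, so what is known only inside J holds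
    almost everywhere. *)
Lemma muJ_ae (P : R -> Prop) : (forall t, 0 < t < T -> P t) -> {ae mu, forall t, P t}.
Proof.
move=> h; exists (~` J); split; [exact: measurableC|exact: muJ_out|].
by move=> t /= nP tJ; apply: nP; apply: h; move: tJ; rewrite /= in_itv.
Qed.

Lemma muJ_fin_num : mu setT \is a fin_num.
Proof. exact: (@muJ_fin R T). Qed.

Lemma integrableJP (f : R -> R) : measurable_fun setT f ->
  mu.-integrable setT (EFin \o f) <-> mu.-integrable J (EFin \o f).
Proof.
move=> mf; rewrite (@negligible_integrable _ _ _ mu setT (~` J)) ?setTD ?setCK //.
- exact: measurableC.
- exact/measurable_EFinP.
- exact: muJ_out.
Qed.

Lemma eq_RintegralJ (f g : R -> R) : measurable_fun setT f -> measurable_fun setT g ->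
  (forall t, 0 < t < T -> f t = g t) -> \int[mu]_t f t = \int[mu]_t g t.
Proof.
move=> mf mg fg; congr fine; apply: ae_eq_integral => //.
- exact/measurable_EFinP.
- exact/measurable_EFinP.
- by apply: muJ_ae => t tJ _ /=; rewrite fg.
Qed.

Lemma eq_Rintegral_ae (f g : R -> R) : measurable_fun setT f -> measurable_fun setT g ->
  {ae mu, forall t, f t = g t} -> \int[mu]_t f t = \int[mu]_t g t.
Proof.
move=> mf mg fg; congr fine; apply: ae_eq_integral => //.
- exact/measurable_EFinP.
- exact/measurable_EFinP.
- have [N [mN N0 sN]] := fg; exists N; split=> // t /= nt; apply: sN => /= tE.
  by apply: nt => _; rewrite /= tE.
Qed.

(** Measurability is asked on the whole line, where [muJ] lives, but the bound only on J: the
    estimates for kernels and for elements of [F] are available there. *)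
Definition bddJ (M : R) (h : R -> R) : Prop :=
  measurable_fun setT h /\ forall t, 0 < t < T -> `|h t| <= M.

Lemma bddJ_cst c : bddJ `|c| (cst c).
Proof. by []. Qed.

Lemma integrable_mul_bddJ M f h : mu.-integrable setT (EFin \o f) -> bddJ M h ->
  mu.-integrable setT (EFin \o (fun t => f t * h t)).
Proof.
move=> fi [mh hM].
have mf : measurable_fun setT f by apply/measurable_EFinP; exact: (measurable_int mu).
have mfh : measurable_fun setT (fun t => f t * h t) by exact: measurable_funM.
apply/(integrableJP mfh); apply: (@le_integrable _ _ _ mu J _ _ (EFin \o (fun t => M * f t))) => //.
- by apply/measurable_EFinP; apply: measurable_funS mfh.
- move=> t /=; rewrite in_itv /= => tJ; rewrite lee_fin !normrM mulrC ler_wpM2r //.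
  by apply: le_trans (ler_norm _); exact: hM.
- apply/integrableJP; first exact: measurable_funM.
  exact: (integrableZl measurableT M fi).
Qed.

Lemma bddJ_integrable M h : bddJ M h -> mu.-integrable setT (EFin \o h).
Proof.
move=> bh; have h1 : mu.-integrable setT (EFin \o (cst 1 : R -> R)).
  by apply: finite_measure_integrable_cst.
by apply: eq_integrable (integrable_mul_bddJ h1 bh) => // t _ /=; rewrite mul1r.
Qed.

Lemma Lfun2_mul_bddJ M f h : f \in Lfun mu 2%:E -> bddJ M h ->
  (fun t => f t * h t) \in Lfun mu 2%:E.
Proof.
move=> f2 [mh hM]; apply: Lfun2_sqrP.
  by apply: measurable_funM => //; exact: Lfun2_measurable f2.
apply: eq_integrable (@integrable_mul_bddJ (M ^+ 2) (fun t => f t * f t) (fun t => h t ^+ 2) _ _) => //.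
- by move=> t _ /=; rewrite exprMn expr2.
- exact: Lfun2_mul_integrable.
- split; first exact: measurable_funX.
  by move=> t tJ; rewrite normrX lerXn2r ?nnegrE ?hM // (le_trans _ (hM t tJ)).
Qed.

Lemma Lfun2_cst (c : R) : cst c \in Lfun mu 2%:E.
Proof. exact: Lfun_cst. Qed.

Lemma bddJ_Lfun2 M h : bddJ M h -> h \in Lfun mu 2%:E.
Proof.
move=> bh; have hE : (fun t => cst 1 t * h t) = h by apply/funext => t /=; rewrite mul1r.
by rewrite -hE; apply: Lfun2_mul_bddJ bh; exact: Lfun2_cst.
Qed.

Lemma Lfun2_integrable f : f \in Lfun mu 2%:E -> mu.-integrable setT (EFin \o f).
Proof.
by move=> f2; apply/Lfun1_integrable; apply: (Lfun_subset12 muJ_fin_num).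
Qed.

Lemma le_RintegralJ (f g : R -> R) : mu.-integrable setT (EFin \o f) ->
  mu.-integrable setT (EFin \o g) -> (forall t, 0 < t < T -> f t <= g t) ->
  \int[mu]_t f t <= \int[mu]_t g t.
Proof.
move=> fi gi fg.
have mf : measurable_fun setT f by apply/measurable_EFinP; exact: (measurable_int mu).
have mg : measurable_fun setT g by apply/measurable_EFinP; exact: (measurable_int mu).
have mJ : measurable J by [].
have E k : measurable_fun setT k -> \int[mu]_t k t = \int[mu]_t (k \_ J) t.
  move=> mk; apply: eq_RintegralJ => //.
    by apply/(measurable_restrictT _ _).1 => //; exact: measurable_funS mk.
  by move=> t tJ; rewrite patchE mem_set //= in_itv.
rewrite (E f) // (E g) // -!Rintegral_mkcond; apply: le_Rintegral => //.
- exact/integrableJP.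
- exact/integrableJP.
Qed.

Lemma Rintegral_leb (f : R -> R) (a b : R) : 0 <= a -> b <= T ->
  \int[mu]_(t in `]a, b[) f t = \int[leb]_(t in `]a, b[) f t.
Proof.
move=> a0 bT; congr fine; apply: eq_measure_integral => A mA Aab.
rewrite /= /muJ /mrestr /=; congr (leb _); apply/setIidPl => t /Aab /=.
rewrite !in_itv /= => /andP[at_ tb].
by rewrite (le_lt_trans a0 at_) (lt_le_trans tb bT).
Qed.

(** The integrand is cut off by a condition instead of restricting the domain, so that it can be
    matched with integrals against [kern], which carries the same kind of cut-off. *)
Lemma muJ_FTC2 (f F : R -> R) (a b : R) : 0 <= a -> a <= b -> b <= T ->
  continuous f -> (forall x : R, is_derive x 1 F (f x)) ->
  \int[mu]_t (if a < t < b then f t else 0) = F b - F a.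
Proof.
move=> a0 ab bT cf dF.
have [<-|nab] := eqVneq a b.
  rewrite subrr (_ : (fun t => _) = cst 0) ?Rintegral_cst ?mul0r //.
  by apply/funext => t; case: ifP => // /andP[/lt_trans h /h]; rewrite ltxx.
have {nab} {}ab : a < b by rewrite lt_neqAle nab.
have cF : continuous F by move=> x; apply/differentiable_continuous/derivable1_diffP.
rewrite (_ : (fun t => _) = f \_ `]a, b[); last first.
  apply/funext => t; rewrite patchE; case: ifPn => tab.
    by rewrite mem_set //= in_itv.
  by rewrite memNset //= in_itv /=; exact/negP.
rewrite -Rintegral_mkcond Rintegral_leb //.
have fi : leb.-integrable `[a, b] (EFin \o f).
  apply: continuous_compact_integrable; first exact: segment_compact.
  exact: continuous_subspaceT.
rewrite Rintegral_itv_obnd_cbnd; last first.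
  by apply: integrableS fi => //; exact: subset_itv_oo_cc.
rewrite Rintegral_itv_bndo_bndc; last first.
  by apply: integrableS fi => //; exact: subset_itv_co_cc.
rewrite /Rintegral (@continuous_FTC2 _ f F) //.
- exact: continuous_subspaceT.
- by split; [move=> x _; exact: ex_derive|exact/cvg_at_right_filter/cF
            |exact/cvg_at_left_filter/cF].
- by move=> x _; rewrite derive1E; exact: derive_val.
Qed.

(** Tonelli's theorem with domination by a product; a bound on J x J is enough because the
    complement of J is null in each variable. *)
Lemma FubiniJ (G : R * R -> R) (f g : R -> R) : measurable_fun setT G ->
  mu.-integrable setT (EFin \o f) -> mu.-integrable setT (EFin \o g) ->
  (forall t s, 0 < t < T -> 0 < s < T -> `|G (t, s)| <= `|f t| * `|g s|) ->
  (mu \x mu)%E.-integrable setT (EFin \o G).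
Proof.
move=> mG fi gi Gfg.
have mf : measurable_fun setT f by apply/measurable_EFinP; exact: (measurable_int mu).
have mg : measurable_fun setT g by apply/measurable_EFinP; exact: (measurable_int mu).
have mG1 t : measurable_fun setT (fun s => G (t, s)) by exact: measurableT_comp.
apply/integrable12ltyP; first exact/measurable_EFinP.
apply: (@le_lt_trans _ _ (\int[mu]_t (`|f t|%:E * \int[mu]_s `|g s|%:E))%E); last first.
  have /integrableP[_ fi'] := fi; have /integrableP[_ gi'] := gi.
  have gfin : (\int[mu]_s `|g s|%:E)%E \is a fin_num.
    by rewrite ge0_fin_numE // integral_ge0.
  rewrite -(fineK gfin) ge0_integralZr //.
  - rewrite muleC lte_mul_pinfty //.
    by rewrite lee_fin; apply: fine_ge0; apply: integral_ge0.
  - by apply/measurable_EFinP; exact: measurableT_comp.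
  - by rewrite lee_fin; apply: fine_ge0; apply: integral_ge0.
apply: ae_ge0_le_integral => //.
- by move=> t _; apply: integral_ge0.
- apply: (@measurable_fun_fubini_tonelli_F _ _ _ _ _ mu (fun x => `|(EFin \o G) x|%E)) => //.
  by apply/measurable_EFinP; exact: measurableT_comp.
- by move=> t _; rewrite mule_ge0 // integral_ge0.
- apply: emeasurable_funM; last exact: measurable_cst.
  by apply/measurable_EFinP; exact: measurableT_comp.
- apply: muJ_ae => t tJ _; rewrite -ge0_integralZl //; last first.
  - by apply/measurable_EFinP; exact: measurableT_comp.
  apply: ae_ge0_le_integral => //.
  - by apply: measurableT_comp => //; apply/measurable_EFinP; exact: mG1.
  - by apply/measurable_EFinP; apply: measurable_funM => //; exact: measurableT_comp.
  - by apply: muJ_ae => s sJ _; rewrite /= lee_fin Gfg.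
Qed.

End Interval.

Section RFubini.
Context d (S : measurableType d) (R : realType)
  (mu : {sigma_finite_measure set S -> \bar R}).
Variables (G : S * S -> R).
Hypothesis Gi : (mu \x mu)%E.-integrable setT (EFin \o G).

Let ae_fine : {ae mu, forall t, setT t ->
  (fine (\int[mu]_s (G (t, s))%:E))%:E = (\int[mu]_s (G (t, s))%:E)%E}.
Proof.
have [N [mN N0 sN]] := ae_integrable1 Gi; exists N; split=> // t /= nt; apply: sN => /= tE.
apply: nt => _; rewrite fineK //; exact: integrable_fin_num tE.
Qed.

Lemma measurable_Rintegral1 : measurable_fun setT (fun t => \int[mu]_s G (t, s)).
Proof.
apply: measurableT_comp; first exact: fine_measurable.
exact: (measurable_fubini_F Gi).
Qed.

(** The inner integral is finite only for almost every t, so its real value agrees with the extended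
    one merely almost everywhere. *)
Lemma Rintegral12 :
  \int[mu]_t \int[mu]_s G (t, s) = fine (\int[(mu \x mu)%E]_x (G x)%:E).
Proof.
congr fine; rewrite -(integral12_prod_meas1 Gi); apply: ae_eq_integral => //.
- by apply/measurable_EFinP; exact: measurable_Rintegral1.
- exact: (measurable_fubini_F Gi).
Qed.

End RFubini.

Lemma Rfubini d (S : measurableType d) (R : realType)
    (mu : {sigma_finite_measure set S -> \bar R}) (G : S * S -> R) :
  (mu \x mu)%E.-integrable setT (EFin \o G) ->
  \int[mu]_t \int[mu]_s G (t, s) = \int[mu]_s \int[mu]_t G (t, s).
Proof.
move=> Gi; rewrite (Rintegral12 Gi) -(integral21_prod_meas1 Gi).
congr fine; apply/esym; apply: ae_eq_integral => //.
- apply/measurable_EFinP; apply: measurableT_comp; first exact: fine_measurable.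
  exact: (measurable_fubini_G Gi).
- exact: (measurable_fubini_G Gi).
- have [N [mN N0 sN]] := ae_integrable2 Gi; exists N; split=> // t /= nt; apply: sN => /= tE.
  apply: nt => _; rewrite fineK //; exact: integrable_fin_num tE.
Qed.

(** * Exponential Volterra kernels *)

Section Kernel.
Context {R : realType} (T : R).
Hypothesis T0 : 0 < T.
Local Notation mu := (muJ T).
Implicit Types (a b t s : R) (f g h q : R -> R).

(** One family covers all kernels of the proof: the exponent - lam gives k_t, - 2 lam gives K, and m
    = rho^2 - 2 lam gives the resolvent. *)
Definition kern a t s : R := if t < s then expR (a * (s - t)) else 0.

Lemma kern_ge0 a t s : 0 <= kern a t s.
Proof. by rewrite /kern; case: ifP => // _; exact: expR_ge0. Qed.

(** Both factors carry the same condition t < s, so the exponents add; in particular the square of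
    k_t is the kernel of K. *)
Lemma kern_mul a b t s : kern a t s * kern b t s = kern (a + b) t s.
Proof. by rewrite /kern; case: ifP; rewrite ?mulr0 // -expRD mulrDl. Qed.

Lemma measurable_kern2 a : measurable_fun setT (fun x : R * R => kern a x.1 x.2).
Proof.
apply: measurable_fun_ifT => //; first exact: measurable_fun_ltr.
apply: measurableT_comp => //; apply: measurable_funM => //; exact: measurable_funB.
Qed.

Lemma measurable_kern a t : measurable_fun setT (kern a t).
Proof. exact: (measurableT_comp (measurable_kern2 a) (pair1_measurable t)). Qed.

Lemma measurable_kernl a s : measurable_fun setT (kern a ^~ s).
Proof. exact: (measurableT_comp (measurable_kern2 a) (pair2_measurable s)). Qed.

Lemma kern_le a t s : 0 <= t -> s <= T -> kern a t s <= expR (`|a| * T).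
Proof.
move=> t0 sT; rewrite /kern; case: ifP => ts; last exact: expR_ge0.
rewrite ler_expR; apply: le_trans (ler_norm _) _; rewrite normrM ler_wpM2l //.
by rewrite gtr0_norm ?subr_gt0 // lerBlDr ler_wpDr.
Qed.

Lemma bddJ_kern a t : 0 <= t -> bddJ T (expR (`|a| * T)) (kern a t).
Proof.
move=> t0; split; first exact: measurable_kern.
by move=> s /andP[s0 sT]; rewrite ger0_norm ?kern_ge0 // kern_le // ltW.
Qed.

Lemma muJT : fine (mu setT) = T.
Proof.
rewrite /muJ /mrestr /= setTI lebesgue_measure_itv /= lte_fin T0 -EFinB /= subr0.
by [].
Qed.

Lemma Rintegral_le_cst f C : mu.-integrable setT (EFin \o f) ->
  (forall t, 0 < t < T -> `|f t| <= C) -> `|\int[mu]_t f t| <= C * T.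
Proof.
move=> fi fC; apply: le_trans (le_normr_Rintegral measurableT fi) _.
rewrite -[X in _ <= C * X]muJT -(Rintegral_cst mu measurableT C); apply: le_RintegralJ => //.
  exact: integrable_norm.
exact: finite_measure_integrable_cst.
Qed.

Definition Kop a h t := \int[mu]_s (kern a t s * h s).

Lemma kern_integrable a t h : 0 <= t -> mu.-integrable setT (EFin \o h) ->
  mu.-integrable setT (EFin \o (fun s => kern a t s * h s)).
Proof.
move=> t0 hi; apply: eq_integrable (integrable_mul_bddJ hi (bddJ_kern a t0)) => // s _ /=.
by rewrite mulrC.
Qed.

Lemma measurable_integrable h : mu.-integrable setT (EFin \o h) -> measurable_fun setT h.
Proof. by move=> hi; apply/measurable_EFinP; exact: (measurable_int mu). Qed.

Lemma kern_prod_integrable a f h : mu.-integrable setT (EFin \o f) ->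
  mu.-integrable setT (EFin \o h) ->
  (mu \x mu)%E.-integrable setT (EFin \o (fun x => f x.1 * (kern a x.1 x.2 * h x.2))).
Proof.
move=> fi hi; have mf := measurable_integrable fi; have mh := measurable_integrable hi.
apply: (FubiniJ (f := f) (g := fun s => expR (`|a| * T) * h s)) => //.
- apply: measurable_funM; first exact: measurableT_comp.
  by apply: measurable_funM; [exact: measurable_kern2|exact: measurableT_comp].
- exact: (integrableZl measurableT (expR (`|a| * T)) hi).
- move=> t s /andP[t0 _] /andP[_ sT] /=; rewrite !normrM ler_wpM2l // ler_wpM2r //.
  rewrite (ger0_norm (kern_ge0 _ _ _)) (ger0_norm (expR_ge0 _)).
  by rewrite kern_le // ltW.
Qed.

Lemma kernr_prod_integrable a f h : mu.-integrable setT (EFin \o f) ->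
  mu.-integrable setT (EFin \o h) ->
  (mu \x mu)%E.-integrable setT (EFin \o (fun x => f x.1 * (kern a x.2 x.1 * h x.2))).
Proof.
move=> fi hi; have mf := measurable_integrable fi; have mh := measurable_integrable hi.
apply: (FubiniJ (f := f) (g := fun s => expR (`|a| * T) * h s)) => //.
- apply: measurable_funM; first exact: measurableT_comp.
  apply: measurable_funM; last exact: measurableT_comp.
  have mswap : measurable_fun setT (fun x : R * R => (x.2, x.1)) by exact: measurable_fun_pair.
  exact: (measurableT_comp (measurable_kern2 a) mswap).
- exact: (integrableZl measurableT (expR (`|a| * T)) hi).
- move=> t s /andP[_ tT] /andP[s0 _] /=; rewrite !normrM ler_wpM2l // ler_wpM2r //.
  rewrite (ger0_norm (kern_ge0 _ _ _)) (ger0_norm (expR_ge0 _)).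
  by rewrite kern_le // ltW.
Qed.

Let cst1_integrable : mu.-integrable setT (EFin \o (cst 1 : R -> R)).
Proof. exact: finite_measure_integrable_cst. Qed.

Lemma measurable_Kop a h : mu.-integrable setT (EFin \o h) -> measurable_fun setT (Kop a h).
Proof.
move=> hi; have := measurable_Rintegral1 (kern_prod_integrable a cst1_integrable hi).
by apply: eq_measurable_fun => t _; apply: eq_Rintegral => s _ /=; rewrite mul1r.
Qed.

Lemma measurable_kernr_int a f : mu.-integrable setT (EFin \o f) ->
  measurable_fun setT (fun s => \int[mu]_t (kern a t s * f t)).
Proof.
move=> fi; have := measurable_Rintegral1 (kernr_prod_integrable a cst1_integrable fi).
by apply: eq_measurable_fun => t _; apply: eq_Rintegral => s _ /=; rewrite mul1r.
Qed.

Lemma kernr_integrable a s f : s <= T -> mu.-integrable setT (EFin \o f) ->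
  mu.-integrable setT (EFin \o (fun t => kern a t s * f t)).
Proof.
move=> sT fi; have mf := measurable_integrable fi.
apply: eq_integrable (@integrable_mul_bddJ _ _ (expR (`|a| * T)) f (kern a ^~ s) fi _) => //.
  by move=> t _ /=; rewrite mulrC.
split; first exact: measurable_kernl.
by move=> t /andP[t0 _]; rewrite ger0_norm ?kern_ge0 // kern_le // ltW.
Qed.

(** Moves [Kop a] off h: its adjoint integrates over earlier times instead of later ones. *)
Lemma kern_fubini a f h : mu.-integrable setT (EFin \o f) ->
  mu.-integrable setT (EFin \o h) ->
  \int[mu]_t (f t * Kop a h t) = \int[mu]_s (h s * \int[mu]_t (kern a t s * f t)).
Proof.
move=> fi hi; have mf := measurable_integrable fi; have mh := measurable_integrable hi.
have Gi := kern_prod_integrable a fi hi.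
transitivity (\int[mu]_t \int[mu]_s (f t * (kern a t s * h s))).
  have mG := measurable_Rintegral1 Gi.
  apply: eq_RintegralJ => //; first exact: measurable_funM (measurable_Kop a hi).
  by move=> t /andP[t0 _]; rewrite -RintegralZl //; apply: kern_integrable => //; exact: ltW.
rewrite (Rfubini Gi) /=; apply: eq_RintegralJ.
- have := measurable_Rintegral1 (kernr_prod_integrable a hi fi).
  by apply: eq_measurable_fun => t _; apply: eq_Rintegral => s _ /=; ring.
- exact: measurable_funM (measurable_kernr_int a fi).
- move=> s /andP[_ sT]; rewrite -RintegralZl //; last by apply: kernr_integrable => //; exact: ltW.
  by apply: eq_Rintegral => t _ /=; ring.
Qed.

End Kernel.

Section Volterra.
Context {R : realType} (T : R).
Hypothesis T0 : 0 < T.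
Local Notation mu := (muJ T).
Local Notation Kop := (Kop T).
Implicit Types (a b t s : R) (f g h q : R -> R).

Lemma integral_kern_le a f (k : R -> R) : measurable_fun setT k ->
  (forall t, 0 < t < T -> 0 <= k t <= expR (`|a| * T)) -> mu.-integrable setT (EFin \o f) ->
  `|\int[mu]_t (k t * f t)| <= expR (`|a| * T) * \int[mu]_t `|f t|.
Proof.
move=> mk kb fi.
have kfi : mu.-integrable setT (EFin \o (fun t => k t * f t)).
  have bk : bddJ T (expR (`|a| * T)) k.
    by split=> // t /kb /andP[k0 k1]; rewrite ger0_norm.
  by apply: eq_integrable (integrable_mul_bddJ fi bk) => // t _ /=; rewrite mulrC.
apply: le_trans (le_normr_Rintegral measurableT kfi) _.
have nfi := integrable_norm fi.
rewrite -RintegralZl //; apply: le_RintegralJ.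
- exact: (integrable_norm kfi).
- exact: (integrableZl measurableT (expR (`|a| * T)) nfi).
- by move=> t /kb /andP[k0 k1]; rewrite normrM ler_wpM2r // ger0_norm.
Qed.

Lemma Kop_bdd a h : mu.-integrable setT (EFin \o h) ->
  bddJ T (expR (`|a| * T) * \int[mu]_t `|h t|) (Kop a h).
Proof.
move=> hi; split; first exact: measurable_Kop.
move=> t /andP[t0 _]; apply: integral_kern_le => //; first exact: measurable_kern.
by move=> s /andP[_ sT]; rewrite kern_ge0 kern_le // ltW.
Qed.

Lemma kernr_bdd a h : mu.-integrable setT (EFin \o h) ->
  bddJ T (expR (`|a| * T) * \int[mu]_t `|h t|) (fun s => \int[mu]_t (kern a t s * h t)).
Proof.
move=> hi; split; first exact: measurable_kernr_int.
move=> s /andP[_ sT]; apply: integral_kern_le => //; first exact: measurable_kernl.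
by move=> t /andP[t0 _]; rewrite kern_ge0 kern_le // ltW.
Qed.

Lemma is_derive_expR_affine (c d x : R) :
  is_derive x 1 (fun t : R => expR (c * t + d)) (c * expR (c * x + d)).
Proof.
have h : is_derive x 1 (fun t : R => c * t + d) c.
  apply: is_derive_eq; rewrite /GRing.scale /= mulr1 addr0 ?mulr0 ?add0r //.
have := @is_derive1_comp _ expR (fun t => c * t + d) x _ _ (is_derive_expR (c * x + d)) h.
by rewrite mulrC.
Qed.

Lemma continuous_affine_expR (c d : R) : continuous (fun t : R => expR (c * t + d)).
Proof.
move=> x; apply/differentiable_continuous/derivable1_diffP.
by have h := is_derive_expR_affine c d x; exact: ex_derive.
Qed.

(** The product of the kernels is exp((a - b) s) up to a constant factor on (t, r). Keeping a - b on
    the left, instead of dividing by it, includes the case a = b. *)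
Lemma kern_kern a b t r : 0 <= t -> r <= T ->
  (a - b) * \int[mu]_s (kern b s r * kern a t s) = kern a t r - kern b t r.
Proof.
move=> t0 rT; pose F s := expR ((a - b) * s + (b * r - a * t)).
have E s : kern b s r * kern a t s = if t < s < r then F s else 0.
  rewrite /kern; case: (ltP s r) => sr; case: (ltP t s) => ts /=; rewrite ?mul0r ?mulr0 //.
  by rewrite -expRD; congr expR; ring.
under eq_Rintegral do rewrite E.
have [tr|rt] := ltP t r; last first.
  rewrite [X in _ * X](_ : _ = 0) ?mulr0 /kern ?ltNge ?rt ?subrr //.
  rewrite (_ : (fun s => _) = cst 0) ?Rintegral_cst ?mul0r //.
  by apply/funext => s; case: ifP => // /andP[ts sr]; have := lt_trans ts sr; rewrite ltNge rt.
have cF : continuous F by exact: continuous_affine_expR.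
have := muJ_FTC2 (f := fun s => (a - b) * F s) (F := F) t0 (ltW tr) rT.
move=> /(_ (fun x => cvgMr (cF x)) (is_derive_expR_affine _ _)) => FTC.
have Fi : mu.-integrable setT (EFin \o (fun s => if t < s < r then F s else 0)).
  have c1 : mu.-integrable setT (EFin \o (kern a t)).
    by apply: bddJ_integrable (bddJ_kern _ _ t0).
  have := kernr_integrable b rT c1.
  by rewrite (_ : _ \o _ = EFin \o (fun s => if t < s < r then F s else 0)) //; apply/funext => s /=; rewrite E.
rewrite -RintegralZl //.
transitivity (F r - F t).
  rewrite -FTC; apply: eq_Rintegral => s _ /=; case: ifP => // _; exact: mulr0.
by rewrite /kern tr /F; congr (expR _ - expR _); ring.
Qed.

(** The resolvent identity for Volterra operators; Fubini reduces it to the convolution of two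
    kernels in [kern_kern]. *)
Lemma resolvent a b h t : 0 <= t -> mu.-integrable setT (EFin \o h) ->
  (a - b) * Kop a (Kop b h) t = Kop a h t - Kop b h t.
Proof.
move=> t0 hi; have mh := measurable_integrable hi.
have ki c : mu.-integrable setT (EFin \o kern c t).
  by apply: bddJ_integrable (bddJ_kern _ _ t0).
have khi c := kern_integrable c t0 hi.
rewrite /Kop kern_fubini // -RintegralB //.
have Hi : mu.-integrable setT (EFin \o (fun s => h s * \int[mu]_r (kern b r s * kern a t r))).
  exact: integrable_mul_bddJ (kernr_bdd _ (ki a)).
rewrite -RintegralZl //; apply: eq_RintegralJ.
- exact: measurable_funM (measurable_integrable Hi).
- apply: measurable_funB; exact: measurable_integrable.
- move=> s /andP[_ sT]; rewrite mulrCA kern_kern //; last exact: ltW.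
  by ring.
Qed.

Lemma continuous_bddJ f : continuous f -> exists M, bddJ T M f.
Proof.
move=> cf; have /compact_bounded[M [_ fM]] := continuous_compact
  (continuous_subspaceT cf) (@segment_compact R 0 T).
exists (`|M| + 1); split; first exact: continuous_measurable_fun.
move=> t /andP[t0 tT]; apply: (fM (`|M| + 1)); first by rewrite (le_lt_trans (ler_norm M)) // ltrDl.
by exists t => //=; rewrite in_itv /= !ltW.
Qed.

Lemma continuous_integrable f : continuous f -> mu.-integrable setT (EFin \o f).
Proof. by move=> cf; apply/Lfun2_integrable/continuous_Lfun2. Qed.

Lemma integrable_cst1 : mu.-integrable setT (EFin \o (cst 1 : R -> R)).
Proof. exact: finite_measure_integrable_cst. Qed.

(** Integration by parts for u = [Kop a q], which satisfies - u' = q + a u with u(T) = 0; the other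
    boundary term is removed by f(0) = 0. As q is only integrable, Fubini first moves the work to
    the kernel, which is smooth up to s. *)
Lemma Kop_parts a q f f' : mu.-integrable setT (EFin \o q) ->
  (forall x : R, is_derive x 1 f (f' x)) -> continuous f' -> f 0 = 0 ->
  \int[mu]_t (f' t * Kop a q t) = \int[mu]_t (q t * f t) + a * \int[mu]_t (f t * Kop a q t).
Proof.
move=> qi df cf' f00.
have cf : continuous f by move=> x; apply/differentiable_continuous/derivable1_diffP.
have fi := continuous_integrable cf; have f'i := continuous_integrable cf'.
(* The fundamental theorem for t |-> exp(a (s - t)) f(t) on (0, s). *)
have parts s : 0 < s < T ->
    \int[mu]_t (kern a t s * f' t) = f s + a * \int[mu]_t (kern a t s * f t).
  move=> /andP[s0 sT]; rewrite -RintegralZl //; last by apply: kernr_integrable => //; exact: ltW.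
  pose e t := expR (- a * t + a * s).
  have de (x : R) := is_derive_expR_affine (- a) (a * s) x.
  have ce : continuous e by exact: continuous_affine_expR.
  have dF (x : R) : is_derive x 1 (fun t => e t * f t) (e x * f' x - a * (e x * f x)).
    have dex : is_derive x 1 e (- a * e x) by exact: de.
    have dfx := df x; apply: is_derive_eq; rewrite /GRing.scale /=; ring.
  have cF : continuous (fun x => e x * f' x - a * (e x * f x)).
    move=> x; apply: cvgB; first by apply: cvgM; [exact: ce|exact: cf'].
    by apply: cvgMr; apply: cvgM; [exact: ce|exact: cf].
  have := muJ_FTC2 (lexx 0) (ltW s0) (ltW sT) cF dF.
  have es : e s = 1 by rewrite /e mulNr addNr expR0.
  rewrite f00 mulr0 subr0 es mul1r => <-.
  apply/eqP; rewrite -subr_eq -RintegralB //; last 2 first.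
  - by apply: kernr_integrable => //; exact: ltW.
  - exact: (integrableZl measurableT a (kernr_integrable a (ltW sT) fi)).
  apply/eqP; apply: eq_RintegralJ.
  - have mk := measurable_kernl a s.
    have mf := measurable_integrable fi; have mf' := measurable_integrable f'i.
    by apply: measurable_funB; last (apply: measurable_funM => //); exact: measurable_funM.
  - apply: measurable_fun_ifT => //; last exact: continuous_measurable_fun.
    by apply: measurable_and; exact: measurable_fun_ltr.
  - move=> t /andP[t0 _]; rewrite t0 /= /kern; case: ifP; rewrite ?mul0r ?mulr0 ?subrr //.
    by move=> _; rewrite /e (_ : a * (s - t) = - a * t + a * s) //; ring.
have qfi c := integrable_mul_bddJ qi (kernr_bdd c fi).
have qfi' := integrable_mul_bddJ qi (kernr_bdd a f'i).
have qffi : mu.-integrable setT (EFin \o (fun t => q t * f t)).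
  have [Mf fM] := continuous_bddJ cf; exact: integrable_mul_bddJ qi fM.
rewrite !kern_fubini // -RintegralZl // -RintegralD //; last first.
  exact: (integrableZl measurableT a (qfi a)).
apply: eq_RintegralJ.
- exact: measurable_integrable qfi'.
- apply: measurable_funD; first exact: measurable_integrable qffi.
  by apply: measurable_funM => //; exact: measurable_integrable (qfi a).
- by move=> s sT; rewrite parts //; ring.
Qed.

(* Splitting the square of a triangular integral along the diagonal. *)
Lemma Kop_sqr a q t : 0 <= t -> mu.-integrable setT (EFin \o q) ->
  Kop a q t ^+ 2 = 2 * Kop (2 * a) (fun s => q s * Kop a q s) t.
Proof.
move=> t0 qi; pose p s := kern a t s * q s.
have pi : mu.-integrable setT (EFin \o p) by exact: kern_integrable.
have mp := measurable_integrable pi.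
have split_p s : 0 < s < T ->
    \int[mu]_r p r = Kop 0 p s + \int[mu]_r (kern 0 r s * p r).
  move=> /andP[s0 sT]; rewrite -RintegralD //; last 2 first.
  - by apply: kern_integrable => //; exact: ltW.
  - by apply: kernr_integrable => //; exact: ltW.
  apply: eq_Rintegral_ae => //.
    apply: measurable_funD; apply: measurable_funM => //.
      exact: measurable_kern.
    exact: measurable_kernl.
  exists [set s]; split => //.
    rewrite /= /muJ /mrestr /=; apply/eqP; rewrite -measure_le0.
    rewrite -[leRHS](lebesgue_measure_set1 s); apply: le_measure => //; rewrite ?inE //.
    exact: measurableI.
  move=> r /= /eqP nE; apply/eqP; apply: contraNT nE => rs.
  rewrite /kern !mul0r !expR0 -mulrDl.
  by case: (ltgtP s r) rs => //= _ _; rewrite ?addr0 ?add0r mul1r.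
have pK := integrable_mul_bddJ pi (Kop_bdd 0 pi).
have pk := integrable_mul_bddJ pi (kernr_bdd 0 pi).
have -> : Kop a q t ^+ 2 = \int[mu]_s (p s * \int[mu]_r p r).
  by rewrite expr2 RintegralZr.
transitivity (\int[mu]_s (p s * Kop 0 p s + p s * \int[mu]_r (kern 0 r s * p r))).
  apply: eq_RintegralJ.
  - by apply: measurable_funM.
  - by apply: measurable_funD; [exact: measurable_integrable pK|exact: measurable_integrable pk].
  - by move=> s sT; rewrite -mulrDr -split_p.
rewrite RintegralD // -(kern_fubini 0 pi pi) mulr2n [RHS]mulrDl mul1r.
suff -> : \int[mu]_s (p s * Kop 0 p s) = Kop (2 * a) (fun s => q s * Kop a q s) t by [].
have qKi := integrable_mul_bddJ qi (Kop_bdd a qi).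
apply: eq_RintegralJ.
- exact: measurable_integrable pK.
- by apply: measurable_funM; [exact: measurable_kern|exact: measurable_integrable qKi].
move=> s /andP[s0 sT].
have [ts|st] := ltP t s; last by rewrite /p /kern ltNge st !mul0r.
have KE : Kop 0 p s = expR (a * (s - t)) * Kop a q s.
  rewrite /Kop -RintegralZl //; last by apply: kern_integrable => //; exact: ltW.
  apply: eq_Rintegral => r _ /=; rewrite /p /kern mul0r expR0.
  case: ifP => sr; rewrite ?mul0r ?mulr0 // (lt_trans ts sr) mul1r mulrA -expRD.
  by congr (expR _ * _); ring.
rewrite KE /p /kern ts (_ : 2 * a * (s - t) = a * (s - t) + a * (s - t)); last by ring.
by rewrite expRD; ring.
Qed.

Lemma kern_integral_left a s : 0 <= s <= T ->
  a * \int[mu]_t (kern a t s * 1) = expR (a * s) - 1.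
Proof.
move=> /andP[s0 sT].
pose F t := expR (- a * t + a * s).
have cF : continuous F by exact: continuous_affine_expR.
have ki : mu.-integrable setT (EFin \o (fun t => kern a t s * 1)).
  exact: kernr_integrable sT integrable_cst1.
have := muJ_FTC2 (f := fun t => - a * F t) (F := F) (lexx 0) s0 sT
  (fun x => cvgMr (cF x)) (is_derive_expR_affine _ _).
have Fs : F s = 1 by rewrite /F mulNr addNr expR0.
have F0 : F 0 = expR (a * s) by rewrite /F mulr0 add0r.
rewrite Fs F0 => FTC; rewrite -opprB -FTC -RintegralZl //.
have k'i : mu.-integrable setT (EFin \o (fun t => a * (kern a t s * 1))).
  exact: (integrableZl measurableT a ki).
have cm := continuous_measurable_fun cF.
have mif : measurable_fun setT (fun t => if 0 < t < s then - a * F t else 0).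
  apply: measurable_fun_ifT => //; last exact: measurable_funM.
  by apply: measurable_and; exact: measurable_fun_ltr.
have E t : 0 < t < T -> a * (kern a t s * 1) = - (if 0 < t < s then - a * F t else 0).
  move=> /andP[-> _] /=; rewrite /kern; case: ifP; rewrite ?mul0r ?mulr0 ?oppr0 // => _.
  by rewrite mulr1 mulNr opprK /F; congr (_ * expR _); ring.
have kf : mu.-integrable setT (EFin \o (fun t => if 0 < t < s then - a * F t else 0)).
  have [M cM] := @continuous_bddJ (fun t => - a * F t) (fun x => cvgMr (cF x)).
  apply: (@bddJ_integrable _ _ M); split=> // t tT; case: ifP => _; first exact: cM.2.
  by rewrite normr0 (le_trans _ (cM.2 t tT)).
rewrite -mulN1r -RintegralZl //; under [RHS]eq_Rintegral do rewrite mulN1r.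
by apply: eq_RintegralJ => //; [exact: measurable_integrable k'i|exact: measurableT_comp].
Qed.

(** For u = [Kop a q] this is - (u^2)' = 2 q u + 2 a u^2 integrated over J, with u(T) = 0. No
    derivative of u is taken: [Kop_sqr] writes u^2 as an integral, and Fubini with
    [kern_integral_left] evaluates it. *)
Lemma Kop_energy a q : mu.-integrable setT (EFin \o q) ->
  Kop a q 0 ^+ 2 = 2 * \int[mu]_t (q t * Kop a q t) + 2 * a * \int[mu]_t (Kop a q t ^+ 2).
Proof.
move=> qi.
have qKi := integrable_mul_bddJ qi (Kop_bdd a qi).
have c1 := integrable_cst1.
pose u s := q s * Kop a q s.
have -> : \int[mu]_t (Kop a q t ^+ 2) = \int[mu]_t (1 * (2 * Kop (2 * a) u t)).
  apply: eq_RintegralJ.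
  - by apply: measurable_funX; exact: measurable_Kop.
  - by apply: measurable_funM => //; apply: measurable_funM => //; exact: measurable_Kop.
  - by move=> t /andP[t0 _]; rewrite Kop_sqr // ?mul1r // ltW.
have ui := integrable_mul_bddJ c1 (Kop_bdd (2 * a) qKi).
transitivity (2 * \int[mu]_t u t + 2 * a * (2 * \int[mu]_t (1 * Kop (2 * a) u t))); last first.
  congr (_ + _ * _); rewrite -RintegralZl //; apply: eq_Rintegral => t _; ring.
rewrite (kern_fubini _ c1) // Kop_sqr //.
rewrite (mulrCA _ 2) -mulrDr; congr (_ * _).
have uk := integrable_mul_bddJ qKi (kernr_bdd (2 * a) c1).
rewrite -RintegralZl // -RintegralD //; last exact: (integrableZl measurableT (2 * a) uk).
apply: eq_RintegralJ.
- by apply: measurable_funM; [exact: measurable_kern|exact: measurable_integrable qKi].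
- apply: measurable_funD; first exact: measurable_integrable qKi.
  by apply: measurable_funM => //; exact: measurable_integrable uk.
- move=> s /andP[s0 sT] /=; rewrite [2 * a * _]mulrCA kern_integral_left ?ltW //.
  by rewrite /kern s0 subr0 /u; ring.
Qed.

End Volterra.

(** * Moduli of continuity and the du Bois-Reymond lemma *)

Section DuBoisReymond.
Context {R : realType} (T : R).
Hypothesis T0 : 0 < T.
Local Notation mu := (muJ T).
Local Notation Kop := (Kop T).
Implicit Types (a b t s e : R) (f g h q : R -> R).

Lemma expRN_dist x y : 0 <= x -> x <= y -> `|expR (- x) - expR (- y)| <= y - x :> R.
Proof.
move=> x0 xy; have -> : - y = - x + - (y - x) by ring.
rewrite expRD -{1}(mulr1 (expR (- x))) -mulrBr normrM.
rewrite -[leRHS]mul1r; apply: ler_pM => //.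
  by rewrite ger0_norm ?expR_ge0 // -expR0 ler_expR oppr_le0.
have e1 : expR (- (y - x)) <= 1 by rewrite -expR0 ler_expR oppr_le0 subr_ge0.
rewrite ger0_norm ?subr_ge0 //; have := expR_ge1Dx (- (y - x)); lra.
Qed.

(** For s > t' both kernels are present and differ by at most - a (t' - t), because x |-> exp(- x)
    is 1-Lipschitz for x >= 0. Between t and t' only the first is present; it is at most 1, which
    the difference of indicators absorbs. *)
Lemma kern_dist a t t' s : a <= 0 -> 0 <= t -> t <= t' -> 0 < s < T ->
  `|kern a t s - kern a t' s| <=
  (if t < s < T then 1 else 0) - (if t' < s < T then 1 else 0) - a * (t' - t).
Proof.
move=> a0 t0 tt' /andP[s0 sT]; rewrite sT !andbT /kern.
have d0 : 0 <= - a * (t' - t) by rewrite mulr_ge0 ?oppr_ge0 // subr_ge0.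
have [t's|st'] := ltP t' s.
  rewrite (le_lt_trans tt' t's) subrr add0r -mulNr.
  rewrite (_ : a * (s - t) = - (- a * (s - t))); last by ring.
  rewrite (_ : a * (s - t') = - (- a * (s - t'))); last by ring.
  rewrite distrC; apply: le_trans (expRN_dist _ _) _.
  - by rewrite mulr_ge0 ?oppr_ge0 // subr_ge0 ltW.
  - by rewrite ler_wpM2l ?oppr_ge0 // lerD2l lerN2.
  - by rewrite -mulrBr le_eqVlt; apply/orP; left; apply/eqP; ring.
rewrite subr0; case: ifP => ts; last first.
  by rewrite subrr normr0 sub0r -mulNr.
rewrite subr0 ger0_norm ?expR_ge0 // -mulNr.
apply: (@le_trans _ _ 1); last by rewrite lerDl.
rewrite -expR0 ler_expR mulr_le0_ge0 // subr_ge0 ltW //.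
Qed.

Lemma kern_modulus a t t' : a <= 0 -> 0 <= t -> t <= t' -> t' <= T ->
  \int[mu]_s `|kern a t s - kern a t' s| <= (1 - a * T) * (t' - t).
Proof.
move=> a0 t0 tt' t'T; have t'0 := le_trans t0 tt'; have tT := le_trans tt' t'T.
have id_ftc b : 0 <= b -> b <= T -> \int[mu]_s (if b < s < T then 1 else 0) = T - b.
  move=> b0 bT; apply: (muJ_FTC2 (f := cst 1) (F := id)) => //.
  exact: cst_continuous.
have ind_int b : mu.-integrable setT (EFin \o (fun s => if b < s < T then 1 else 0)).
  apply: (@bddJ_integrable _ _ 1); split.
    apply: measurable_fun_ifT => //.
    by apply: measurable_and; exact: measurable_fun_ltr.
  by move=> s _; case: ifP; rewrite ?normr1 // normr0.
have ki b : 0 <= b -> mu.-integrable setT (EFin \o kern a b).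
  by move=> b0; exact: bddJ_integrable (bddJ_kern _ _ b0).
have c1 c : mu.-integrable setT (EFin \o (cst c : R -> R)).
  exact: finite_measure_integrable_cst.
have di : mu.-integrable setT (EFin \o (fun s => `|kern a t s - kern a t' s|)).
  have kki : mu.-integrable setT (EFin \o (fun s => kern a t s - kern a t' s)).
    exact: (integrableB measurableT (ki _ t0) (ki _ t'0)).
  exact: (integrable_norm kki).
have bi := integrableB measurableT (ind_int t) (ind_int t').
apply: (@le_trans _ _ (\int[mu]_s ((if t < s < T then 1 else 0) -
    (if t' < s < T then 1 else 0) - a * (t' - t)))).
  apply: le_RintegralJ => //.
    exact: (integrableB measurableT bi (c1 (a * (t' - t)))).
  by move=> s sT; exact: kern_dist.
rewrite RintegralB //; last exact: (c1 (a * (t' - t))).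
rewrite RintegralB // !id_ftc // (Rintegral_cst _ _ (a * (t' - t))) // muJT //.
rewrite le_eqVlt; apply/orP; left; apply/eqP; ring.
Qed.

Lemma kern_le1 a t s : a <= 0 -> kern a t s <= 1.
Proof.
move=> a0; rewrite /kern; case: ifP => // ts.
by rewrite -expR0 ler_expR mulr_le0_ge0 // subr_ge0 ltW.
Qed.

(** Both kernels lie in [0, 1] for a <= 0, so the square of the difference is at most its absolute
    value. *)
Lemma kern_modulus2 a t t' : a <= 0 -> 0 <= t -> t <= t' -> t' <= T ->
  \int[mu]_s (kern a t s - kern a t' s) ^+ 2 <= (1 - a * T) * (t' - t).
Proof.
move=> a0 t0 tt' t'T; apply: le_trans (kern_modulus a0 t0 tt' t'T).
have mk : measurable_fun setT (fun s => kern a t s - kern a t' s).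
  by apply: measurable_funB; exact: measurable_kern.
have b1 s : `|kern a t s - kern a t' s| <= 1.
  have := kern_ge0 a t s; have := kern_ge0 a t' s.
  have := kern_le1 t s a0; have := kern_le1 t' s a0.
  by rewrite ler_norml => *; lra.
apply: le_RintegralJ.
- apply: (@bddJ_integrable _ _ 1); split; first exact: measurable_funX.
  by move=> s _; rewrite normrX exprn_ile1.
- apply: (@bddJ_integrable _ _ 1); split; first exact: measurableT_comp.
  by move=> s _; rewrite normr_id.
- by move=> s _; rewrite -real_normK ?num_real // expr2 ler_piMl.
Qed.

(** The C^1 primitive of the absolute value; its second differences give explicit test functions. *)
Definition sq x : R := x * `|x| / 2.

(** A quadratic remainder bound, checked by the signs of y and h + y, treats the kink of the
    absolute value at 0 together with all other points. *)
Lemma is_derive_sq (x : R) : is_derive x 1 sq `|x|.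
Proof.
have sqE (y h : R) : `|sq (h + y) - sq y - h * `|y| | <= h ^+ 2 / 2.
  rewrite /sq; have [y0|y0] := lerP 0 y; have [yh|yh] := lerP 0 (h + y);
  rewrite ?(ger0_norm y0) ?(ltr0_norm y0) ?(ger0_norm yh) ?(ltr0_norm yh) ler_norml;
  apply/andP; split; nra.
have lim : h^-1 *: (sq (h *: 1 + x) - sq x) @[h --> 0^'] --> `|x|.
  apply/cvgrPdist_le => e e0; near=> h.
  have h0 : h != 0 by near: h; exact: nbhs_dnbhs_neq.
  rewrite /GRing.scale /= mulr1 distrC.
  rewrite (_ : h^-1 * (sq (h + x) - sq x) - `|x| = h^-1 * (sq (h + x) - sq x - h * `|x|)); last first.
    by field.
  rewrite normrM normfV ler_pdivrMl ?normr_gt0 //.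
  apply: le_trans (sqE _ _) _; rewrite -real_normK ?num_real // expr2 -mulrA ler_wpM2l //.
  have he : `|h| <= e.
    by near: h; apply: dnbhs0_le.
  have := normr_ge0 h; lra.
split; first by apply/cvg_ex; exists `|x|.
exact: cvg_lim lim.
Unshelve. all: by end_near. Qed.

(** Second differences of [sq] and of the absolute value: [step e] goes from - e^2 to e^2 across
    [- e, e], and its derivative [tent e] is a bump of mass 2 e^2 supported there. *)
Definition step e x := sq (x + e) - 2 * sq x + sq (x - e).
Definition tent e x := `|x + e| - 2 * `|x| + `|x - e|.

Lemma is_derive_sq_shift (c x : R) : is_derive x 1 (fun t : R => sq (t + c)) `|x + c|.
Proof.
have h : is_derive x 1 (fun t : R => t + c) 1 by apply: is_derive_eq; rewrite addr0.
by have := @is_derive1_comp _ sq (fun t => t + c) x _ _ (is_derive_sq (x + c)) h; rewrite mulr1.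
Qed.

Lemma is_derive_step e (a x : R) : is_derive x 1 (fun t : R => step e (t - a)) (tent e (x - a)).
Proof.
have h1 := is_derive_sq_shift (- a + e) x.
have h2 := is_derive_sq_shift (- a) x.
have h3 := is_derive_sq_shift (- a - e) x.
rewrite (_ : (fun t => _) = (fun t => sq (t + (- a + e)) - 2 * sq (t - a) + sq (t + (- a - e)))).
  by apply: is_derive_eq; rewrite /tent /GRing.scale /= !addrA; ring.
by apply/funext => t; rewrite /step !addrA.
Qed.

Lemma tent_ge0 e x : 0 <= e -> 0 <= tent e x.
Proof.
move=> e0; rewrite /tent; have := ler_normD (x + e) (x - e).
rewrite (_ : x + e + (x - e) = 2 * x); last by ring.
by rewrite normrM gtr0_norm // => h; lra.
Qed.

Lemma tent_out e x : 0 < e -> e <= `|x| -> tent e x = 0.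
Proof.
move=> e0; rewrite /tent; have [x0|x0] := lerP 0 x => ex.
  by rewrite (ger0_norm x0) in ex *; rewrite !ger0_norm; lra.
by rewrite (ltr0_norm x0) in ex *; rewrite !ler0_norm; lra.
Qed.

Lemma step_right e x : 0 < e -> e <= x -> step e x = e ^+ 2.
Proof. by move=> e0 ex; rewrite /step /sq !ger0_norm; [field|lra..]. Qed.

Lemma step_left e x : 0 < e -> x <= - e -> step e x = - e ^+ 2.
Proof. by move=> e0 ex; rewrite /step /sq !ler0_norm; [field|lra..]. Qed.

Lemma continuous_tent e a : continuous (fun x => tent e (x - a)).
Proof.
have ca c' : continuous (fun x : R => `|x - a + c'|).
  move=> x; apply: cvg_norm; apply: cvgD; last exact: cvg_cst.
  by apply: cvgB; [exact: cvg_id|exact: cvg_cst].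
move=> x; rewrite /tent; apply: cvgD; last exact: (ca (- e) x).
apply: cvgB; first exact: (ca e x).
by apply: cvgMr; apply: cvg_norm; apply: cvgB; [exact: cvg_id|exact: cvg_cst].
Qed.

(** Both steps take the same constant value to the left of a - e and to the right of b + e, so their
    difference has compact support in J. *)
Lemma C1c_step e a b : 0 < e -> e < a -> a <= b -> b + e < T ->
  C1c T (fun t => step e (t - a) - step e (t - b)) /\
  forall t, derive1 (fun t => step e (t - a) - step e (t - b)) t = tent e (t - a) - tent e (t - b).
Proof.
move=> e0 ea ab bT.
have dphi (t : R) : is_derive t 1 (fun t => step e (t - a) - step e (t - b))
    (tent e (t - a) - tent e (t - b)).
  have h1 := is_derive_step e a t; have h2 := is_derive_step e b t.
  exact: is_deriveB.
have d1 t : derive1 (fun t => step e (t - a) - step e (t - b)) t = tent e (t - a) - tent e (t - b).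
  by rewrite derive1E; exact: derive_val.
split => //; split.
- by move=> t; exact: ex_derive.
- rewrite (_ : derive1 _ = (fun t => tent e (t - a) - tent e (t - b))); last exact/funext.
  by move=> t; apply: cvgB; exact: continuous_tent.
- apply: (@subset_trans _ `[a - e, b + e]%classic).
    rewrite closureE => t; apply; split; first exact: itv_closed.
    move=> s /=; rewrite in_itv /=; apply: contraNT; rewrite negb_and -!ltNge => /orP[sa|sb].
      by rewrite !step_left ?subrr //; lra.
    by rewrite !step_right ?subrr //; lra.
  by move=> t /=; rewrite !in_itv /= => /andP[h1 h2]; apply/andP; split; lra.
Qed.

(** Tested on the difference of two steps, the hypothesis says that y has equal tent-weighted
    averages around a and b. Narrow tents and continuity of y at a and b then give equality of the
    values. *)
Lemma du_bois_reymond (y : R -> R) : measurable_fun setT y ->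
  (exists M, bddJ T M y) -> (forall t, 0 < t < T -> {for t, continuous y}) ->
  (forall phi, C1c T phi -> \int[mu]_t (y t * derive1 phi t) = 0) ->
  forall a b, 0 < a -> a <= b -> b < T -> y a = y b.
Proof.
move=> my [M yM] cy yphi a b a0 ab bT.
have yi := bddJ_integrable yM.
apply/eqP; rewrite -subr_eq0 -normr_le0; apply/ler_addgt0Pr => eta eta0; rewrite add0r.
have eta2 : 0 < eta / 2 by rewrite divr_gt0.
have a0T : 0 < a < T by rewrite a0 (le_lt_trans ab).
have b0T : 0 < b < T by rewrite bT (lt_le_trans a0 ab).
have /cvgrPdist_le/(_ _ eta2)/nbhs_normP[da da0 hda] := cy a a0T.
have /cvgrPdist_le/(_ _ eta2)/nbhs_normP[db db0 hdb] := cy b b0T.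
(* The width e keeps both tents inside J and inside the neighbourhoods on which y varies by at most
   [eta / 2]. *)
have [e [e0 [ea [eb [eda edb]]]]] : exists e, 0 < e /\ e < a /\ b + e < T /\ e < da /\ e < db.
  exists (Num.min (Num.min (a / 2) ((T - b) / 2)) (Num.min (da / 2) (db / 2))).
  have m1 : 0 < a / 2 by rewrite divr_gt0.
  have m2 : 0 < (T - b) / 2 by rewrite divr_gt0 // subr_gt0.
  have m3 : 0 < da / 2 by rewrite divr_gt0.
  have m4 : 0 < db / 2 by rewrite divr_gt0.
  set m := Num.min _ _.
  have h1 : m <= a / 2 by rewrite /m !ge_min lexx.
  have h2 : m <= (T - b) / 2 by rewrite /m !ge_min lexx !orbT.
  have h3 : m <= da / 2 by rewrite /m !ge_min lexx !orbT.
  have h4 : m <= db / 2 by rewrite /m !ge_min lexx !orbT.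
  by split; [rewrite /m !lt_min m1 m2 m3 m4|do !split; lra].
have tent_cont c := @continuous_tent e c.
have tent_i c := continuous_integrable T (tent_cont c).
have ytent_i c : mu.-integrable setT (EFin \o (fun t => y t * tent e (t - c))).
  by have [K hK] := continuous_bddJ T (tent_cont c); exact: integrable_mul_bddJ yi hK.
have mass c : e < c -> c + e < T -> \int[mu]_t tent e (t - c) = 2 * e ^+ 2.
  move=> ec cT.
  have := muJ_FTC2 (lexx 0) (ltW T0) (lexx T) (tent_cont c) (is_derive_step e c).
  rewrite step_right ?step_left //; [|lra|lra].
  rewrite (_ : e ^+ 2 - - e ^+ 2 = 2 * e ^+ 2); last by ring.
  move=> <-; apply: eq_RintegralJ.
  - exact: continuous_measurable_fun.
  - apply: measurable_fun_ifT; [|exact: continuous_measurable_fun|by []].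
    by apply: measurable_and; exact: measurable_fun_ltr.
  - by move=> t ->.
have avg c d : e < c -> c + e < T -> e < d ->
    (forall t, `|c - t| < d -> `|y c - y t| <= eta / 2) ->
    `|\int[mu]_t (y t * tent e (t - c)) - y c * (2 * e ^+ 2)| <= eta / 2 * (2 * e ^+ 2).
  move=> ec cT ed hd; rewrite -(mass c) // -!RintegralZl // -RintegralB //; last first.
    exact: (integrableZl measurableT (y c) (tent_i c)).
  have di : mu.-integrable setT (EFin \o (fun t => y t * tent e (t - c) - y c * tent e (t - c))).
    exact: (integrableB measurableT (ytent_i c) (integrableZl measurableT (y c) (tent_i c))).
  apply: le_trans (le_normr_Rintegral measurableT di) _; apply: le_RintegralJ.
  - exact: integrable_norm di.
  - exact: (integrableZl measurableT (eta / 2) (tent_i c)).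
  - move=> t _; rewrite -mulrBl normrM (ger0_norm (tent_ge0 _ (ltW e0))).
    have [h|h] := ltP `|c - t| d.
      by rewrite ler_wpM2r ?tent_ge0 ?(ltW e0) // distrC hd.
    by rewrite tent_out ?mulr0 // distrC (le_trans (ltW ed)).
have [C1 dE] := C1c_step e0 ea ab eb.
have := yphi _ C1; under eq_Rintegral do rewrite dE mulrBr.
rewrite RintegralB // => /eqP; rewrite subr_eq0 => /eqP Eab.
have ha := avg a da ea _ eda hda; have hb := avg b db _ eb edb hdb.
have {}ha := ha (le_lt_trans (lerD ab (lexx e)) eb).
have {}hb := hb (lt_le_trans ea ab).
have e2 : 0 < 2 * e ^+ 2 by rewrite mulr_gt0 // exprn_gt0.
rewrite -(ler_pM2r e2) -{1}(gtr0_norm e2) -normrM mulrBl.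
rewrite [X in `|X|](_ : _ = (\int[mu]_t (y t * tent e (t - b)) - y b * (2 * e ^+ 2)) -
   (\int[mu]_t (y t * tent e (t - a)) - y a * (2 * e ^+ 2))); last by rewrite Eab; ring.
apply: le_trans (ler_normB _ _) _; apply: le_trans (lerD hb ha) _.
by rewrite -mulrDl -splitr.
Qed.

End DuBoisReymond.

(** * Weighted forms on E and Cauchy-Schwarz estimates *)

Section EForms.
Context {R : realType} (T : R).
Hypothesis T0 : 0 < T.
Local Notation mu := (muJ T).
Local Notation Kop := (Kop T).
Implicit Types (a b t s : R) (f g h q : R -> R).

Lemma E_mul_integrable (x y : E T) : mu.-integrable setT (EFin \o (fun t => x t * y t)).
Proof. by apply: Lfun2_mul_integrable; exact: LfunP. Qed.

Lemma E_mulh_integrable M h (x y : E T) : bddJ T M h ->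
  mu.-integrable setT (EFin \o (fun t => x t * y t * h t)).
Proof. by move=> hM; exact: integrable_mul_bddJ (E_mul_integrable x y) hM. Qed.

Lemma weighted_form_linear_l M h (hM : bddJ T M h) (c : R) (x x' y : E T) :
  \int[mu]_t ((c *: x + x') t * y t * h t) =
  c *: (\int[mu]_t (x t * y t * h t) : R) + \int[mu]_t (x' t * y t * h t).
Proof.
have i1 := E_mulh_integrable x y hM; have i2 := E_mulh_integrable x' y hM.
rewrite /GRing.scale /= -RintegralZl // -RintegralD //.
  by apply: eq_Rintegral => t _; rewrite [RHS](_ : _ = (c * x t + x' t) * y t * h t) //; ring.
exact: (integrableZl measurableT c i1).
Qed.

Lemma weighted_form_linear_r M h (hM : bddJ T M h) (c : R) (x y y' : E T) :
  \int[mu]_t (x t * (c *: y + y') t * h t) =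
  c *: (\int[mu]_t (x t * y t * h t) : R) + \int[mu]_t (x t * y' t * h t).
Proof.
rewrite (_ : \int[mu]_t (x t * (c *: y + y') t * h t) =
  \int[mu]_t ((c *: y + y') t * x t * h t)); last first.
  by apply: eq_Rintegral => t _; ring.
by rewrite (weighted_form_linear_l hM); congr (_ *: _ + _); apply: eq_Rintegral => t _; ring.
Qed.

Definition weighted_form M h (hM : bddJ T M h) : {bilinear E T -> E T -> R} :=
  mk_bilinear (weighted_form_linear_l hM) (fun c x => @weighted_form_linear_r M h hM c x).

Lemma weighted_formE M h (hM : bddJ T M h) x y :
  weighted_form hM x y = \int[mu]_t (x t * y t * h t).
Proof. by []. Qed.

Lemma weighted_form_psd M h (hM : bddJ T M h) : (forall t, 0 < t < T -> 0 <= h t) ->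
  psd_form (weighted_form hM).
Proof.
move=> h0; split=> [x y|x]; rewrite !weighted_formE.
  by apply: eq_Rintegral => t _; ring.
rewrite (_ : 0 = \int[mu]_t (cst 0 t)); last by rewrite Rintegral_cst // mul0r.
apply: le_RintegralJ; first exact: finite_measure_integrable_cst.
  exact: E_mulh_integrable hM.
by move=> t tJ; rewrite mulr_ge0 ?h0 // -expr2 sqr_ge0.
Qed.

Lemma cauchy_schwarz f g : f \in Lfun mu 2%:E -> g \in Lfun mu 2%:E ->
  (\int[mu]_t (f t * g t)) ^+ 2 <= (\int[mu]_t (f t ^+ 2)) * (\int[mu]_t (g t ^+ 2)).
Proof.
move=> f2 g2; pose fE : E T := Lfun_Sub (lee1n 2) f2; pose gE : E T := Lfun_Sub (lee1n 2) g2.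
have pw := @weighted_form_psd _ _ (bddJ_cst T 1) (fun _ _ => ler01).
have := form_CS pw fE gE; rewrite !weighted_formE.
rewrite (_ : \int[mu]_t (fE t * gE t * _) = \int[mu]_t (f t * g t)); last first.
  by apply: eq_Rintegral => t _ /=; rewrite mulr1.
rewrite (_ : \int[mu]_t (fE t * fE t * _) = \int[mu]_t (f t ^+ 2)); last first.
  by apply: eq_Rintegral => t _ /=; rewrite mulr1.
rewrite (_ : \int[mu]_t (gE t * gE t * _) = \int[mu]_t (g t ^+ 2)) //.
by apply: eq_Rintegral => t _ /=; rewrite mulr1.
Qed.

Lemma L2norm_sqr f : f \in Lfun mu 2%:E -> L2norm T f ^+ 2 = \int[mu]_t (f t ^+ 2).
Proof.
move=> f2; rewrite /L2norm /Rintegral -Lnorm2_sqr.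
have := finite_norm_fine (Lfun_Sub (lee1n 2) f2) => /= <-.
by rewrite poweR_EFin /= powR_mulrn // fine_ge0 // Lnorm_ge0.
Qed.

(** Cauchy-Schwarz against [kern_modulus2]. Thus [Kop a q] is Hoelder continuous with exponent 1/2
    when q is square integrable, the source of the continuity required in [Fset]. *)
Lemma Kop_modulus a q t t' : a <= 0 -> q \in Lfun mu 2%:E -> 0 <= t -> t <= t' -> t' <= T ->
  (Kop a q t - Kop a q t') ^+ 2 <= (1 - a * T) * (t' - t) * \int[mu]_t (q t ^+ 2).
Proof.
move=> a0 q2 t0 tt' t'T; have qi := Lfun2_integrable q2.
have t'0 := le_trans t0 tt'.
have k2 c : 0 <= c -> kern a c \in Lfun mu 2%:E.
  by move=> c0; exact: bddJ_Lfun2 (bddJ_kern T a c0).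
rewrite /Kop -RintegralB //; [|exact: kern_integrable..].
under eq_Rintegral do rewrite -mulrBl.
have d2 : (fun s => kern a t s - kern a t' s) \in Lfun mu 2%:E.
  exact: (LfunP ((Lfun_Sub (lee1n 2) (k2 _ t0) : E T) - Lfun_Sub (lee1n 2) (k2 _ t'0))).
apply: le_trans (cauchy_schwarz d2 q2) _.
rewrite ler_wpM2r ?kern_modulus2 //.
by apply: Rintegral_ge0 => s _; exact: sqr_ge0.
Qed.

Lemma within_continuous_modulus (y : R -> R) (C : R) : 0 <= C ->
  (forall t t', 0 <= t -> t <= t' -> t' <= T -> (y t - y t') ^+ 2 <= C * (t' - t)) ->
  {within `[0, T], continuous y}.
Proof.
move=> C0 yC; apply/subspace_continuousP => x /=; rewrite in_itv /= => /andP[x0 xT].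
apply/cvgrPdist_le => e e0; rewrite near_withinE.
have d0 : 0 < e ^+ 2 / (C + 1) by rewrite divr_gt0 ?exprn_gt0 // ltr_wpDl.
near=> t; rewrite /= in_itv /= => /andP[t0 tT].
have xt : `|x - t| < e ^+ 2 / (C + 1) by near: t; apply/nbhs_normP; exists (e ^+ 2 / (C + 1)).
rewrite -(@ler_pXn2r _ 2) ?nnegrE ?(ltW e0) // real_normK ?num_real //.
apply: (@le_trans _ _ (C * `|x - t|)).
  have [xt'|tx] := lerP x t; last by rewrite -(sqrrN (y x - _)) opprB; apply: yC => //; exact: ltW.
  by rewrite yC.
apply: (@le_trans _ _ ((C + 1) * `|x - t|)); first by rewrite ler_wpM2r // lerDl.
by rewrite mulrC -ler_pdivlMr ?ltW // ltr_wpDl.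
Unshelve. all: by end_near. Qed.

Lemma within_continuous_bdd (y : R -> R) : measurable_fun setT y ->
  {within `[0, T], continuous y} -> exists M, bddJ T M y.
Proof.
move=> my cy; have /compact_bounded[M [_ yM]] := continuous_compact cy (@segment_compact R 0 T).
exists (`|M| + 1); split=> // t /andP[t0 tT].
apply: (yM (`|M| + 1)); first by rewrite (le_lt_trans (ler_norm M)) // ltrDl.
by exists t => //=; rewrite in_itv /= !ltW.
Qed.

(** [du_bois_reymond] gives constancy inside J; one-sided limits carry it to the endpoints, where
    y(T) = 0 fixes the constant. *)
Lemma weak_constant_zero (y : R -> R) : measurable_fun setT y ->
  {within `[0, T], continuous y} -> y T = 0 ->
  (forall phi, C1c T phi -> \int[mu]_t (y t * derive1 phi t) = 0) ->
  forall t, 0 <= t <= T -> y t = 0.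
Proof.
move=> my cy yT yphi; have yM := within_continuous_bdd my cy.
have /(continuous_within_itvP _ T0)[cy1 cy2 cy3] := cy.
have yc : forall t, 0 < t < T -> {for t, continuous y}.
  by move=> t tJ; apply: cy1; rewrite in_itv.
have yconst := du_bois_reymond T0 my yM yc yphi.
have y0 t : 0 < t < T -> y t = 0.
  move=> /andP[t0 tT]; rewrite -yT; apply/esym.
  have h : y x @[x --> T^'-] --> y t.
    apply: cvg_near_cst; near=> s.
    have ts : t < s by near: s; exact: nbhs_left_gt.
    have sT : s < T by near: s; exact: nbhs_left_lt.
    by rewrite (yconst t s) // ltW.
  exact: cvg_unique cy3 h.
move=> t /andP[]; rewrite le_eqVlt => /predU1P[<- _|t0].
  have h : y x @[x --> 0^'+] --> (0 : R).
    apply: cvg_near_cst; near=> s.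
    by apply: y0; apply/andP; split; near: s; [exact: nbhs_right_gt|exact: nbhs_right_lt].
  exact: cvg_unique cy2 h.
by rewrite le_eqVlt => /predU1P[->//|tT]; apply: y0; rewrite t0.
Unshelve. all: by end_near. Qed.

End EForms.

(** * Uniqueness of weak derivatives *)

Section WeakDerivatives.
Context {R : realType} (T : R).
Hypothesis T0 : 0 < T.
Local Notation mu := (muJ T).
Local Notation Kop := (Kop T).
Local Notation leb := (@lebesgue_measure R).
Implicit Types (a b t s : R) (f g h q : R -> R).

Lemma C1c_out phi t : C1c T phi -> ~~ (0 < t < T) -> phi t = 0.
Proof.
move=> [_ _ sub]; apply: contraNeq => pt.
have : closure [set t | phi t != 0] t by apply: subset_closure.
by move=> /sub; rewrite /= in_itv.
Qed.

Lemma C1c_is_derive phi (x : R) : C1c T phi -> is_derive x 1 phi (derive1 phi x).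
Proof. by move=> [d _ _]; rewrite derive1E; apply: DeriveDef. Qed.

Lemma C1c_bddJ phi : C1c T phi -> exists M, bddJ T M phi.
Proof.
move=> C; apply: continuous_bddJ => x; apply/differentiable_continuous/derivable1_diffP.
by case: C.
Qed.

Lemma C1c_bddJ' phi : C1c T phi -> exists M, bddJ T M (derive1 phi).
Proof. by move=> [_ c _]; exact: continuous_bddJ. Qed.

Lemma Kop_weak a q phi : mu.-integrable setT (EFin \o q) -> C1c T phi ->
  \int[mu]_t (Kop a q t * derive1 phi t) =
  \int[mu]_t (q t * phi t) + a * \int[mu]_t (Kop a q t * phi t).
Proof.
move=> qi C; have [d c _] := C.
under eq_Rintegral do rewrite mulrC.
rewrite (Kop_parts a qi (fun x => C1c_is_derive x C) c).
  by congr (_ + _ * _); apply: eq_Rintegral => t _; rewrite mulrC.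
by apply: (C1c_out C); rewrite ltxx.
Qed.

Lemma KopT a q : mu.-integrable setT (EFin \o q) -> Kop a q T = 0.
Proof.
move=> qi; have mq := measurable_integrable qi.
rewrite /Kop (eq_RintegralJ (g := cst 0)) ?Rintegral_cst ?mul0r //.
  by apply: measurable_funM => //; exact: measurable_kern.
by move=> t /andP[_ tT]; rewrite /kern ltNge (ltW tT) mul0r.
Qed.

Lemma Kop_within a q : a <= 0 -> q \in Lfun mu 2%:E -> {within `[0, T], continuous (Kop a q)}.
Proof.
move=> a0 q2; apply: (@within_continuous_modulus _ _ _ ((1 - a * T) * \int[mu]_t (q t ^+ 2))).
  rewrite mulr_ge0 ?Rintegral_ge0 // => [|t _]; last exact: sqr_ge0.
  by rewrite subr_ge0 (le_trans _ ler01) // mulr_le0_ge0 // ltW.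
by move=> t t' t0 tt' t'T; rewrite mulrAC; exact: Kop_modulus.
Qed.

(** The weak derivative of [Kop 0 h] is - h, so this primitive is annihilated by
    [weak_constant_zero]; h is then recovered from it by Lebesgue differentiation. *)
Lemma weak_zero h : h \in Lfun mu 2%:E ->
  (forall phi, C1c T phi -> \int[mu]_t (h t * phi t) = 0) -> {ae mu, forall t, h t = 0}.
Proof.
move=> h2 hphi; have hi := Lfun2_integrable h2; have mh := Lfun2_measurable h2.
have H0 : forall t, 0 <= t <= T -> Kop 0 h t = 0.
  apply: (weak_constant_zero T0).
  - exact: measurable_Kop.
  - exact: Kop_within.
  - exact: KopT.
  - by move=> phi C; rewrite Kop_weak // hphi // mul0r addr0.
pose J : set R := `]0, T[%classic.
have lebJ : leb.-integrable J (EFin \o h).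
  have /integrableP[mhJ hfin] := (integrableJP T mh).1 hi.
  apply/integrableP; split=> //; apply: le_lt_trans hfin.
  rewrite le_eqVlt; apply/orP; left; apply/eqP; apply: eq_measure_integral => A mA AJ.
  by rewrite /= /muJ /mrestr /=; congr (leb _); apply/esym/setIidPl.
pose f := h \_ J.
have fi : leb.-integrable setT (EFin \o f).
  rewrite /f -restrict_EFin; exact: (@integrable_mkcond _ _ _ leb J (EFin \o h) (measurable_itv _)).1.
have fiy y : leb.-integrable `]-oo, y] (EFin \o f) by apply: integrableS fi.
have locf : locally_integrable [set: R] f by exact: open_integrable_locally openT fi.
(* Differentiation of x |-> int_(-oo)^x f, with h extended by 0 outside J; [F0] shows that this
   primitive is 0 on J, being the difference of [Kop 0 h] at 0 and at x. *)
have [N [mN N0 sN]] := FTC1Ny fiy locf.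
have F0 x : 0 < x < T -> \int[leb]_(t in [set` `]-oo, x]]) f t = 0.
  move=> /andP[x0 xT].
  rewrite /f -Rintegral_mkcondr.
  have -> : [set` `]-oo, x]] `&` J = `]0, x]%classic.
    apply/seteqP; split=> t; rewrite /J /= !in_itv /=.
      by move=> [tx /andP[t0 _]]; rewrite t0 tx.
    by move=> /andP[t0 tx]; rewrite t0 tx (le_lt_trans tx).
  transitivity (\int[mu]_(t in `]0, x]) h t).
    congr fine; apply: eq_measure_integral => A mA Ax.
    rewrite /= /muJ /mrestr /=; congr (leb _); apply/esym/setIidPl => t /Ax /=.
    by rewrite !in_itv /= => /andP[-> tx]; exact: le_lt_trans tx xT.
  rewrite Rintegral_mkcond.
  transitivity (\int[mu]_t (kern 0 0 t * h t - kern 0 x t * h t)).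
    have ki c : 0 <= c -> mu.-integrable setT (EFin \o (fun t => kern 0 c t * h t)).
      by move=> c0; exact: kern_integrable.
    apply: eq_RintegralJ.
    - by apply/(measurable_restrictT _ _).1 => //; exact: measurable_funS mh.
    - apply: measurable_funB; apply: measurable_funM => //; exact: measurable_kern.
    - move=> t /andP[t0 tT]; rewrite patchE /kern t0 !mul0r expR0 mul1r.
      have [xt|tx] := ltP x t.
        by rewrite memNset ?mul1r ?subrr //= in_itv /= t0 /= leNgt xt.
      by rewrite mul0r subr0 mem_set //= in_itv /= t0.
  rewrite RintegralB //; last 2 first.
  - exact: kern_integrable.
  - by apply: kern_integrable => //; exact: ltW.
  by have := H0 0; have := H0 x; rewrite /Kop => -> => [->|]; rewrite ?subrr ?lexx ?ltW.
exists (N `|` ~` J); split.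
- by apply: measurableU => //; apply: measurableC; exact: measurable_itv.
- apply/eqP; rewrite -measure_le0; apply: le_trans (measureU2 _ _ _) _ => //.
    by apply: measurableC; exact: measurable_itv.
  rewrite [X in (_ + X)%E](muJ_out T) adde0 -N0 /= /muJ /mrestr /=.
  by apply: le_measure; rewrite ?inE //; apply: measurableI => //; exact: measurable_itv.
- move=> x /= nx; have [xJ|] := pselect (J x); last by right.
  left; apply: sN => /= -[_ dF]; apply: nx.
  have -> : h x = f x by rewrite /f patchE mem_set.
  rewrite -dF derive1E (@near_eq_derive _ _ _ _ (cst 0)) ?derive_cst //.
  move: xJ; rewrite /J /= in_itv /= => /andP[x0 xT].
  near=> y; apply: F0; apply/andP; split; near: y; [exact: lt_nbhsr|exact: lt_nbhsl].
Unshelve. all: by end_near. Qed.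

End WeakDerivatives.

(** * The isometry of E onto F *)

Section InverseOperator.
Context {R : realType} (T lam : R).
Hypotheses (T0 : 0 < T) (lam0 : 0 < lam).
Local Notation mu := (muJ T).
Local Notation Kop := (Kop T).
Implicit Types (a b t s : R) (q : E T).

Let Nlam0 : - lam <= 0. Proof. by rewrite oppr_le0 ltW. Qed.

Let E_integrable q : mu.-integrable setT (EFin \o q).
Proof. by apply: Lfun2_integrable; exact: LfunP. Qed.

(* The solution v of -v' + lam v = lam q, v(T) = 0. *)
Definition Sinv_fun q t : R := if 0 <= t <= T then lam * Kop (- lam) q t else 0.

Lemma measurable_Sinv_fun q : measurable_fun setT (Sinv_fun q).
Proof.
apply: measurable_fun_ifT => //.
- by apply: measurable_and; exact: measurable_fun_ler.
- by apply: measurable_funM => //; exact: measurable_Kop.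
Qed.

Lemma Sinv_fun_within q : {within `[0, T], continuous (Sinv_fun q)}.
Proof.
apply: (@within_continuous_modulus _ _ _
    (lam ^+ 2 * ((1 - - lam * T) * \int[mu]_t (q t ^+ 2)))).
  rewrite mulr_ge0 ?sqr_ge0 // mulr_ge0 //.
    by rewrite mulNr opprK addr_ge0 // mulr_ge0 // ltW.
  by apply: Rintegral_ge0 => t _; exact: sqr_ge0.
move=> t t' t0 tt' t'T.
rewrite /Sinv_fun t0 t'T (le_trans t0 tt') (le_trans tt' t'T) /= -mulrBr exprMn.
rewrite -mulrA ler_wpM2l ?sqr_ge0 // mulrAC; apply: Kop_modulus => //; exact: LfunP.
Qed.

Lemma Sinv_fun_bdd q : exists M, bddJ T M (Sinv_fun q).
Proof.
by apply: within_continuous_bdd; [exact: measurable_Sinv_fun|exact: Sinv_fun_within].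
Qed.

Lemma Sinv_fun_Lfun2 q : Sinv_fun q \in Lfun mu 2%:E.
Proof. by have [M] := Sinv_fun_bdd q; exact: bddJ_Lfun2. Qed.

Lemma Sinv_fun_inJ q t : 0 < t < T -> Sinv_fun q t = lam * Kop (- lam) q t.
Proof. by move=> /andP[t0 tT]; rewrite /Sinv_fun !ltW. Qed.

Definition Sinv_E q : E T := Lfun_Sub (lee1n 2) (Sinv_fun_Lfun2 q).

(** The derivative is read off the equation - v' + lam v = lam q. *)
Definition dSinv q : E T := lam *: Sinv_E q - lam *: q.

Lemma Sinv_fun_weak q : weak_deriv T (Sinv_fun q) (dSinv q).
Proof.
move=> phi C.
have [M phiM] := C1c_bddJ C; have [M' phiM'] := C1c_bddJ' C.
have Ki := E_integrable q.
have Kbi := bddJ_integrable (Kop_bdd (- lam) Ki).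
have vi : mu.-integrable setT (EFin \o Sinv_fun q) by apply: Lfun2_integrable; exact: Sinv_fun_Lfun2.
have K1 := integrable_mul_bddJ Kbi phiM'; have K0 := integrable_mul_bddJ Kbi phiM.
have v1 := integrable_mul_bddJ vi phiM'; have v0 := integrable_mul_bddJ vi phiM.
have q0 := integrable_mul_bddJ Ki phiM.
have E1 : \int[mu]_t (Sinv_fun q t * derive1 phi t) =
    lam * \int[mu]_t (Kop (- lam) q t * derive1 phi t).
  rewrite -RintegralZl //; apply: eq_RintegralJ.
  - exact: measurable_integrable v1.
  - by apply: measurable_funM => //; exact: measurable_integrable K1.
  - by move=> t tJ; rewrite Sinv_fun_inJ // mulrA.
have E0 : \int[mu]_t (Sinv_fun q t * phi t) = lam * \int[mu]_t (Kop (- lam) q t * phi t).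
  rewrite -RintegralZl //; apply: eq_RintegralJ.
  - exact: measurable_integrable v0.
  - by apply: measurable_funM => //; exact: measurable_integrable K0.
  - by move=> t tJ; rewrite Sinv_fun_inJ // mulrA.
have -> : \int[mu]_t (dSinv q t * phi t) =
    lam * \int[mu]_t (Sinv_fun q t * phi t) - lam * \int[mu]_t (q t * phi t).
  rewrite -!RintegralZl // -RintegralB //.
  - by apply: eq_Rintegral => t _; rewrite [LHS](_ : _ = (lam * Sinv_fun q t - lam * q t) * phi t) //; ring.
  - exact: (integrableZl measurableT lam v0).
  - exact: (integrableZl measurableT lam q0).
rewrite E1 (Kop_weak _ Ki C) E0; ring.
Qed.

Lemma Sinv_funP q : Sinv_fun q \in Fpred T.
Proof.
rewrite inE; split.
- by split; [exact: Sinv_fun_Lfun2|exists (dSinv q); exact: Sinv_fun_weak].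
- exact: Sinv_fun_within.
- by rewrite /Sinv_fun (ltW T0) lexx /= KopT ?mulr0.
- by move=> t; rewrite in_itv /= /Sinv_fun => /negbTE ->.
Qed.

Lemma dSinvE q t : dSinv q t = lam * Sinv_fun q t - lam * q t. Proof. by []. Qed.

Definition Sinv q : F T := MkF (Sinv_funP q).

Lemma SinvE q t : Sinv q t = Sinv_fun q t. Proof. by []. Qed.

Lemma Kop_linear a c (x y : E T) t : 0 <= t -> Kop a (c *: x + y) t = c * Kop a x t + Kop a y t.
Proof.
move=> t0; have xi := kern_integrable a t0 (E_integrable x).
have yi := kern_integrable a t0 (E_integrable y).
rewrite /Kop -RintegralZl // -RintegralD //; last exact: (integrableZl measurableT c xi).
apply: eq_Rintegral => s _.
by rewrite [LHS](_ : _ = kern a t s * (c * x s + y s)) //; ring.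
Qed.

Lemma Sinv_linear c (x y : E T) : Sinv (c *: x + y) = c *: Sinv x + Sinv y.
Proof.
apply: val_inj; apply/funext => t.
rewrite [RHS](_ : _ = c * Sinv_fun x t + Sinv_fun y t) // /= /Sinv_fun.
by case: ifP => [/andP[t0 _]|_]; [rewrite Kop_linear //; ring|rewrite mulr0 addr0].
Qed.

Lemma vderivP (v : F T) : weak_deriv T v (vderiv v).
Proof.
rewrite /vderiv; case: xgetP => // noex.
have : F_fun v \in Fpred T by exact: F_funP.
by rewrite inE => -[[_ [g gv]] _ _ _]; have := noex g.
Qed.

Lemma weak_deriv_unique (v : R -> R) (g g' : E T) : weak_deriv T v g -> weak_deriv T v g' ->
  {ae mu, forall t, g t = g' t}.
Proof.
move=> vg vg'.
have h2 : (fun t => g t - g' t) \in Lfun mu 2%:E by exact: (LfunP (g - g')).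
have [|N [mN N0 sN]] := weak_zero T0 h2; last first.
  exists N; split=> // t /= nt; apply: sN => /= /eqP; rewrite subr_eq0 => /eqP E.
  exact: nt.
move=> phi C; have [M phiM] := C1c_bddJ C.
have gi := integrable_mul_bddJ (E_integrable g) phiM.
have gi' := integrable_mul_bddJ (E_integrable g') phiM.
under eq_Rintegral do rewrite mulrBl.
rewrite RintegralB //; apply/eqP; rewrite subr_eq0; apply/eqP/oppr_inj.
by rewrite -vg // -vg'.
Qed.

Lemma vderiv_Sinv q : {ae mu, forall t, vderiv (Sinv q) t = lam * Sinv_fun q t - lam * q t}.
Proof. exact: (@weak_deriv_unique (Sinv q) (vderiv (Sinv q)) (dSinv q) (vderivP _) (Sinv_fun_weak q)). Qed.

Lemma E_measurable q : measurable_fun setT q.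
Proof. by apply: Lfun2_measurable; exact: LfunP. Qed.

Lemma bform_Sinv (w q : E T) : bform lam w (Sinv q) = lam * \int[mu]_t (w t * q t).
Proof.
have wq := E_mul_integrable w q.
rewrite /bform -RintegralZl //; apply: eq_Rintegral_ae.
- apply: measurable_funM; first exact: E_measurable.
  apply: measurable_funD; first by apply: measurableT_comp => //; exact: E_measurable.
  by apply: measurable_funM => //; exact: measurable_Sinv_fun.
- by apply: measurable_funM => //; exact: measurable_integrable wq.
- have [N [mN N0 sN]] := vderiv_Sinv q; exists N; split=> // t /= nt; apply: sN => /= E.
  by apply: nt; rewrite E /=; ring.
Qed.

(** With w = [Kop (- lam) q] one has v = lam w and v' = lam^2 w - lam q. In the squared norm of v
    the integrals of w^2 and q w are cancelled by |v(0)|^2, which [Kop_energy] evaluates, and lam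
    int q^2 remains. *)
Lemma normF_Sinv q : normF lam (Sinv q) = normE lam q.
Proof.
have qi := E_integrable q; have q2 : (q : R -> R) \in Lfun mu 2%:E by exact: LfunP.
have Kb := Kop_bdd (- lam) qi; have Ki := bddJ_integrable Kb.
have v2 := Sinv_fun_Lfun2 q.
rewrite /normF /normE; congr Num.sqrt.
rewrite !L2norm_sqr //; last exact: LfunP.
pose w t := Kop (- lam) q t.
have w2 : w \in Lfun mu 2%:E by exact: bddJ_Lfun2 Kb.
have wi : mu.-integrable setT (EFin \o (fun t => w t ^+ 2)).
  by apply: eq_integrable (Lfun2_mul_integrable w2 w2) => // t _ /=; rewrite expr2.
have qwi : mu.-integrable setT (EFin \o (fun t => q t * w t)).
  exact: Lfun2_mul_integrable q2 w2.
have q2i : mu.-integrable setT (EFin \o (fun t => q t ^+ 2)).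
  by apply: eq_integrable (Lfun2_mul_integrable q2 q2) => // t _ /=; rewrite expr2.
have -> : \int[mu]_t (Sinv q t ^+ 2) = lam ^+ 2 * \int[mu]_t (w t ^+ 2).
  rewrite -RintegralZl //; apply: eq_RintegralJ.
  - by apply: measurable_funX; exact: measurable_Sinv_fun.
  - by apply: measurable_funM => //; exact: measurable_integrable wi.
  - by move=> t tJ; rewrite SinvE Sinv_fun_inJ // exprMn.
have -> : \int[mu]_t (vderiv (Sinv q) t ^+ 2) = lam ^+ 4 * \int[mu]_t (w t ^+ 2)
    - 2 * lam ^+ 3 * \int[mu]_t (q t * w t) + lam ^+ 2 * \int[mu]_t (q t ^+ 2).
  have i1 : mu.-integrable setT (EFin \o (fun t => lam ^+ 4 * w t ^+ 2)).
    exact: (integrableZl measurableT (lam ^+ 4) wi).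
  have i2 : mu.-integrable setT (EFin \o (fun t => 2 * lam ^+ 3 * (q t * w t))).
    exact: (integrableZl measurableT (2 * lam ^+ 3) qwi).
  have i3 : mu.-integrable setT (EFin \o (fun t => lam ^+ 2 * q t ^+ 2)).
    exact: (integrableZl measurableT (lam ^+ 2) q2i).
  have i12 : mu.-integrable setT (EFin \o (fun t => lam ^+ 4 * w t ^+ 2 - 2 * lam ^+ 3 * (q t * w t))).
    exact: (integrableB measurableT i1 i2).
  rewrite -!RintegralZl // -RintegralB // -RintegralD //.
  apply: eq_Rintegral_ae.
  - by apply: measurable_funX; exact: E_measurable.
  - by apply: measurable_funD; [exact: measurable_integrable i12|exact: measurable_integrable i3].
  have [N [mN N0 sN]] := vderiv_Sinv q; exists (N `|` ~` `]0, T[%classic); split.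
  - by apply: measurableU => //; apply: measurableC; exact: measurable_itv.
  - apply/eqP; rewrite -measure_le0; apply: le_trans (measureU2 _ _ _) _ => //.
      by apply: measurableC; exact: measurable_itv.
    by rewrite [X in (_ + X)%E](muJ_out T) adde0 -[leRHS]N0 lexx.
  - move=> t /= nt; have [tJ|] := pselect (`]0, T[%classic t); last by right.
    left; apply: sN => /= E; apply: nt; rewrite E.
    rewrite Sinv_fun_inJ.
      by rewrite -/(w t); ring.
    by move: tJ; rewrite /= in_itv.
have -> : `|Sinv q 0| ^+ 2 = lam ^+ 2 * (w 0) ^+ 2.
  by rewrite real_normK ?num_real // SinvE /Sinv_fun lexx (ltW T0) /= exprMn.
have := Kop_energy (- lam) qi; rewrite -/(w 0) => ->.
by rewrite /w; field; rewrite gt_eqF.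
Qed.

(** The equation forces q = v - v' / lam. The difference z = v - S q solves z' = lam z weakly with
    z(T) = 0, and the integrating factor exp(- lam t) reduces this to [weak_constant_zero]. Equality
    holds at every real t because both functions are 0 outside [0, T]. *)
Lemma Sinv_surj (v : F T) : exists q : E T, v = Sinv q.
Proof.
have : F_fun v \in Fpred T by exact: F_funP.
rewrite inE => -[[v2 _] cv vT vout].
pose vE : E T := Lfun_Sub (lee1n 2) v2.
pose q : E T := vE - lam^-1 *: vderiv v; exists q.
pose z t := v t - Sinv_fun q t.
have qE t : q t = v t - lam^-1 * vderiv v t by [].
have mv : measurable_fun setT v by exact: Lfun2_measurable v2.
have mz : measurable_fun setT z by apply: measurable_funB => //; exact: measurable_Sinv_fun.
have cz : {within `[0, T], continuous z}.
  by move=> t; apply: continuousB; [exact: cv|exact: Sinv_fun_within].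
have zT : z T = 0.
  by rewrite /z vT /Sinv_fun (ltW T0) lexx /= (KopT _ (E_integrable q)) mulr0 subrr.
have vi := Lfun2_integrable v2.
have si := Lfun2_integrable (Sinv_fun_Lfun2 q).
have zi : mu.-integrable setT (EFin \o z) by exact: (integrableB measurableT vi si).
have zweak phi : C1c T phi ->
    \int[mu]_t (z t * derive1 phi t) = - lam * \int[mu]_t (z t * phi t).
  move=> C; have [M phiM] := C1c_bddJ C; have [M' phiM'] := C1c_bddJ' C.
  have v1 := integrable_mul_bddJ vi phiM'; have s1 := integrable_mul_bddJ si phiM'.
  have z1 := integrable_mul_bddJ zi phiM.
  have dv1 := integrable_mul_bddJ (E_integrable (vderiv v)) phiM.
  have ds1 := integrable_mul_bddJ (E_integrable (dSinv q)) phiM.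
  under eq_Rintegral do rewrite mulrBl.
  rewrite RintegralB // (vderivP v C) (Sinv_fun_weak q C) opprK addrC -RintegralB //.
  rewrite -RintegralZl //; apply: eq_Rintegral => t _.
  rewrite dSinvE qE /z.
  by field; rewrite gt_eqF.
pose e t := expR (- lam * t + 0).
have ce : continuous e by exact: continuous_affine_expR.
have me := continuous_measurable_fun ce.
have yz : forall t, 0 <= t <= T -> e t * z t = 0.
  apply: (weak_constant_zero T0 (y := fun t => e t * z t)).
  - exact: measurable_funM.
  - by move=> x; apply: continuousM; [exact: continuous_subspaceT|exact: cz].
  - by rewrite zT mulr0.
  move=> psi C; have [dpsi cpsi spsi] := C.
  have de (x : R) : is_derive x 1 e (- lam * e x) by exact: is_derive_expR_affine.
  have dphi (x : R) : is_derive x 1 (fun t => e t * psi t) (e x * derive1 psi x - lam * (e x * psi x)).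
    have dex := de x; have dpx := C1c_is_derive x C.
    by apply: is_derive_eq; rewrite /GRing.scale /=; ring.
  have d1 : derive1 (fun t => e t * psi t) = (fun x => e x * derive1 psi x - lam * (e x * psi x)).
    by apply/funext => x; rewrite derive1E; exact: derive_val.
  have cps : continuous psi by move=> x; apply/differentiable_continuous/derivable1_diffP.
  have Cphi : C1c T (fun t => e t * psi t).
    split.
    - by move=> x; have dpx := dphi x; exact: ex_derive.
    - rewrite d1 => x; apply: cvgB; first by apply: cvgM; [exact: ce|exact: cpsi].
      by apply: cvgMr; apply: cvgM; [exact: ce|exact: cps].
    - apply: subset_trans spsi; apply: closure_subset => t /=.
      by apply: contraNneq => ->; rewrite mulr0.
  have := zweak _ Cphi; rewrite d1.
  have [M phiM] := C1c_bddJ Cphi.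
  have zp := integrable_mul_bddJ zi phiM.
  have [M' eM] := @continuous_bddJ _ T (fun x => e x * derive1 psi x) (fun x => cvgM (ce x) (cpsi x)).
  have zd := integrable_mul_bddJ zi eM.
  under eq_Rintegral do rewrite mulrBr.
  rewrite RintegralB //; last first.
    have := integrableZl measurableT lam zp.
    by apply: eq_integrable => // t _ /=; rewrite -EFinM mulrCA.
  have -> : \int[mu]_t (z t * (lam * (e t * psi t))) = lam * \int[mu]_t (z t * (e t * psi t)).
    by rewrite -RintegralZl //; apply: eq_Rintegral => t _; rewrite mulrCA.
  move/eqP; rewrite mulNr subr_eq addNr => /eqP <-.
  by apply: eq_Rintegral => t _; ring.
apply: val_inj; apply/funext => t /=.
have [tin|tout] := boolP (0 <= t <= T); last first.
  by rewrite vout ?in_itv // /Sinv_fun (negbTE tout).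
have /eqP := yz t tin; rewrite mulf_eq0 gt_eqF ?expR_gt0 //= subr_eq0 => /eqP.
by [].
Qed.

End InverseOperator.

(** * Elements of the projective tensor product as functions *)

Section L2Limit.
Context d (S : measurableType d) (R : realType) (mu : {measure set S -> \bar R}).
Hypothesis mu_fin : (mu setT < +oo)%E.
Variable u : nat -> S -> R.
Hypothesis u2 : forall n, u n \in Lfun mu 2%:E.
Local Notation b := (2^-1 : R).
Hypothesis u_cauchy : forall n m, (n <= m)%N ->
  (\int[mu]_x ((u m x - u n x) ^+ 2)%:E <= ((b ^+ n) ^+ 2)%:E)%E.

(** An upper limit is measurable and defined at every point, with no exceptional set to be chosen; a
    symmetry shared by all the u_n passes to it pointwise. *)
Definition L2lim (x : S) : R := fine (limn_esup (fun n => (u n x)%:E)).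

Let mu_ n : measurable_fun setT (u n). Proof. exact: Lfun2_measurable (u2 n). Qed.

Let b0 : 0 < b. Proof. by rewrite invr_gt0. Qed.

Let sum_geo n : \sum_(k < n) b ^+ k <= 2.
Proof.
suff -> : \sum_(k < n) b ^+ k = 2 - 2 * b ^+ n.
  by rewrite gerBl mulr_ge0 // exprn_ge0 // ltW.
elim: n => [|n IH]; first by rewrite big_ord0 expr0 mulr1 subrr.
by rewrite big_ord_recr /= IH exprS; field.
Qed.

(** The inequality |y| <= y^2 / c + c with c = 2^-k turns the rate in square mean into summable
    bounds on the integrals of the increments. *)
Let step_integral k :
  (\int[mu]_x `|u k.+1 x - u k x|%:E <= (b ^+ k * (1 + fine (mu setT)))%:E)%E.
Proof.
have bk : 0 < b ^+ k by rewrite exprn_gt0.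
have md : measurable_fun setT (fun x => u k.+1 x - u k x) by exact: measurable_funB.
have mfin : mu setT \is a fin_num by rewrite ge0_fin_numE.
apply: (@le_trans _ _ (\int[mu]_x (((b ^+ k)^-1)%:E * ((u k.+1 x - u k x) ^+ 2)%:E + (b ^+ k)%:E))%E).
  apply: ge0_le_integral => //.
  - by apply/measurable_EFinP; exact: measurableT_comp.
  - apply: emeasurable_funD; last exact: measurable_cst.
    by apply/measurable_EFinP; apply: measurable_funM => //; exact: measurable_funX.
  move=> x _; rewrite -EFinM -EFinD lee_fin.
  set y := u k.+1 x - u k x; set c := b ^+ k in bk *.
  have h := sqr_ge0 (`|y| - c).
  have yy : y ^+ 2 = `|y| ^+ 2 by rewrite real_normK ?num_real.
  rewrite -(ler_pM2l bk) mulrDr mulrA mulfV ?gt_eqF // mul1r yy.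
  by have := normr_ge0 y; nra.
rewrite ge0_integralD //; first last.
- by apply/measurable_EFinP; apply: measurable_funM => //; exact: measurable_funX.
- by move=> x _; rewrite mule_ge0 ?lee_fin ?invr_ge0 ?sqr_ge0 // ltW.
rewrite ge0_integralZl //; first last.
- by move=> x _; rewrite lee_fin sqr_ge0.
- by apply/measurable_EFinP; exact: measurable_funX.
rewrite integral_cst // mulrDr mulr1 EFinD; apply: leeD; last by rewrite EFinM fineK.
have := @lee_wpmul2l _ ((b ^+ k)^-1)%:E _ _ _ (u_cauchy (leqnSn k)).
rewrite lee_fin invr_ge0 (ltW bk) => /(_ isT) /le_trans; apply.
by rewrite -EFinM lee_fin expr2 mulKf ?gt_eqF.
Qed.

Let ae_cvg : {ae mu, forall x, cvgn (fun n => u n x)}.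
Proof.
pose D k x := `|u k.+1 x - u k x|.
have D0 k x : (0 <= (D k x)%:E)%E by rewrite lee_fin; exact: normr_ge0.
have mD k : measurable_fun setT (EFin \o D k).
  by apply/measurable_EFinP; apply: measurableT_comp => //; exact: measurable_funB.
have D_int : mu.-integrable setT (fun x => \sum_(k <oo) (D k x)%:E)%E.
  apply/integrableP; split.
    apply: ge0_emeasurable_sum => [k x _ _|k _]; [by rewrite lee_fin; exact: normr_ge0|exact: mD].
  under eq_integral => x _ do rewrite gee0_abs ?nneseries_ge0 //.
  rewrite integral_nneseries //.
  apply: (@le_lt_trans _ _ (2 * (1 + fine (mu setT)))%:E); last exact: ltry.
  apply: lime_le; first by apply: is_cvg_nneseries => k _ _; exact: integral_ge0.
  apply: nearW => n; rewrite big_mkord.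
  apply: (@le_trans _ _ (\sum_(k < n) (b ^+ k * (1 + fine (mu setT)))%:E)%E).
    by apply: lee_sum => k _; exact: step_integral.
  rewrite sumEFin lee_fin -mulr_suml.
  by apply: ler_wpM2r; [rewrite addr_ge0 // fine_ge0|exact: sum_geo].
have [N [mN N0 sN]] := integrable_ae measurableT D_int.
exists N; split=> // x /= nx; apply: sN => /= /(_ I) Dfin; apply: nx.
have cD : cvgn (series (fun k => u k.+1 x - u k x)).
  apply: normed_cvg; apply: nondecreasing_is_cvgn.
    by apply: nondecreasing_series => k _ _; exact: normr_ge0.
  exists (fine (\sum_(k <oo) (D k x)%:E)) => _ [n _ <-].
  rewrite -lee_fin fineK // /= -sumEFin.
  exact: nneseries_lim_ge.
rewrite (_ : (fun n => u n x) = (fun n => series (fun k => u k.+1 x - u k x) n + u 0%N x)).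
  by apply: is_cvgD => //; exact: is_cvg_cst.
by apply/funext => n; rewrite /series /= telescope_sumr // subrK.
Qed.

Lemma measurable_L2lim : measurable_fun setT L2lim.
Proof.
apply: measurableT_comp; first exact: fine_measurable.
by apply: measurable_fun_limn_esup => n; exact/measurable_EFinP.
Qed.

Let L2lim_cvg x : cvgn (fun n => u n x) -> u n x @[n --> \oo] --> L2lim x.
Proof.
move=> cu; rewrite /L2lim.
have h : (u n x)%:E @[n --> \oo] --> (limn (fun n => u n x))%:E by apply: cvg_EFin => //; exact: nearW.
have [_ ->] := cvg_limn_einf_sup h.
exact: cu.
Qed.

(** Fatou's lemma in the larger index carries the Cauchy rate over to the limit. *)
Lemma L2lim_dist n : (\int[mu]_x ((L2lim x - u n x) ^+ 2)%:E <= ((b ^+ n) ^+ 2)%:E)%E.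
Proof.
pose f k x := ((u k x - u n x) ^+ 2)%:E.
have mf k : measurable_fun setT (f k).
  by apply/measurable_EFinP; apply: measurable_funX; exact: measurable_funB.
have f0 k x : setT x -> (0 <= f k x)%E by move=> _; rewrite lee_fin sqr_ge0.
have mL := measurable_L2lim.
have -> : (\int[mu]_x ((L2lim x - u n x) ^+ 2)%:E = \int[mu]_x limn_einf (f ^~ x))%E.
  apply: ae_eq_integral => //.
  - by apply/measurable_EFinP; apply: measurable_funX; exact: measurable_funB.
  - rewrite /limn_einf; apply: measurableT_comp => //.
    by apply: measurable_fun_limn_esup => k; exact: measurableT_comp.
  have [N [mN N0 sN]] := ae_cvg; exists N; split=> // x /= nx; apply: sN => /= cx; apply: nx => _.
  have ux := L2lim_cvg cx.
  have h : (f k x) @[k --> \oo] --> ((L2lim x - u n x) ^+ 2)%:E.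
    apply: cvg_EFin; first exact: nearW.
    by rewrite expr2; apply: cvgM; apply: cvgB => //; exact: cvg_cst.
  by have [-> _] := cvg_limn_einf_sup h.
apply: le_trans (fatou mu measurableT mf f0) _.
rewrite limn_einf_lim; apply: lime_le; first exact: is_cvg_einfs.
near=> k; apply: (@le_trans _ _ (\int[mu]_x f k x)%E).
  by apply: ereal_inf_lbound; exists k => /=.
by apply: u_cauchy; near: k; exact: nbhs_infty_ge.
Unshelve. all: by end_near. Qed.

Lemma L2lim_Lfun2 : L2lim \in Lfun mu 2%:E.
Proof.
have h : (fun x => L2lim x - u 0%N x) \in Lfun mu 2%:E.
  apply: Lfun2_sqrP; first by apply: measurable_funB => //; exact: measurable_L2lim.
  apply/integrableP; split.
    by apply/measurable_EFinP; apply: measurable_funX; apply: measurable_funB => //; exact: measurable_L2lim.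
  apply: le_lt_trans (ltry ((b ^+ 0) ^+ 2)); apply: le_trans (L2lim_dist 0).
  rewrite le_eqVlt; apply/orP; left; apply/eqP; apply: eq_integral => x _ /=.
  by rewrite ger0_norm // sqr_ge0.
rewrite (_ : L2lim = (fun x => (L2lim x - u 0%N x) + u 0%N x)); last first.
  by apply/funext => x; rewrite subrK.
exact: (LfunP ((Lfun_Sub (lee1n 2) h : LfunType mu (lee1n 2)) + Lfun_Sub (lee1n 2) (u2 0))).
Qed.

Lemma Lnorm_L2lim :
  ('N[mu]_2%:E [EFin \o (u n \- L2lim)%R] @[n --> \oo] --> 0)%E.
Proof.
have bn : b ^+ n @[n --> \oo] --> 0.
  by apply: cvg_expr; rewrite ger0_norm ?(ltW b0) // invf_lt1 // ltr1n.
have bE : (b ^+ n)%:E @[n --> \oo] --> 0%E by apply: cvg_EFin => //; exact: nearW.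
apply: (@squeeze_cvge _ _ _ _ (cst 0%E) _ (fun n => (b ^+ n)%:E)) => //; last exact: cvg_cst.
apply: nearW => n; rewrite Lnorm_ge0 /=.
have Nfin : ('N[mu]_2%:E [EFin \o (u n \- L2lim)%R] < +oo)%E.
  have := LfunP ((Lfun_Sub (lee1n 2) (u2 n) : LfunType mu (lee1n 2)) - Lfun_Sub (lee1n 2) L2lim_Lfun2).
  by rewrite inE => /andP[_]; rewrite inE.
have Nf : ('N[mu]_2%:E [EFin \o (u n \- L2lim)%R])%E \is a fin_num.
  by rewrite ge0_fin_numE; [exact: Nfin|exact: Lnorm_ge0].
rewrite -(fineK Nf) lee_fin -(@ler_pXn2r _ 2) ?nnegrE ?fine_ge0 ?Lnorm_ge0 ?exprn_ge0 ?(ltW b0) //.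
rewrite -lee_fin; apply: le_trans (L2lim_dist n).
rewrite -powR_mulrn ?fine_ge0 ?Lnorm_ge0 // -poweR_EFin fineK // Lnorm2_sqr.
rewrite le_eqVlt; apply/orP; left; apply/eqP; apply: eq_integral => x _ /=.
by congr EFin; ring.
Qed.

End L2Limit.

(** * The function represented by a limit of tensors *)

Section RepresentingFunction.
Context {R : realType} (T lam : R).
Hypotheses (T0 : 0 < T) (lam0 : 0 < lam).
Local Notation mu := (muJ T).
Local Notation mu2 := (muJ T \x muJ T)%E.
Implicit Types (x y w : E T) (s : seq (E T * E T)).

Lemma normE_sqrt x : normE lam x = Num.sqrt (lam * \int[mu]_t (x t ^+ 2)).
Proof. by rewrite /normE L2norm_sqr //; exact: LfunP. Qed.

Lemma normE_ge0 x : 0 <= normE lam x. Proof. exact: sqrtr_ge0. Qed.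

Lemma eval_bilinear_l (z : R * R) (c : R) x x' y :
  (c *: x + x') z.1 * y z.2 = c *: (x z.1 * y z.2 : R) + x' z.1 * y z.2.
Proof. by rewrite [LHS](_ : _ = (c * x z.1 + x' z.1) * y z.2) // mulrDl -mulrA. Qed.

Lemma eval_bilinear_r (z : R * R) (c : R) x y y' :
  x z.1 * (c *: y + y') z.2 = c *: (x z.1 * y z.2 : R) + x z.1 * y' z.2.
Proof. by rewrite [LHS](_ : _ = x z.1 * (c * y z.2 + y' z.2)) // mulrDr mulrCA. Qed.

Definition eval_form z : {bilinear E T -> E T -> R} :=
  mk_bilinear (eval_bilinear_l z) (fun c x => eval_bilinear_r z c x).

Lemma tensE_fun_tsum s z : tensE_fun s z = tsum (eval_form z) s. Proof. by []. Qed.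

(** Evaluation at a point of the plane is itself a bilinear form on [E], so [tensor_eq] already
    tests equality pointwise. *)
Lemma tensE_fun_eq s s' : tensor_eq s s' -> tensE_fun s = tensE_fun s'.
Proof. by move=> ss'; apply/funext => z; rewrite !tensE_fun_tsum ss'. Qed.

Lemma sqr_integrable_E x : mu.-integrable setT (EFin \o (fun t => x t ^+ 2)).
Proof. by apply: eq_integrable (E_mul_integrable x x) => // t _ /=; rewrite expr2. Qed.

Lemma tens1_sqr_integral x y :
  (\int[mu2]_z ((x z.1 * y z.2) ^+ 2)%:E =
   ((\int[mu]_t (x t ^+ 2)) * (\int[mu]_t (y t ^+ 2)))%:E)%E.
Proof.
have mx := E_measurable x; have my := E_measurable y.
have xi := sqr_integrable_E x; have yi := sqr_integrable_E y.
have fin (w : E T) : (\int[mu]_t (w t ^+ 2)%:E)%E = (\int[mu]_t (w t ^+ 2))%:E.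
  by rewrite /Rintegral fineK //; exact: integrable_fin_num (sqr_integrable_E w).
rewrite (fubini_tonelli1 (fun z => ((x z.1 * y z.2) ^+ 2)%:E)); first last.
- by move=> z; rewrite lee_fin sqr_ge0.
- apply/measurable_EFinP; apply: measurable_funX; apply: measurable_funM.
    exact: measurableT_comp.
  exact: measurableT_comp.
rewrite /fubini_F /=.
transitivity (\int[mu]_t ((x t ^+ 2)%:E * (\int[mu]_r (y r ^+ 2))%:E))%E.
  apply: eq_integral => t _; rewrite -fin -ge0_integralZl //.
  - by apply: eq_integral => r _; rewrite -EFinM exprMn.
  - by apply/measurable_EFinP; exact: measurable_funX.
  - by move=> r _; rewrite lee_fin sqr_ge0.
  - by rewrite lee_fin sqr_ge0.
rewrite ge0_integralZr //.
- by rewrite fin -EFinM.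
- by apply/measurable_EFinP; exact: measurable_funX.
- by move=> r _; rewrite lee_fin sqr_ge0.
- by rewrite lee_fin; apply: Rintegral_ge0 => r _; exact: sqr_ge0.
Qed.

Lemma tens1_Lfun2 x y : (fun z : R * R => x z.1 * y z.2) \in Lfun mu2 2%:E.
Proof.
have mxy : measurable_fun setT (fun z : R * R => x z.1 * y z.2).
  by apply: measurable_funM; apply: measurableT_comp => //; exact: E_measurable.
apply: Lfun2_sqrP => //; apply/integrableP; split.
  by apply/measurable_EFinP; exact: measurable_funX.
under eq_integral => z _ do rewrite /= ger0_norm ?sqr_ge0 //.
by rewrite tens1_sqr_integral ltry.
Qed.

Definition tens1 (p : E T * E T) : E2 T := Lfun_Sub (lee1n 2) (tens1_Lfun2 p.1 p.2).
Definition tensE2 s : E2 T := \sum_(p <- s) tens1 p.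

Lemma tensE2E s z : tensE2 s z = tensE_fun s z.
Proof.
rewrite /tensE2 /tensE_fun; elim: s => [|p s IH]; first by rewrite !big_nil.
by rewrite !big_cons -IH.
Qed.

Definition nm2 (w : E2 T) : R := fine ('N[mu2]_2%:E[EFin \o w])%E.

Lemma nm2_sqr (w : E2 T) : (\int[mu2]_z (w z ^+ 2)%:E)%E = ((nm2 w) ^+ 2)%:E.
Proof.
rewrite -Lnorm2_sqr -(finite_norm_fine w) poweR_EFin powR_mulrn //.
by rewrite fine_ge0 // Lnorm_ge0.
Qed.

Lemma nm2_ge0 (w : E2 T) : 0 <= nm2 w. Proof. by rewrite fine_ge0 // Lnorm_ge0. Qed.

Lemma nm2_tens1 p : lam * nm2 (tens1 p) = normE lam p.1 * normE lam p.2.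
Proof.
have i0 (w : E T) : 0 <= \int[mu]_t (w t ^+ 2).
  by apply: Rintegral_ge0 => r _; exact: sqr_ge0.
rewrite !normE_sqrt -sqrtrM ?mulr_ge0 ?(ltW lam0) //.
rewrite (_ : lam * _ * (lam * _) = (lam * nm2 (tens1 p)) ^+ 2).
  by rewrite sqrtr_sqr ger0_norm // mulr_ge0 ?nm2_ge0 // ltW.
have := tens1_sqr_integral p.1 p.2; rewrite -[LHS]/(\int[mu2]_z (tens1 p z ^+ 2)%:E)%E.
by rewrite nm2_sqr exprMn => -[->]; ring.
Qed.

Lemma nm2_tensE2 s : lam * nm2 (tensE2 s) <= \sum_(p <- s) normE lam p.1 * normE lam p.2.
Proof.
elim: s => [|p s IH].
  rewrite /tensE2 !big_nil.
  have := nm2_sqr 0; under eq_integral => z _ do rewrite [(0 : E2 T) z](_ : _ = 0) // expr0n /=.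
  rewrite integral0 => -[/esym/eqP]; rewrite expf_eq0 /= => /eqP ->.
  by rewrite mulr0.
rewrite /tensE2 !big_cons -nm2_tens1.
apply: (@le_trans _ _ (lam * (nm2 (tens1 p) + nm2 (tensE2 s)))).
  by rewrite ler_wpM2l ?(ltW lam0) //; exact: ler_LnormD.
by rewrite mulrDr lerD2l.
Qed.

Variables (Epi : completeNormedModType R) (tE : {bilinear E T -> E T -> Epi}).
Hypothesis tEpi : tensor_completion (pi_norm (@normE R T lam) (@normE R T lam)) tE.

(** The L_2 norm is multiplicative on elementary tensors, so any representation bounds it by the
    triangle inequality. This is the continuity of the inclusion of [Epi] in L_2(J x J); the factor
    lam comes from the weight in [normE]. *)
Lemma nm2_le_tensor s : lam * nm2 (tensE2 s) <= `|tsum tE s|.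
Proof.
apply: (le_tensor_norm normE_ge0 tEpi) => s' ss'.
have -> : tensE2 s = tensE2 s'; last exact: nm2_tensE2.
by apply/LfuneqP => z; rewrite !tensE2E (tensE_fun_eq ss').
Qed.

Lemma tensE2_sub s s' z :
  tensE2 (s ++ tneg s') z = tensE_fun s z - tensE_fun s' z.
Proof. by rewrite tensE2E !tensE_fun_tsum tsum_cat tsum_neg. Qed.

Definition diag (cs : seq (E T)) := [seq (c, c) | c <- cs].

(** Each term c (x) c contributes the square of int c phi. *)
Lemma tensE_diag_form cs (phi : E T) :
  mu2.-integrable setT (EFin \o (fun z => tensE_fun (diag cs) z * (phi z.1 * phi z.2))) /\
  0 <= fine (\int[mu2]_z (tensE_fun (diag cs) z * (phi z.1 * phi z.2))%:E)%E.
Proof.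
have Fi (c : E T) : mu2.-integrable setT
    (EFin \o (fun z => (c z.1 * phi z.1) * (c z.2 * phi z.2))).
  apply: (FubiniJ (f := fun t => c t * phi t) (g := fun t => c t * phi t)).
  - have m := measurable_integrable (E_mul_integrable c phi).
    by apply: measurable_funM; [exact: (measurableT_comp m)|exact: (measurableT_comp m)].
  - exact: E_mul_integrable.
  - exact: E_mul_integrable.
  - by move=> t s _ _ /=; rewrite normrM.
have F0 (c : E T) : fine (\int[mu2]_z ((c z.1 * phi z.1) * (c z.2 * phi z.2))%:E)%E =
    (\int[mu]_t (c t * phi t)) ^+ 2.
  rewrite -(Rintegral12 (Fi c)) /= expr2 -RintegralZr //; last exact: E_mul_integrable.
  by apply: eq_Rintegral => t _; rewrite RintegralZl //; exact: E_mul_integrable.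
elim: cs => [|c cs [IHi IH0]].
  have E0 z : tensE_fun (diag [::]) z * (phi z.1 * phi z.2) = 0.
    by rewrite /tensE_fun big_nil mul0r.
  split; last by under eq_integral do rewrite E0; rewrite integral0.
  rewrite (_ : EFin \o _ = cst 0%E); last by apply/funext => z /=; rewrite E0.
  exact: integrable0.
have Ec z : tensE_fun (diag (c :: cs)) z * (phi z.1 * phi z.2) =
    (c z.1 * phi z.1) * (c z.2 * phi z.2) + tensE_fun (diag cs) z * (phi z.1 * phi z.2).
  by rewrite /tensE_fun /= big_cons /=; ring.
split.
  by apply: eq_integrable (integrableD measurableT (Fi c) IHi) => // z _ /=; rewrite Ec.
rewrite (_ : fine _ = \int[mu2]_z ((c z.1 * phi z.1) * (c z.2 * phi z.2) +
   tensE_fun (diag cs) z * (phi z.1 * phi z.2))); last first.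
  by apply: eq_Rintegral => z _; rewrite Ec.
rewrite RintegralD //; apply: addr_ge0 => //.
by rewrite /Rintegral F0 sqr_ge0.
Qed.

Lemma diag_sym cs (r t : R) : tensE_fun (diag cs) (r, t) = tensE_fun (diag cs) (t, r).
Proof.
by rewrite /tensE_fun !big_map; apply: eq_bigr => c _ /=; rewrite mulrC.
Qed.

Lemma spsd_pi_limit (cs : nat -> seq (E T)) (U : Epi) :
  tsum tE (diag (cs n)) @[n --> \oo] --> U -> spsd_pi tE U.
Proof.
move=> csU; pose b : R := 2^-1; have b0 : 0 < b by rewrite invr_gt0.
(* Two errors of this size, divided by lam, add up to at most the 2^-n that the construction of
   [L2lim] asks for. *)
have sub k : exists n, `|U - tsum tE (diag (cs n))| <= lam / 2 * b ^+ k.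
  have e0 : 0 < lam / 2 * b ^+ k by rewrite mulr_gt0 ?divr_gt0 // exprn_gt0.
  by have /cvgrPdist_le/(_ _ e0)[n _ hn] := csU; exists n; exact: (hn n (leqnn n)).
pose nu k := proj1_sig (cid (sub k)).
have nuP k : `|U - tsum tE (diag (cs (nu k)))| <= lam / 2 * b ^+ k by rewrite /nu; case: cid.
pose sq k := diag (cs (nu k)).
have sqU : tsum tE (sq k) @[k --> \oo] --> U.
  have bk : b ^+ k @[k --> \oo] --> 0.
    by apply: cvg_expr; rewrite ger0_norm ?(ltW b0) // invf_lt1 // ltr1n.
  apply/cvgrPdist_le => e e0; near=> k; apply: le_trans (nuP k) _.
  rewrite mulrC -ler_pdivlMr ?divr_gt0 //.
  apply: le_trans (ler_norm _) _; near: k; apply: cvgr0_norm_le bk _ _.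
  by rewrite divr_gt0 // divr_gt0.
pose u k := tensE_fun (sq k).
have uE k : u k = tensE2 (sq k) by apply/funext => z; rewrite tensE2E.
have u2 k : u k \in Lfun mu2 2%:E by rewrite uE; exact: LfunP.
have mu2_fin : (mu2 setT < +oo)%E.
  rewrite -setXTT product_measure1E //.
  by rewrite lte_mul_pinfty // ?(fin_num_fun_lty (@muJ_fin _ T)) // muJ_fin_num.
have u_cauchy n m : (n <= m)%N ->
    (\int[mu2]_z ((u m z - u n z) ^+ 2)%:E <= ((b ^+ n) ^+ 2)%:E)%E.
  move=> nm; pose w := tensE2 (sq m ++ tneg (sq n)).
  rewrite (_ : (\int[mu2]_z ((u m z - u n z) ^+ 2)%:E)%E = (\int[mu2]_z (w z ^+ 2)%:E)%E); last first.
    by apply: eq_integral => z _; rewrite tensE2_sub.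
  rewrite nm2_sqr lee_fin lerXn2r ?nnegrE ?nm2_ge0 ?exprn_ge0 ?(ltW b0) //.
  rewrite -(ler_pM2l lam0); apply: le_trans (nm2_le_tensor _) _.
  rewrite tsum_cat tsum_neg.
  rewrite (_ : tsum tE (sq m) - tsum tE (sq n) = (U - tsum tE (sq n)) - (U - tsum tE (sq m))); last first.
    by rewrite opprB [RHS]addrC addrA subrK.
  apply: le_trans (ler_normB _ _) _; apply: le_trans (lerD (nuP n) (nuP m)) _.
  have : b ^+ m <= b ^+ n by apply: ler_wiXn2l => //; rewrite ?(ltW b0) // invf_le1 // ler1n.
  move=> bmn; rewrite -mulrDr mulrAC -mulrA ler_wpM2l ?(ltW lam0) //.
  by rewrite ler_pdivrMr //; lra.
pose w : E2 T := Lfun_Sub (lee1n 2) (L2lim_Lfun2 mu2_fin u2 u_cauchy).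
exists w.
  by exists sq; split=> //; exact: (Lnorm_L2lim mu2_fin u2 u_cauchy).
split.
  apply: aeW => z; rewrite /= /L2lim; congr (fine (limn_esup _)).
  by apply/funext => n; rewrite /u /sq diag_sym.
move=> phi.
have w2 : (w : R * R -> R) \in Lfun mu2 2%:E by exact: LfunP.
pose Phi : R * R -> R := fun z => phi z.1 * phi z.2.
have Phi2 : Phi \in Lfun mu2 2%:E := tens1_Lfun2 phi phi.
have wPhi := Lfun2_mul_integrable w2 Phi2.
have PP : mu2.-integrable setT (EFin \o (fun z => Phi z ^+ 2)).
  by apply: eq_integrable (Lfun2_mul_integrable Phi2 Phi2) => // z _ /=; rewrite expr2.
have -> : \int[mu]_s \int[mu]_t (w (s, t) * phi s * phi t) = \int[mu2]_z (w z * Phi z).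
  rewrite /Rintegral -(Rintegral12 wPhi); apply: eq_Rintegral => r _.
  by apply: eq_Rintegral => t _; rewrite /Phi /= mulrA.
pose K := \int[mu2]_z (Phi z ^+ 2).
have K0 : 0 <= K by apply: Rintegral_ge0 => z _; exact: sqr_ge0.
(* The approximant u_n pairs nonnegatively with Phi. The error D is handled by Young's inequality
   with weight 2^-n, which matches its squared norm of at most 4^-n. *)
have lower n : - (b ^+ n * ((1 + K) / 2)) <= \int[mu2]_z (w z * Phi z).
  have bn : 0 < b ^+ n by rewrite exprn_gt0.
  pose D : R * R -> R := fun z => w z - u n z.
  have D2 : D \in Lfun mu2 2%:E by rewrite /D uE; exact: (LfunP (w - tensE2 (sq n))).
  have DD : mu2.-integrable setT (EFin \o (fun z => D z ^+ 2)).
    by apply: eq_integrable (Lfun2_mul_integrable D2 D2) => // z _ /=; rewrite expr2.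
  have DPhi := Lfun2_mul_integrable D2 Phi2.
  have uPhi := Lfun2_mul_integrable (u2 n) Phi2.
  have iD : \int[mu2]_z (D z ^+ 2) <= (b ^+ n) ^+ 2.
    rewrite -lee_fin /Rintegral fineK; last exact: integrable_fin_num DD.
    exact: (L2lim_dist mu2_fin u2 u_cauchy).
  have -> : \int[mu2]_z (w z * Phi z) = \int[mu2]_z (D z * Phi z) + \int[mu2]_z (u n z * Phi z).
    by rewrite -RintegralD //; apply: eq_Rintegral => z _; rewrite -mulrDl subrK.
  have u0 : 0 <= \int[mu2]_z (u n z * Phi z) by have [] := tensE_diag_form (cs (nu n)) phi.
  apply: (@le_trans _ _ (\int[mu2]_z (D z * Phi z))); last by rewrite lerDl.
  apply: (@le_trans _ _ (\int[mu2]_z (- (2 * b ^+ n)^-1 * D z ^+ 2 + - (b ^+ n / 2) * Phi z ^+ 2))).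
    rewrite RintegralD //; last 2 first.
    - exact: (integrableZl measurableT (- (2 * b ^+ n)^-1) DD).
    - exact: (integrableZl measurableT (- (b ^+ n / 2)) PP).
    rewrite !RintegralZl // -/K.
    rewrite !mulNr -opprD lerN2 (_ : b ^+ n * ((1 + K) / 2) = b ^+ n / 2 + b ^+ n / 2 * K); last by ring.
    rewrite lerD2r mulrC ler_pdivrMr ?mulr_gt0 //.
    by apply: le_trans iD _; rewrite expr2; lra.
  apply: le_Rintegral => //.
    have := integrableD measurableT (integrableZl measurableT (- (2 * b ^+ n)^-1) DD)
      (integrableZl measurableT (- (b ^+ n / 2)) PP).
    exact.
  move=> z _; rewrite -subr_ge0.
  rewrite (_ : _ - _ = (2 * b ^+ n)^-1 * (D z + b ^+ n * Phi z) ^+ 2).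
    by rewrite mulr_ge0 ?sqr_ge0 // invr_ge0 mulr_ge0 // ltW.
  by field; rewrite gt_eqF.
have lim : - (b ^+ n * ((1 + K) / 2)) @[n --> \oo] --> - (0 * ((1 + K) / 2)).
  apply: cvgN; apply: cvgMl.
  by apply: cvg_expr; rewrite ger0_norm ?(ltW b0) // invf_lt1 // ltr1n.
rewrite mul0r oppr0 in lim.
by apply: (@ler_cvg_to _ _ _ _ _ _ _ _ lim (cvg_cst _)); apply: nearW; exact: lower.
Unshelve. all: by end_near. Qed.

End RepresentingFunction.

(** * Integration of vector-valued functions *)

Definition mk_linear (R : realType) (V W : lmodType R) (f : V -> W)
    (fl : forall c x y, f (c *: x + y) = c *: f x + f y) : {linear V -> W} :=
  HB.pack f (GRing.isLinear.Build R V W _ f fl).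

Section VectorIntegral.
Context {R : realType} (T : R).
Hypothesis T0 : 0 < T.
Local Notation bddJ := (bddJ T).
Implicit Types (h f : R -> R) (c M t : R).

Lemma bddJ_comb c M h M' h' : bddJ M h -> bddJ M' h' ->
  bddJ (`|c| * M + M') (fun t => c * h t + h' t).
Proof.
move=> [mh hM] [mh' hM']; split.
  by apply: measurable_funD => //; exact: measurable_funM.
move=> t tJ; apply: le_trans (ler_normD _ _) _.
by rewrite normrM lerD ?ler_wpM2l ?hM ?hM'.
Qed.

Lemma bddJ_mul M h M' h' : bddJ M h -> bddJ M' h' -> bddJ (M * M') (fun t => h t * h' t).
Proof.
move=> [mh hM] [mh' hM']; split; first exact: measurable_funM.
by move=> t tJ; rewrite normrM ler_pM ?normr_ge0 ?hM ?hM'.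
Qed.

Lemma bddJ_sum (I : Type) (r : seq I) (c : I -> R) (h : I -> R -> R) :
  (forall i, exists M, bddJ M (h i)) -> exists M, bddJ M (fun t => \sum_(i <- r) c i * h i t).
Proof.
move=> hM; elim: r => [|i r [M IH]].
  exists 0; split=> [|t _]; last by rewrite big_nil normr0.
  by under eq_fun do rewrite big_nil; exact: measurable_cst.
have [Mi hi] := hM i; exists (`|c i| * Mi + M).
by under eq_fun do rewrite big_cons; exact: bddJ_comb.
Qed.

(** The analogue of a finite signed measure on J, given by its action on bounded measurable
    functions. Since the bound only looks at J, so does D. *)
Definition bounded_functional (C : R) (D : (R -> R) -> R) : Prop :=
  [/\ 0 <= C,
      forall c M h M' h', bddJ M h -> bddJ M' h' ->
        D (fun t => c * h t + h' t) = c * D h + D h' &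
      forall M h, bddJ M h -> `|D h| <= C * M].

Section OneFunctional.
Variables (C : R) (D : (R -> R) -> R) (DC : bounded_functional C D).

Lemma bf_zero h : measurable_fun setT h -> (forall t, 0 < t < T -> h t = 0) -> D h = 0.
Proof.
move=> mh h0; apply/eqP; rewrite -normr_le0; have [_ _ /(_ 0 h)] := DC.
by rewrite mulr0; apply; split=> // t /h0 ->; rewrite normr0.
Qed.

Lemma bf_sum (I : Type) (r : seq I) (c : I -> R) (h : I -> R -> R) :
  (forall i, exists M, bddJ M (h i)) ->
  D (fun t => \sum_(i <- r) c i * h i t) = \sum_(i <- r) c i * D (h i).
Proof.
move=> hM; elim: r => [|i r IH].
  by rewrite big_nil; under eq_fun do rewrite big_nil; rewrite bf_zero.
rewrite big_cons -IH; have [Mi hi] := hM i; have [M hr] := bddJ_sum r c hM.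
under eq_fun do rewrite big_cons.
by have [_ Dl _] := DC; rewrite (Dl _ _ _ _ _ hi hr).
Qed.

(** Weighting each [A i] by the sign of [D (A i)] gives a function bounded by 1 on J, on which D is
    at most C. *)
Lemma bf_variation (I : finType) (A : I -> R -> R) :
  (forall i, exists M, bddJ M (A i)) ->
  (forall t, 0 < t < T -> \sum_i `|A i t| <= 1) -> \sum_i `|D (A i)| <= C.
Proof.
move=> AM A1.
have -> : \sum_i `|D (A i)| = \sum_i Num.sg (D (A i)) * D (A i).
  by apply: eq_bigr => i _; rewrite normrEsg.
rewrite -(bf_sum _ _ AM); apply: le_trans (ler_norm _) _.
have [_ _ DB] := DC; rewrite -[leRHS]mulr1; apply: DB; split.
  by have [M []] := bddJ_sum (index_enum I) (fun i => Num.sg (D (A i))) AM.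
move=> t tJ; apply: le_trans (ler_norm_sum _ _ _) _; apply: le_trans (A1 t tJ).
apply: ler_sum => i _; rewrite normrM ler_piMl //.
by rewrite normr_sg; case: (_ != _).
Qed.

Lemma bf_eqJ h h' M M' : bddJ M h -> bddJ M' h' -> (forall t, 0 < t < T -> h t = h' t) ->
  D h = D h'.
Proof.
move=> hM hM' E; have [_ Dl _] := DC.
have : D (fun t => -1 * h t + h' t) = 0.
  apply: bf_zero; first by have [] := bddJ_comb (-1) hM hM'.
  by move=> t tJ; rewrite E // mulN1r addNr.
by rewrite (Dl _ _ _ _ _ hM hM') mulN1r addrC => /subr0_eq.
Qed.

End OneFunctional.

Definition pt n j : R := j%:R * T / n.+1%:R.
(** The cells are half-open, so that each point of J lies in exactly one of the n + 1 cells. *)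
Definition ind n j t : R := if pt n j <= t < pt n j.+1 then 1 else 0.

Let n1 n : 0 < n.+1%:R :> R. Proof. by rewrite ltr0n. Qed.

Lemma ind_norm n j t : `|ind n j t| = ind n j t.
Proof. by rewrite /ind; case: ifP; rewrite ?normr1 ?normr0. Qed.

Lemma bddJ_ind n j : bddJ 1 (ind n j).
Proof.
split; last by move=> t _; rewrite ind_norm /ind; case: ifP.
apply: measurable_fun_ifT => //; apply: measurable_and.
  exact: measurable_fun_ler.
exact: measurable_fun_ltr.
Qed.

Lemma pt_step n j : pt n j.+1 = pt n j + T / n.+1%:R.
Proof. by rewrite /pt -natr1; field; rewrite nat1r gt_eqF. Qed.

Lemma pt_mem n (j : 'I_n.+1) : 0 <= pt n j <= T.
Proof.
rewrite /pt divr_ge0 ?mulr_ge0 ?(ltW T0) //= ler_pdivrMr // mulrC ler_wpM2l ?(ltW T0) //.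
by rewrite ler_nat ltnW.
Qed.

Lemma sum_ind n t : 0 < t < T -> \sum_(j < n.+1) ind n j t = 1.
Proof.
move=> /andP[t0 tT]; pose H j : R := if pt n j <= t then 1 else 0.
have E j : ind n j t = H j - H j.+1.
  rewrite /ind /H [pt n j.+1 <= t]leNgt; case: ltP => h /=.
    by rewrite andbT subr0.
  rewrite andbF (le_trans _ h) ?subrr // pt_step lerDl divr_ge0 //; exact: ltW.
under eq_bigr do rewrite E.
rewrite -(big_mkord xpredT (fun j => H j - H j.+1)).
rewrite (eq_bigr (fun j => - (H j.+1 - H j))); last by move=> j _; rewrite opprB.
rewrite sumrN telescope_sumr // opprB /H.
rewrite {1}/pt !mul0r (ltW t0) {1}/pt mulrAC mulfV ?gt_eqF // mul1r leNgt tT subr0.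
by [].
Qed.

Lemma ind_dist n j t : ind n j t != 0 -> `|t - pt n j| <= T / n.+1%:R.
Proof.
rewrite /ind; case: ifP => [/andP[h1 h2] _|_]; last by rewrite eqxx.
by rewrite ger0_norm ?subr_ge0 // lerBlDl -pt_step ltW.
Qed.

Variables (X : completeNormedModType R) (kappa : R -> X).
Hypothesis kappa_uc : forall e, 0 < e -> exists2 d, 0 < d &
  forall t t', 0 <= t <= T -> 0 <= t' <= T -> `|t - t'| <= d -> `|kappa t - kappa t'| <= e.

(* Riemann sums of the X-valued integral of kappa against the functional D; two of
   them are compared on the product of their partitions. *)
Lemma vector_integral (C : R) (D : (R -> R) -> R) : bounded_functional C D ->
  exists W : X, forall (phi : {linear X -> R}) Cphi M f,
    (forall x, `|phi x| <= Cphi * `|x|) -> bddJ M f ->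
    (forall t, 0 < t < T -> phi (kappa t) = f t) -> phi W = D f.
Proof.
move=> DC; have [C0 Dl DB] := DC.
pose W n := \sum_(j < n.+1) D (ind n j) *: kappa (pt n j).
have mesh d : 0 < d -> exists N, forall n, (N <= n)%N -> T / n.+1%:R <= d.
  move=> d0; have dT : 0 < d / T by rewrite divr_gt0.
  have [N _ hN] := near_infty_natSinv_lt (PosNum dT); exists N => n Nn.
  by have := hN n Nn => /= /ltW; rewrite ler_pdivlMr // mulrC.
have D_split n m (j : 'I_n.+1) : D (ind n j) = \sum_(i < m.+1) D (fun t => ind n j t * ind m i t).
  have bp i := bddJ_mul (bddJ_ind n j) (bddJ_ind m i).
  have bp' (i : 'I_m.+1) : exists M, bddJ M (fun t => ind n j t * ind m i t) by exists (1 * 1).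
  have := bf_sum DC (index_enum 'I_m.+1) (fun=> 1) bp'.
  under [RHS]eq_bigr do rewrite mul1r; move=> <-.
  have [M bM] := bddJ_sum (index_enum 'I_m.+1) (fun=> 1) bp'.
  apply: (bf_eqJ DC (bddJ_ind n j) bM) => t tJ.
  by under eq_bigr do rewrite mul1r; rewrite -mulr_sumr sum_ind // mulr1.
have W_diff n m e d : 0 < e -> (forall t t', 0 <= t <= T -> 0 <= t' <= T ->
     `|t - t'| <= d -> `|kappa t - kappa t'| <= e) ->
    T / n.+1%:R <= d / 2 -> T / m.+1%:R <= d / 2 -> `|W n - W m| <= C * e.
  move=> e0 kd nd md.
  pose A (p : 'I_n.+1 * 'I_m.+1) t := ind n p.1 t * ind m p.2 t.
  have AM p : exists M, bddJ M (A p).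
    by exists (1 * 1); exact: bddJ_mul (bddJ_ind _ _) (bddJ_ind _ _).
  have WE : W n - W m = \sum_p D (A p) *: (kappa (pt n p.1) - kappa (pt m p.2)).
    under eq_bigr do rewrite scalerBr; rewrite sumrB; congr (_ - _).
      rewrite -(pair_bigA _ (fun (j : 'I_n.+1) (i : 'I_m.+1) => D (A (j, i)) *: kappa (pt n j))) /=.
      by apply: eq_bigr => j _; rewrite -scaler_suml -D_split.
    rewrite -(pair_bigA _ (fun (j : 'I_n.+1) (i : 'I_m.+1) => D (A (j, i)) *: kappa (pt m i))) /=.
    rewrite exchange_big /=; apply: eq_bigr => i _; rewrite -scaler_suml (D_split m n).
    congr (_ *: _); apply: eq_bigr => j _; congr D.
    by apply/funext => t; rewrite /A /= mulrC.
  rewrite WE; apply: le_trans (ler_norm_sum _ _ _) _.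
  apply: (@le_trans _ _ (\sum_p `|D (A p)| * e)).
    apply: ler_sum => p _; rewrite normrZ.
    (* Two cells that do not meet contribute 0; otherwise a common point t shows that their left
       endpoints are at distance at most d. *)
    have [/eqP h|/eqP h] := boolP (A p == (fun=> 0)).
      rewrite h (bf_zero DC (h := fun=> 0)) // ?normr0 ?mul0r //; exact: measurable_cst.
    have [t At] : exists t, A p t != 0.
      apply: contrapT => /forallNP nA; apply: h; apply/funext => t.
      by apply/eqP; have /negP := nA t; rewrite negbK.
    move: At; rewrite /A mulf_eq0 negb_or => /andP[/ind_dist h1 /ind_dist h2].
    rewrite ler_wpM2l // kd ?pt_mem //.
    rewrite (_ : pt n p.1 - pt m p.2 = (t - pt m p.2) - (t - pt n p.1)); last by ring.
    apply: le_trans (ler_normB _ _) _; rewrite (splitr d).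
    by apply: lerD; [exact: le_trans h2 md|exact: le_trans h1 nd].
  rewrite -mulr_suml ler_wpM2r ?(ltW e0) //; apply: (bf_variation DC) => // t tJ.
  rewrite /A -(pair_bigA _ (fun (j : 'I_n.+1) (i : 'I_m.+1) => `|ind n j t * ind m i t|)) /=.
  under eq_bigr => j _ do under eq_bigr => i _ do rewrite normrM !ind_norm.
  by under eq_bigr => j _ do rewrite -mulr_sumr sum_ind // mulr1; rewrite sum_ind.
have W_cvg : cvgn W.
  apply/cauchy_cvgP/cauchy_exP => e e0.
  have C1 : 0 < C + 1 by rewrite ltr_wpDl.
  have e1 : 0 < e / (C + 1) by rewrite divr_gt0.
  have [d d0 kd] := kappa_uc e1.
  have [N hN] := mesh (d / 2) (divr_gt0 d0 (ltr0Sn R 1)).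
  exists (W N); exists N => // n /= Nn; rewrite -ball_normE /=.
  apply: le_lt_trans (W_diff N n _ _ e1 kd (hN N (leqnn N)) (hN n Nn)) _.
  by rewrite mulrCA gtr_pMr // ltr_pdivrMr // mul1r ltrDl.
exists (limn W) => phi Cphi M f phiC fM phif.
have Cphi0 : 0 <= `|Cphi| by [].
have {}phiC x : `|phi x| <= `|Cphi| * `|x|.
  by apply: le_trans (phiC x) _; rewrite ler_wpM2r // ler_norm.
have phiW : phi (W n) @[n --> \oo] --> phi (limn W).
  apply/cvgrPdist_le => e e0.
  have C1 : 0 < `|Cphi| + 1 by rewrite ltr_wpDl.
  have e1 : 0 < e / (`|Cphi| + 1) by rewrite divr_gt0.
  have /cvgrPdist_le/(_ _ e1) := W_cvg; apply: filterS => n hn.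
  rewrite -linearB; apply: le_trans (phiC _) _.
  apply: (@le_trans _ _ ((`|Cphi| + 1) * `|limn W - W n|)); first by rewrite ler_wpM2r // lerDl.
  by rewrite mulrC -ler_pdivlMr.
have phiD : phi (W n) @[n --> \oo] --> D f.
  apply/cvgrPdist_le => e e0.
  pose K := C * `|Cphi| + 1; have K0 : 0 < K by rewrite ltr_wpDl // mulr_ge0.
  have e1 : 0 < e / K by rewrite divr_gt0.
  have [d d0 kd] := kappa_uc e1.
  have [N hN] := mesh d d0; exists N => // n /= Nn.
  have bI (j : 'I_n.+1) : exists M, bddJ M (ind n j) by exists 1; exact: bddJ_ind.
  have phiE : phi (W n) = D (fun t => \sum_(j < n.+1) phi (kappa (pt n j)) * ind n j t).
    rewrite (bf_sum DC _ _ bI) /W linear_sum; apply: eq_bigr => j _.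
    by rewrite linearZ /= mulrC.
  have [M' bM'] := bddJ_sum (index_enum 'I_n.+1) (fun j => phi (kappa (pt n j))) bI.
  (* On J the step function with the values phi(kappa) at the nodes differs from f by at most |Cphi|
     e / K, and D is applied to that difference. *)
  rewrite phiE (_ : D f - _ = D (fun t => -1 * (\sum_(j < n.+1) phi (kappa (pt n j)) * ind n j t) + f t)); last first.
    by rewrite (Dl _ _ _ _ _ bM' fM) mulN1r addrC.
  apply: (@le_trans _ _ (C * (`|Cphi| * (e / K)))); last first.
    by rewrite mulrA mulrCA ger_pMr // ler_pdivrMr // mul1r /K lerDl.
  apply: DB; split; first by have [] := bddJ_comb (-1) bM' fM.
  move=> t tJ; rewrite mulN1r addrC -{1}(mulr1 (f t)) -(sum_ind n tJ) mulr_sumr -sumrB.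
  apply: le_trans (ler_norm_sum _ _ _) _.
  rewrite -[leRHS]mulr1 -(sum_ind n tJ) mulr_sumr; apply: ler_sum => j _.
  rewrite -mulrBl normrM ind_norm.
  have [->|i0] := eqVneq (ind n j t) 0; first by rewrite !mulr0.
  rewrite ler_wpM2r //; first by rewrite -ind_norm.
  rewrite -phif // -linearB; apply: le_trans (phiC _) _; rewrite ler_wpM2l // kd ?pt_mem //.
    by move: tJ => /andP[t0 tT]; rewrite !ltW.
  by apply: le_trans (hN n Nn); exact: ind_dist.
exact: cvg_unique phiW phiD.
Qed.

End VectorIntegral.

(** * Duality and the diagonal functional *)

Section Duality.
Context {R : realType} (T lam : R).
Hypotheses (T0 : 0 < T) (lam0 : 0 < lam).
Variables (Epi Feps : completeNormedModType R).
Variables (tE : {bilinear E T -> E T -> Epi}) (tF : {bilinear F T -> F T -> Feps}).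
Hypothesis tEpi : tensor_completion (pi_norm (@normE R T lam) (@normE R T lam)) tE.
Hypothesis tFeps : tensor_completion (eps_norm (@normF R T lam) (@normF R T lam)) tF.
Local Notation mu := (muJ T).
Local Notation bddJ := (bddJ T).
Local Notation S := (Sinv T0 lam0).
Implicit Types (x y w : E T) (s : seq (E T * E T)) (h : R -> R) (M c t : R).

Definition ip : {bilinear E T -> E T -> R} := weighted_form (bddJ_cst T lam).

Lemma ipE x y : ip x y = lam * \int[mu]_t (x t * y t).
Proof.
rewrite /ip weighted_formE mulrC -RintegralZr //; exact: E_mul_integrable.
Qed.

Lemma ip_psd : psd_form ip.
Proof. by apply: weighted_form_psd => t _; exact: ltW. Qed.

Lemma normE_ip x : normE lam x = Num.sqrt (ip x x).
Proof. by rewrite normE_sqrt ipE; congr (Num.sqrt (_ * _)); apply: eq_Rintegral => t _; rewrite expr2. Qed.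

Lemma normE_sqr x : normE lam x ^+ 2 = ip x x.
Proof. by rewrite normE_ip sqr_sqrtr // (form_ge0 ip_psd). Qed.

Lemma bddJ_ge0 M h : bddJ M h -> 0 <= M.
Proof.
move=> [_ hM]; have T2 : 0 < T / 2 < T by rewrite divr_gt0 // ltr_pdivrMr // ltr_pMr // ltr1n.
by apply: le_trans (hM _ T2).
Qed.

Lemma weighted_form_le M h x y : bddJ M h ->
  `|\int[mu]_t (x t * y t * h t)| <= M / lam * (normE lam x * normE lam y).
Proof.
move=> hM; have M0 := bddJ_ge0 hM.
have xyi := E_mul_integrable x y; have xyh := E_mulh_integrable x y hM.
have axy : mu.-integrable setT (EFin \o (fun t => `|x t| * `|y t|)).
  by apply: eq_integrable (integrable_norm xyi) => // t _ /=; rewrite normrM.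
apply: (@le_trans _ _ (M * \int[mu]_t (`|x t| * `|y t|))).
  apply: le_trans (le_normr_Rintegral measurableT xyh) _.
  rewrite -RintegralZl //; apply: le_RintegralJ.
  - exact: (integrable_norm xyh).
  - exact: (integrableZl measurableT M axy).
  - by move=> t tJ; rewrite !normrM mulrC ler_wpM2r ?mulr_ge0 // hM.2.
rewrite -mulrA ler_wpM2l // mulrC ler_pdivlMr // !normE_sqrt.
have i0 (w : E T) : 0 <= \int[mu]_t (w t ^+ 2) by apply: Rintegral_ge0 => r _; exact: sqr_ge0.
rewrite -sqrtrM ?mulr_ge0 ?(ltW lam0) //.
have l0 : 0 <= (\int[mu]_t (`|x t| * `|y t|)) * lam.
  by rewrite mulr_ge0 ?(ltW lam0) //; apply: Rintegral_ge0 => t _; rewrite mulr_ge0.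
rewrite -(ger0_norm l0) -sqrtr_sqr ler_wsqrtr // exprMn.
rewrite (_ : lam * _ * (lam * _) = (\int[mu]_t (x t ^+ 2) * \int[mu]_t (y t ^+ 2)) * lam ^+ 2); last by ring.
rewrite ler_wpM2r ?sqr_ge0 //.
have := cauchy_schwarz (Lfun2_abs (LfunP x)) (Lfun2_abs (LfunP y)).
under [X in _ <= X * _ -> _]eq_Rintegral do rewrite real_normK ?num_real //.
by under [X in _ <= _ * X -> _]eq_Rintegral do rewrite real_normK ?num_real //.
Qed.

Definition trace_sum s h := \sum_(p <- s) \int[mu]_t (p.1 t * p.2 t * h t).

Lemma trace_sumE M h (hM : bddJ M h) s : trace_sum s h = tsum (weighted_form hM) s.
Proof. by []. Qed.

Definition approx (U : Epi) : nat -> seq (E T * E T) :=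
  proj1_sig (cid (tensor_approx_seq tEpi U)).

Lemma approxP U : tsum tE (approx U n) @[n --> \oo] --> U.
Proof. by rewrite /approx; case: cid. Qed.

(* The extension to Epi of w |-> int_J w(t, t) h(t) dt, for h bounded on J; the limit
   then does not depend on the approximating tensors. *)
Definition diag_int h (U : Epi) : R := limn (fun n => trace_sum (approx U n) h).

Lemma diag_int_cvg M h (U : Epi) (s : nat -> seq (E T * E T)) : bddJ M h ->
  tsum tE (s n) @[n --> \oo] --> U -> trace_sum (s n) h @[n --> \oo] --> diag_int h U.
Proof.
move=> hM sU.
have c0 : 0 <= M / lam by rewrite divr_ge0 ?(bddJ_ge0 hM) // ltW.
have [r rP] := ext_exists (@normE_ge0 R T lam) tEpi c0
  (fun x y => weighted_form_le x y hM : `|weighted_form hM x y| <= _) U.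
have -> : diag_int h U = r by apply: cvg_lim => //; exact: rP _ (@approxP U).
exact: rP _ sU.
Qed.

Lemma diag_int_tsum M h s : bddJ M h -> diag_int h (tsum tE s) = trace_sum s h.
Proof.
move=> hM; have h1 : tsum tE s @[n --> \oo] --> tsum tE s by exact: cvg_cst.
have h2 := @diag_int_cvg M h _ (fun=> s) hM h1.
exact: cvg_unique h2 (cvg_cst _).
Qed.

Lemma diag_int_linear_h c M h M' h' U : bddJ M h -> bddJ M' h' ->
  diag_int (fun t => c * h t + h' t) U = c * diag_int h U + diag_int h' U.
Proof.
move=> hM hM'; have hc := bddJ_comb c hM hM'.
have l1 := diag_int_cvg hM (@approxP U); have l2 := diag_int_cvg hM' (@approxP U).
have l3 := diag_int_cvg hc (@approxP U).
have l4 : c * trace_sum (approx U n) h + trace_sum (approx U n) h' @[n --> \oo] -->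
    c * diag_int h U + diag_int h' U by apply: cvgD => //; exact: cvgMr.
have E s : trace_sum s (fun t => c * h t + h' t) = c * trace_sum s h + trace_sum s h'.
  rewrite /trace_sum mulr_sumr -big_split /=; apply: eq_bigr => p _.
  have i1 := E_mulh_integrable p.1 p.2 hM; have i2 := E_mulh_integrable p.1 p.2 hM'.
  rewrite -RintegralZl // -RintegralD //; last exact: (integrableZl measurableT c i1).
  by apply: eq_Rintegral => t _; ring.
have {}l4 : trace_sum (approx U n) (fun t => c * h t + h' t) @[n --> \oo] -->
    c * diag_int h U + diag_int h' U by under eq_fun do rewrite E.
exact: cvg_unique l3 l4.
Qed.

Lemma trace_sum_cat s s' h : trace_sum (s ++ s') h = trace_sum s h + trace_sum s' h.
Proof. by rewrite /trace_sum big_cat. Qed.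

Lemma diag_int_linear h M c (U U' : Epi) : bddJ M h ->
  diag_int h (c *: U + U') = c *: (diag_int h U : R) + diag_int h U'.
Proof.
move=> hM; pose sc s := [seq (c *: p.1, p.2) | p <- s].
have scE (Y : lmodType R) (b : {bilinear E T -> E T -> Y}) s : tsum b (sc s) = c *: tsum b s.
  by rewrite /tsum big_map scaler_sumr; apply: eq_bigr => p _; rewrite linearZl_LR.
have l1 := diag_int_cvg hM (@approxP U); have l2 := diag_int_cvg hM (@approxP U').
have UU : tsum tE (sc (approx U n) ++ approx U' n) @[n --> \oo] --> c *: U + U'.
  under eq_fun do rewrite tsum_cat scE.
  by apply: cvgD; [apply: cvgZl_tmp; exact: approxP|exact: approxP].
have l3 := @diag_int_cvg M h _ (fun n => sc (approx U n) ++ approx U' n) hM UU.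
have l4 : c * trace_sum (approx U n) h + trace_sum (approx U' n) h @[n --> \oo] -->
    c * diag_int h U + diag_int h U' by apply: cvgD => //; exact: cvgMr.
have {}l4 : trace_sum (sc (approx U n) ++ approx U' n) h @[n --> \oo] -->
    c * diag_int h U + diag_int h U'.
  by under eq_fun do rewrite trace_sum_cat (trace_sumE hM (sc _)) scE.
exact: cvg_unique l3 l4.
Qed.

Lemma diag_int_le h M U : bddJ M h -> `|diag_int h U| <= M / lam * `|U|.
Proof.
move=> hM; have l1 : `|trace_sum (approx U n) h| @[n --> \oo] --> `|diag_int h U|.
  by apply: cvg_norm; apply: diag_int_cvg hM _; exact: approxP.
have l2 : M / lam * `|tsum tE (approx U n)| @[n --> \oo] --> M / lam * `|U|.
  by apply: cvgMr; apply: cvg_norm; exact: approxP.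
apply: ler_cvg_to l1 l2 _; apply: nearW => n; rewrite (trace_sumE hM).
apply: (tsum_le (@normE_ge0 R T lam) tEpi) => [|x y]; last exact: weighted_form_le.
by rewrite divr_ge0 ?(bddJ_ge0 hM) // ltW.
Qed.

Lemma diag_int_bounded U : bounded_functional T (`|U| / lam) (diag_int^~ U).
Proof.
split=> [|c M h M' h' hM hM'|M h hM]; first by rewrite divr_ge0 // ltW.
  exact: diag_int_linear_h hM hM'.
by rewrite [leRHS](_ : _ = M / lam * `|U|) ?diag_int_le //; ring.
Qed.

Lemma diag_cvg (cs : nat -> seq (E T)) (U : Epi) M h :
  tsum tE (diag (cs n)) @[n --> \oo] --> U -> bddJ M h ->
  \sum_(c <- cs n) \int[mu]_t (c t * c t * h t) @[n --> \oo] --> diag_int h U.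
Proof.
move=> csU hM; have := diag_int_cvg hM csU.
by under eq_fun do rewrite /trace_sum big_map.
Qed.

(** On the approximating squares c (x) c the integrand is c^2 h. *)
Lemma diag_int_ge0 (cs : nat -> seq (E T)) (U : Epi) M h :
  tsum tE (diag (cs n)) @[n --> \oo] --> U -> bddJ M h ->
  (forall t, 0 < t < T -> 0 <= h t) -> 0 <= diag_int h U.
Proof.
move=> csU hM h0; apply: (cvgr_to_ge (diag_cvg csU hM)); apply: nearW => n.
by apply: sumr_ge0 => c _; exact: (weighted_form_psd hM h0).2.
Qed.

Lemma diag_cvg1 (cs : nat -> seq (E T)) (U : Epi) :
  tsum tE (diag (cs n)) @[n --> \oo] --> U ->
  \sum_(c <- cs n) ip c c @[n --> \oo] --> lam * diag_int (cst 1) U.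
Proof.
move=> csU.
have E n : lam * (\sum_(c <- cs n) \int[mu]_t (c t * c t * cst 1 t)) = \sum_(c <- cs n) ip c c.
  rewrite mulr_sumr; apply: eq_bigr => c _; rewrite ipE; congr (_ * _).
  by apply: eq_Rintegral => t _ /=; rewrite mulr1.
under eq_fun do rewrite -E.
by apply: cvgMr; exact: diag_cvg csU (bddJ_cst T 1).
Qed.

(** A sum of squares c (x) c is its own representation, and its cost is the sum of the squared
    norms, that is, the trace. *)
Lemma tensor_norm_le_diag (cs : nat -> seq (E T)) (U : Epi) :
  tsum tE (diag (cs n)) @[n --> \oo] --> U -> `|U| <= lam * diag_int (cst 1) U.
Proof.
move=> csU; have l1 : `|tsum tE (diag (cs n))| @[n --> \oo] --> `|U| by exact: cvg_norm.
apply: ler_cvg_to l1 (diag_cvg1 csU) _; apply: nearW => n.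
apply: le_trans (tensor_norm_le (@normE_ge0 R T lam) tEpi (s' := diag (cs n)) _) _ => //.
by rewrite big_map; apply: ler_sum => c _; rewrite -expr2 normE_sqr.
Qed.

Lemma diag_int_le_trace (cs : nat -> seq (E T)) (U : Epi) K :
  tsum tE (diag (cs n)) @[n --> \oo] --> U -> (forall n, \sum_(c <- cs n) ip c c <= K) ->
  lam * diag_int (cst 1) U <= K.
Proof. by move=> csU csK; apply: (cvgr_to_le (diag_cvg1 csU)); exact: nearW. Qed.

(** Cauchy-Schwarz with the kernel shows that S x vanishes at every point when x has seminorm 0.
    This supplies the hypothesis [L_null] for the form built from a functional. *)
Lemma Sinv_null x : ip x x = 0 -> S x = 0.
Proof.
rewrite ipE => /eqP; rewrite mulf_eq0 gt_eqF //= => /eqP x0.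
apply: val_inj; apply/funext => t /=; rewrite /Sinv_fun; case: ifP => // /andP[t0 tT].
suff -> : Kop T (- lam) x t = 0 by rewrite mulr0.
apply/eqP; rewrite -sqrf_eq0 eq_le sqr_ge0 andbT.
have k2 : kern (- lam) t \in Lfun mu 2%:E := bddJ_Lfun2 (bddJ_kern T (- lam) t0).
apply: le_trans (cauchy_schwarz k2 (LfunP x)) _.
under [X in _ * X <= _]eq_Rintegral do rewrite expr2.
by rewrite x0 mulr0.
Qed.

(** [normF] contains a weak derivative picked by choice, so homogeneity is not read off the
    definition; it is transported from [E] through the isometry. *)
Lemma normF_scale c (w : F T) : normF lam (c *: w) = `|c| * normF lam w.
Proof.
have [q ->] := Sinv_surj T0 lam0 w.
have -> : c *: S q = S (c *: q).
  by have := Sinv_linear T0 lam0 c q 0; rewrite !addr0 => ->; rewrite (_ : S 0 = 0) ?addr0 // Sinv_null // linear0l.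
rewrite !normF_Sinv !normE_ip formZl formZr mulrA -expr2 sqrtrM ?sqr_ge0 //.
by rewrite sqrtr_sqr.
Qed.

Lemma dual_norm_le (g : {linear F T -> R}) (v : F T) : in_dual (normF lam) g ->
  dual_norm (normF lam) g = 1 -> `|g v| <= normF lam v.
Proof.
move=> [C gC] g1; have N0 (u : F T) : 0 <= normF lam u by exact: sqrtr_ge0.
have [v0|v0] := eqVneq (normF lam v) 0; first by have := gC v; rewrite v0 mulr0.
have vp : 0 < normF lam v by rewrite lt0r v0 N0.
have vN : normF lam ((normF lam v)^-1 *: v) <= 1.
  by rewrite normF_scale ger0_norm ?invr_ge0 // mulVf.
have ub : ubound [set `|g u| | u in [set u | normF lam u <= 1]] `|C|.
  move=> _ [u /= u1 <-]; apply: le_trans (gC u) _.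
  apply: le_trans (ler_norm _) _; rewrite normrM (ger0_norm (N0 u)).
  by rewrite ler_piMr.
have : `|g ((normF lam v)^-1 *: v)| <= 1.
  by rewrite -g1; apply: ub_le_sup; [exists `|C| | exists ((normF lam v)^-1 *: v)].
by rewrite linearZ /= normrM ger0_norm ?invr_ge0 // mulrC ler_pdivrMr // mul1r.
Qed.

Lemma Sinv_sum n (a : 'I_n -> R) (f : nat -> E T) :
  S (\sum_(i < n) a i *: f i) = \sum_(i < n) a i *: S (f i).
Proof.
have S0 : S 0 = 0 by rewrite Sinv_null // linear0l.
elim: n a => [|n IH] a; first by rewrite !big_ord0.
by rewrite !big_ord_recr /= addrC Sinv_linear IH addrC.
Qed.

(** Testing g on v, the sum of g(S f_i) S f_i, gives r = g(v) <= sqrt r for the sum of squares r,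
    hence r <= 1. *)
Lemma dual_bessel (g : {linear F T -> R}) f n : in_dual (normF lam) g ->
  dual_norm (normF lam) g = 1 -> onz ip f -> \sum_(i < n) g (S (f i)) ^+ 2 <= 1.
Proof.
move=> gd g1 of_; set r := \sum_(i < n) _.
have r0 : 0 <= r by apply: sumr_ge0 => i _; exact: sqr_ge0.
pose v := S (\sum_(i < n) g (S (f i)) *: f i).
have gv : g v = r.
  rewrite /v Sinv_sum linear_sum; apply: eq_bigr => i _.
  by rewrite linearZ /= expr2.
have vN : normF lam v <= Num.sqrt r.
  by rewrite normF_Sinv normE_ip ler_wsqrtr //; exact: (onz_sqr (fun i : 'I_n => g (S (f i))) of_).
have := le_trans (dual_norm_le v gd g1) vN.
rewrite gv ger0_norm // => rs.
have : r ^+ 2 <= r.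
  by rewrite -[leRHS]sqr_sqrtr // lerXn2r // nnegrE // sqrtr_ge0.
rewrite expr2; case: (ltrP 0 r) => [rp|r1 _]; first by rewrite ger_pMr.
exact: le_trans r1 ler01.
Qed.

Lemma eps_diag_le1 f n : onz ip f ->
  `|tsum tF [seq (S (f i), S (f i)) | i <- iota 0 n]| <= 1.
Proof.
move=> of_; rewrite tFeps.1 /eps_norm; set A := (X in sup X).
(* If no pair of functionals of dual norm 1 exists, the supremum is over the empty set, where [sup]
   is 0. *)
have [->|/set0P A0] := eqVneq A set0; first by rewrite sup0.
apply: ge_sup => // _ [g1 [g2 [[d1 n1] [d2 n2] ->]]].
rewrite big_map -[X in iota 0 X](subn0 n) -/(index_iota 0 n) big_mkord.
have b1 := dual_bessel n d1 n1 of_; have b2 := dual_bessel n d2 n2 of_.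
apply: le_trans (ler_norm_sum _ _ _) _.
apply: (@le_trans _ _ (\sum_(i < n) (g1 (S (f i)) ^+ 2 + g2 (S (f i)) ^+ 2) / 2)).
  apply: ler_sum => i _ /=; rewrite normrM.
  have := sqr_ge0 (`|g1 (S (f i))| - `|g2 (S (f i))|).
  rewrite -[g1 _ ^+ 2]real_normK ?num_real // -[g2 _ ^+ 2]real_normK ?num_real //.
  by nra.
by rewrite -mulr_suml big_split /=; lra.
Qed.

End Duality.

(** * Continuous functionals and density of algebraic tensors *)

Section BoundedFunctionals.
Context {R : realType}.

Definition bilinear_left (V W X : lmodType R) (b : {bilinear V -> W -> X}) y : {linear V -> X} :=
  mk_linear (f := b^~ y) (fun c x x' => linearPl b y c x x').

Definition bilinear_right (V W X : lmodType R) (b : {bilinear V -> W -> X}) x : {linear W -> X} :=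
  mk_linear (f := b x) (fun c y y' => linearPr b x c y y').

Context {X Y : completeNormedModType R}.

Lemma continuous_left (b : {bilinear X -> Y -> R}) y :
  continuous (fun p : X * Y => b p.1 p.2) -> continuous (bilinear_left b y).
Proof.
move=> cb x; have h : (z, y) @[z --> x] --> (x, y).
  by apply: cvg_pair; [exact: cvg_id|exact: cvg_cst].
exact: (cvg_comp _ _ h (cb (x, y))).
Qed.

Lemma continuous_right (b : {bilinear X -> Y -> R}) x :
  continuous (fun p : X * Y => b p.1 p.2) -> continuous (bilinear_right b x).
Proof.
move=> cb y; have h : (x, z) @[z --> y] --> (x, y).
  by apply: cvg_pair; [exact: cvg_cst|exact: cvg_id].
exact: (cvg_comp _ _ h (cb (x, y))).
Qed.

Lemma continuous_linear_le (f : {linear X -> R}) : continuous f ->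
  exists2 C, 0 <= C & forall x, `|f x| <= C * `|x|.
Proof.
move=> cf; have /linear_boundedP/pinfty_ex_gt0[r r0 fr] : bounded_near f (nbhs 0).
  by apply/linear_bounded_continuous.
by exists r => //; exact: ltW.
Qed.

Lemma le_dual_norm (f : {linear X -> R}) x : continuous f -> `|x| <= 1 ->
  f x <= dual_norm (fun v : X => `|v|) f.
Proof.
move=> /continuous_linear_le[C C0 fC] x1; apply: le_trans (ler_norm _) _.
apply: ub_le_sup; last by exists x.
exists C => _ [u /= u1 <-]; apply: le_trans (fC u) _.
by rewrite ler_piMr.
Qed.

Lemma dense_linear_eq (V W : lmodType R) (t : {bilinear V -> W -> X}) (f g : {linear X -> R}) :
  dense (range (tsum t)) -> continuous f -> continuous g ->
  (forall v w, f (t v w) = g (t v w)) -> forall x, f x = g x.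
Proof.
move=> dt cf cg fg x; apply/eqP; rewrite -subr_eq0; apply/negPn/negP => fgx.
have op : open ((fun u => f u - g u) @^-1` (~` [set 0])).
  apply: open_comp => [u _|]; first by apply: continuousB; [exact: cf|exact: cg].
  exact/closed_openC/accessible_closed_set1/hausdorff_accessible/norm_hausdorff.
have ne : (fun u => f u - g u) @^-1` (~` [set 0]) !=set0 by exists x; exact/eqP.
have [z [/= nz [s _ sE]]] := dt _ ne op; apply: nz.
by rewrite -sE /tsum (linear_sum f) (linear_sum g) -sumrB big1 // => p _; rewrite fg subrr.
Qed.

End BoundedFunctionals.

(** * Solving B(U, .) = l for positive semidefinite l *)

Section Existence.
Context {R : realType} (T lam : R).
Hypotheses (T0 : 0 < T) (lam0 : 0 < lam).
Variables (Epi Feps : completeNormedModType R).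
Variables (tE : {bilinear E T -> E T -> Epi}) (tF : {bilinear F T -> F T -> Feps}).
Hypothesis tEpi : tensor_completion (pi_norm (@normE R T lam) (@normE R T lam)) tE.
Hypothesis tFeps : tensor_completion (eps_norm (@normF R T lam) (@normF R T lam)) tF.
Variables (B Delta : {bilinear Epi -> Feps -> R}).
Hypotheses (BP : B_spec tE tF lam B) (DeltaP : trace_spec tE tF Delta).
Local Notation mu := (muJ T).
Local Notation bddJ := (bddJ T).
Local Notation S := (Sinv T0 lam0).
Local Notation ip := (ip T lam).
Implicit Types (x y w : E T) (h : R -> R) (M c t : R) (U : Epi) (v : Feps).

Lemma tE_le x y : `|tE x y| <= normE lam x * normE lam y.
Proof.
by have := tensor_norm_le (@normE_ge0 R T lam) tEpi (s := [:: (x, y)]) (s' := [:: (x, y)]);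
  rewrite /tsum !big_seq1; apply.
Qed.

Lemma B_tensor w1 w2 x y : B (tE w1 w2) (tF (S x) (S y)) = ip w1 x * ip w2 y.
Proof. by rewrite BP.2 !bform_Sinv !ipE. Qed.

Lemma functional_eq (f g : {linear Feps -> R}) : continuous f -> continuous g ->
  (forall x y, f (tF (S x) (S y)) = g (tF (S x) (S y))) -> forall v, f v = g v.
Proof.
move=> cf cg fg; apply: (dense_linear_eq tFeps.2) => // v w.
by have [x ->] := Sinv_surj T0 lam0 v; have [y ->] := Sinv_surj T0 lam0 w.
Qed.

Lemma B_separates U : (forall x y, B U (tF (S x) (S y)) = 0) -> U = 0.
Proof.
move=> BU0; apply: (tensor_separation (@normE_ge0 R T lam) tEpi (ip_psd T lam0)
  (@normE_ip _ _ _) (b := fun x y => bilinear_left B (tF (S x) (S y)))) => //.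
- by move=> x y; exact: continuous_left BP.1.
- by move=> x y w1 w2; exact: B_tensor.
Qed.

(** The trace is a single value of l, taken at the tensor of [eps_diag_le1]. *)
Lemma functional_trace (l : {linear Feps -> R}) (f : nat -> E T) n : continuous l -> onz ip f ->
  \sum_(i < n) l (tF (S (f i)) (S (f i))) <= dual_norm (fun v : Feps => `|v|) l.
Proof.
move=> cl of_; have := le_dual_norm cl (eps_diag_le1 T0 lam0 tFeps n of_).
by rewrite /tsum big_map linear_sum -[X in iota 0 X](subn0 n) -/(index_iota 0 n) big_mkord.
Qed.

(** Used twice: for l itself, where the trace bound matters, and for l + rho^2 Delta(U, .), where
    the approximating squares matter. *)
Lemma spsd_solution (l : {linear Feps -> R}) : continuous l -> spsd_functional tF l ->
  exists U (cs : nat -> seq (E T)), [/\ tsum tE (diag (cs n)) @[n --> \oo] --> U,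
    forall v, B U v = l v &
    forall n, \sum_(c <- cs n) ip c c <= dual_norm (fun v : Feps => `|v|) l].
Proof.
move=> cl [lC l0].
have Ll c x x' y : l (tF (S (c *: x + x')) (S y)) = c *: l (tF (S x) (S y)) + l (tF (S x') (S y)).
  by rewrite Sinv_linear linearPl linearP.
have Lr c x y y' : l (tF (S x) (S (c *: y + y'))) = c *: l (tF (S x) (S y)) + l (tF (S x) (S y')).
  by rewrite Sinv_linear linearPr linearP.
pose L := mk_bilinear (f := fun x y => l (tF (S x) (S y))) Ll Lr.
have pL : psd_form L by split=> [x y|x]; [exact: lC|exact: l0].
have L_null x : ip x x = 0 -> L x x = 0.
  by move=> /(Sinv_null T0 lam0) x0; rewrite /L /= x0 linear0l linear0.
have L_trace f n : onz ip f -> \sum_(i < n) L (f i) (f i) <= dual_norm (fun v : Feps => `|v|) l.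
  by move=> of_; exact: functional_trace.
have t_le x y : `|tE x y| <= Num.sqrt (ip x x) * Num.sqrt (ip y y).
  by rewrite -!normE_ip tE_le.
have [c [U [cU cM cL]]] := psd_tensor (ip_psd T lam0) pL L_null L_trace t_le.
exists U, (fun n => mkseq (c n) n).
have sumE (Y : nmodType) (f : E T -> Y) n :
    \sum_(x <- mkseq (c n) n) f x = \sum_(k < n) f (c n k).
  by rewrite big_map -[X in iota 0 X](subn0 n) -/(index_iota 0 n) big_mkord.
have csU : tsum tE (diag (mkseq (c n) n)) @[n --> \oo] --> U.
  have tsE n : tsum tE (diag (mkseq (c n) n)) = \sum_(k < n) tE (c n k) (c n k).
    by rewrite /tsum big_map sumE.
  by under eq_fun do rewrite tsE.
split=> // [v|n]; last by rewrite sumE.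
have cB := continuous_right (x := U) BP.1.
apply: (functional_eq (f := bilinear_right B U) cB cl) => x y.
have cBl : continuous (bilinear_left B (tF (S x) (S y))) := continuous_left BP.1.
have h1 := cvg_comp _ _ csU (cBl U).
have h2 := cL x y.
have hE n : B (tsum tE (diag (mkseq (c n) n))) (tF (S x) (S y)) =
    \sum_(k < n) ip (c n k) x * ip (c n k) y.
  rewrite (_ : B _ _ = bilinear_left B (tF (S x) (S y)) (tsum tE (diag (mkseq (c n) n)))) //.
  by rewrite /tsum linear_sum big_map sumE; apply: eq_bigr => k _; exact: B_tensor.
have h3 : B (tsum tE (diag (mkseq (c n) n))) (tF (S x) (S y)) @[n --> \oo] --> L x y.
  by under eq_fun do rewrite hE.
exact: cvg_unique h1 h3.
Qed.

End Existence.

(** * The diagonal and its reproducing kernel *)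

Section Reproducing.
Context {R : realType} (T lam : R).
Hypotheses (T0 : 0 < T) (lam0 : 0 < lam).
Variables (Epi Feps : completeNormedModType R).
Variables (tE : {bilinear E T -> E T -> Epi}) (tF : {bilinear F T -> F T -> Feps}).
Hypothesis tEpi : tensor_completion (pi_norm (@normE R T lam) (@normE R T lam)) tE.
Variables (B Delta : {bilinear Epi -> Feps -> R}).
Hypotheses (BP : B_spec tE tF lam B) (DeltaP : trace_spec tE tF Delta).
Local Notation mu := (muJ T).
Local Notation bddJ := (bddJ T).
Local Notation S := (Sinv T0 lam0).
Local Notation ip := (ip T lam).
Local Notation diag_int := (diag_int tEpi).
Implicit Types (x y w : E T) (h : R -> R) (M c t : R) (U : Epi) (v : Feps).

Lemma bddJ_Sinv_mul x y : exists M, bddJ M (fun t => S x t * S y t).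
Proof.
have [M hM] := Sinv_fun_bdd T0 lam0 x; have [M' hM'] := Sinv_fun_bdd T0 lam0 y.
by exists (M * M'); exact: bddJ_mul hM hM'.
Qed.

Lemma Rintegral_tensE M h (s : seq (E T * E T)) : bddJ M h ->
  mu.-integrable setT (EFin \o (fun t => tensE_fun s (t, t) * h t)) /\
  \int[mu]_t (tensE_fun s (t, t) * h t) = trace_sum s h.
Proof.
move=> hM; elim: s => [|p s [IH1 IH2]].
  have E t : tensE_fun [::] (t, t) * h t = 0 by rewrite /tensE_fun big_nil mul0r.
  split; first by apply: eq_integrable (integrable0 mu setT) => // t _ /=; rewrite E.
  by under eq_Rintegral do rewrite E; rewrite Rintegral_cst // mul0r /trace_sum big_nil.
have E t : tensE_fun (p :: s) (t, t) * h t = p.1 t * p.2 t * h t + tensE_fun s (t, t) * h t.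
  by rewrite /tensE_fun big_cons mulrDl.
have pi := E_mulh_integrable p.1 p.2 hM; split.
  by apply: eq_integrable (integrableD measurableT pi IH1) => // t _ /=; rewrite E.
under eq_Rintegral do rewrite E.
by rewrite RintegralD // IH2 /trace_sum big_cons.
Qed.

Lemma Delta_tensor U x y : Delta U (tF (S x) (S y)) = diag_int (fun t => S x t * S y t) U.
Proof.
have [M hM] := bddJ_Sinv_mul x y.
have cD : continuous (bilinear_left Delta (tF (S x) (S y))) := continuous_left DeltaP.1.
have h1 := cvg_comp _ _ (@approxP _ _ _ _ _ tEpi U) (cD U).
have h2 := diag_int_cvg T0 lam0 (tEpi := tEpi) hM (@approxP _ _ _ _ _ tEpi U).
have E s : Delta (tsum tE s) (tF (S x) (S y)) = trace_sum s (fun t => S x t * S y t).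
  have -> : tF (S x) (S y) = tsum tF [:: (S x, S y)] by rewrite /tsum big_seq1.
  rewrite DeltaP.2; under eq_Rintegral do rewrite /tensF_fun big_seq1.
  by rewrite -(Rintegral_tensE s hM).2.
have {}h1 : trace_sum (approx tEpi U n) (fun t => S x t * S y t) @[n --> \oo] -->
    Delta U (tF (S x) (S y)) by under eq_fun do rewrite -E; exact: h1.
exact: cvg_unique h1 h2.
Qed.

(** The absolute value makes k_t total in t; on [0, T] it changes nothing. *)
Definition kernE t : E T :=
  Lfun_Sub (lee1n 2) (bddJ_Lfun2 (bddJ_kern T (- lam) (normr_ge0 t))).

Lemma ip_kernE x t : 0 < t < T -> ip (kernE t) x = S x t.
Proof.
move=> tJ; rewrite ipE SinvE (Sinv_fun_inJ lam x tJ).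
by rewrite [LHS](_ : _ = lam * Kop T (- lam) x `|t|) // gtr0_norm //; case/andP: tJ.
Qed.

Lemma normE_kernE t : 0 <= t -> normE lam (kernE t) <= Num.sqrt (lam * T).
Proof.
move=> t0; rewrite normE_sqrt ler_wsqrtr // ler_wpM2l ?(ltW lam0) //.
have hM := bddJ_kern T (- lam) (normr_ge0 t).
apply: le_trans (ler_norm _) _; rewrite -[leRHS]mul1r; apply: Rintegral_le_cst => //.
  by apply: eq_integrable (bddJ_integrable (bddJ_mul hM hM)) => // s _ /=; rewrite expr2.
move=> s _; rewrite [kernE t s](_ : _ = kern (- lam) `|t| s) // ger0_norm ?sqr_ge0 //.
by rewrite expr_le1 ?kern_ge0 // kern_le1 // oppr_le0 ltW.
Qed.

Lemma normE_kernEB t t' : 0 <= t <= T -> 0 <= t' <= T ->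
  normE lam (kernE t - kernE t') <= Num.sqrt (lam * ((1 + lam * T) * `|t - t'|)).
Proof.
move=> /andP[t0 tT] /andP[t'0 t'T]; rewrite normE_sqrt ler_wsqrtr // ler_wpM2l ?(ltW lam0) //.
have l0 : - lam <= 0 by rewrite oppr_le0 ltW.
rewrite [leLHS](_ : _ = \int[mu]_s (kern (- lam) t s - kern (- lam) t' s) ^+ 2); last first.
  by apply: eq_Rintegral => s _; rewrite [in RHS](_ : kern _ t s - kern _ t' s = (kernE t - kernE t') s) //
    [RHS](_ : _ = kern (- lam) `|t| s - kern (- lam) `|t'| s) // !ger0_norm.
have [tt'|/ltW tt'] := lerP t t'.
  have := kern_modulus2 T0 l0 t0 tt' t'T.
  by rewrite mulNr opprK.
under eq_Rintegral do rewrite -sqrrN opprB.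
have := kern_modulus2 T0 l0 t'0 tt' tT.
by rewrite mulNr opprK.
Qed.

Definition kernT t : Epi := tE (kernE t) (kernE t).

Lemma kernT_uniformly_continuous e : 0 < e -> exists2 d, 0 < d & forall t t',
  0 <= t <= T -> 0 <= t' <= T -> `|t - t'| <= d -> `|kernT t - kernT t'| <= e.
Proof.
move=> e0; have K0 : 0 < lam * T * (lam * (1 + lam * T)) by rewrite !mulr_gt0 // addr_gt0 // mulr_gt0.
(* This d solves sqrt(lam T) sqrt(lam (1 + lam T) d) = e / 2; each factor of the tensor accounts for
   one half of e. *)
exists ((e / 2) ^+ 2 / (lam * T * (lam * (1 + lam * T)))) => [|t t' tJ t'J tt'].
  by rewrite divr_gt0 // exprn_gt0 // divr_gt0.
have -> : kernT t - kernT t' = tE (kernE t) (kernE t - kernE t') + tE (kernE t - kernE t') (kernE t').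
  by rewrite linearBr linearBl addrA subrK.
apply: le_trans (ler_normD _ _) _.
have D0 := normE_ge0 lam (kernE t - kernE t').
have dl := normE_kernEB tJ t'J.
have H : Num.sqrt (lam * T) * normE lam (kernE t - kernE t') <= e / 2.
  apply: le_trans (ler_wpM2l (sqrtr_ge0 _) dl) _.
  rewrite -sqrtrM ?mulr_ge0 ?(ltW lam0) ?(ltW T0) //.
  have e2 : 0 <= e / 2 by rewrite divr_ge0 // ltW.
  rewrite -[leRHS](ger0_norm e2) -[leRHS]sqrtr_sqr ler_wsqrtr //.
  by move: tt'; rewrite ler_pdivlMr // mulrC; congr (_ <= _); ring.
rewrite [leRHS](splitr e) lerD //.
  apply: le_trans (tE_le tEpi _ _) _; apply: le_trans H; rewrite ler_wpM2r //.
  by apply: normE_kernE; case/andP: tJ.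
apply: le_trans (tE_le tEpi _ _) _; apply: le_trans H; rewrite mulrC ler_wpM2r //.
by apply: normE_kernE; case/andP: t'J.
Qed.

(* kernT t represents the evaluation v |-> v(t, t) under B, and its own diagonal is
   kern (-2 lam) t; W is the integral of kernT against D. *)
Lemma kernel_integral C D : bounded_functional T C D -> exists W : Epi,
  (forall x y, B W (tF (S x) (S y)) = D (fun t => S x t * S y t)) /\
  (forall M h, bddJ M h -> diag_int h W = D (Kop T (- (2 * lam)) h)).
Proof.
move=> DC; have [W WP] := vector_integral T0 kernT_uniformly_continuous DC; exists W; split.
  move=> x y; have [M hM] := bddJ_Sinv_mul x y.
  have cB : continuous (bilinear_left B (tF (S x) (S y))) := continuous_left BP.1.
  have [K _ hK] := continuous_linear_le cB.
  apply: (WP (bilinear_left B (tF (S x) (S y))) K M) => // t tJ.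
  by rewrite [LHS](_ : _ = B (tE (kernE t) (kernE t)) (tF (S x) (S y))) // (B_tensor T0 lam0 BP) !ip_kernE.
move=> M h hM; have hi := bddJ_integrable hM.
apply: (WP (mk_linear (fun c U U' => diag_int_linear T0 lam0 tEpi c U U' hM)) (M / lam)
  _ _ _ (Kop_bdd _ hi)) => [U|t tJ]; first exact: diag_int_le.
rewrite [LHS](_ : _ = diag_int h (kernT t)) //.
have -> : kernT t = tsum tE [:: (kernE t, kernE t)] by rewrite /tsum big_seq1.
rewrite (diag_int_tsum T0 lam0 tEpi _ hM) /trace_sum big_seq1.
have -> : - (2 * lam) = - lam + - lam by ring.
apply: eq_Rintegral => s _; rewrite -kern_mul.
by rewrite [LHS](_ : _ = kern (- lam) `|t| s * kern (- lam) `|t| s * h s) // gtr0_norm //; case/andP: tJ.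
Qed.

End Reproducing.

(** * The Volterra equation *)

Section ResolventOperator.
Context {R : realType} (T lam rho : R).
Hypotheses (T0 : 0 < T) (lam0 : 0 < lam).
Local Notation mu := (muJ T).
Local Notation bddJ := (bddJ T).
Local Notation Kop := (Kop T).
Implicit Types (h : R -> R) (M a t s : R).

Lemma kern_integral_right a t : 0 <= t <= T ->
  a * \int[mu]_s (kern a t s * 1) = expR (a * (T - t)) - 1.
Proof.
move=> /andP[t0 tT]; pose F s := expR (a * s + - (a * t)).
have cF : continuous F by exact: continuous_affine_expR.
have caF : continuous (fun s => a * F s) by move=> x; exact: cvgMr (cF x).
have := muJ_FTC2 (f := fun s => a * F s) (F := F) t0 tT (lexx T) caF
  (is_derive_expR_affine _ _).
rewrite [in X in _ = X -> _]/F subrr expR0 -mulrBr => <-.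
have ki := kern_integrable a t0 (@integrable_cst1 R T).
rewrite -RintegralZl //; apply: eq_RintegralJ.
- by apply: measurable_funM => //; apply: measurable_funM => //; exact: measurable_kern.
- apply: measurable_fun_ifT => //; last exact: continuous_measurable_fun.
  by apply: measurable_and; exact: measurable_fun_ltr.
- move=> s /andP[_ sT]; rewrite /kern sT andbT mulr1; case: ifP; rewrite ?mulr0 // => _.
  by rewrite /F mulrBr.
Qed.

Lemma Kop_ge0 a h t : measurable_fun setT h -> (forall s, 0 < s < T -> 0 <= h s) ->
  0 <= Kop a h t.
Proof.
move=> mh h0; rewrite /Kop.
(* Outside J the sign of h is unknown; its positive part agrees with h on J and is nonnegative
   everywhere. *)
rewrite (@eq_RintegralJ _ _ _ (fun s => kern a t s * Num.max (h s) 0)).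
- by apply: Rintegral_ge0 => s _; rewrite mulr_ge0 ?kern_ge0 // le_max lexx orbT.
- by apply: measurable_funM => //; exact: measurable_kern.
- by apply: measurable_funM; [exact: measurable_kern|exact: measurable_maxr].
- by move=> s /h0 hs; rewrite (max_idPl hs).
Qed.

(* By the resolvent identity, Rop inverts 1 - rho^2 Kop (-2 lam) on J. *)
Definition Rop h t : R := h t + rho ^+ 2 * Kop (rho ^+ 2 - 2 * lam) h t.

Lemma Kop_bddJ a M h : bddJ M h -> bddJ (expR (`|a| * T) * (M * T)) (Kop a h).
Proof.
move=> hM; have hi := bddJ_integrable hM; have [mK Kb] := Kop_bdd a hi; split=> // t tJ.
apply: le_trans (Kb _ tJ) _; rewrite ler_wpM2l ?expR_ge0 //.
apply: le_trans (ler_norm _) _; apply: Rintegral_le_cst => //.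
  exact: (integrable_norm hi).
by move=> s /hM.2; rewrite normr_id.
Qed.

Lemma Rop_bddJ : exists C, 0 <= C /\ forall M h, bddJ M h -> bddJ (C * M) (Rop h).
Proof.
pose k := expR (`|rho ^+ 2 - 2 * lam| * T).
exists (rho ^+ 2 * (k * T) + 1); split=> [|M h hM].
  by rewrite addr_ge0 // mulr_ge0 ?sqr_ge0 // mulr_ge0 ?expR_ge0 // ltW.
have := bddJ_comb (rho ^+ 2) (Kop_bddJ (rho ^+ 2 - 2 * lam) hM) hM.
rewrite ger0_norm ?sqr_ge0 //.
rewrite -/k (_ : _ + M = (rho ^+ 2 * (k * T) + 1) * M); last by ring.
by rewrite (_ : (fun t => _) = Rop h) //; apply/funext => t; rewrite /Rop addrC.
Qed.

(** The exponents m and - 2 lam differ by rho^2, so the resolvent identity reads rho^2 K_m K = K_m -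
    K. It serves the existence proof. *)
Lemma Rop_Kop M h t : 0 < t < T -> bddJ M h ->
  Rop (Kop (- (2 * lam)) h) t = Kop (rho ^+ 2 - 2 * lam) h t.
Proof.
move=> /andP[t0 _] hM; have := resolvent (rho ^+ 2 - 2 * lam) (- (2 * lam)) (ltW t0) (bddJ_integrable hM).
by rewrite opprK subrK /Rop => ->; rewrite addrC subrK.
Qed.

Lemma Kop_comb a c M h M' h' t : 0 <= t -> bddJ M h -> bddJ M' h' ->
  Kop a (fun s => c * h s + h' s) t = c * Kop a h t + Kop a h' t.
Proof.
move=> t0 hM hM'; have hi := kern_integrable a t0 (bddJ_integrable hM).
have h'i := kern_integrable a t0 (bddJ_integrable hM').
rewrite /Kop -RintegralZl // -RintegralD //; last exact: (integrableZl measurableT c hi).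
by apply: eq_Rintegral => s _; ring.
Qed.

(** The same identity with the factors in the other order, rho^2 K K_m = K_m - K; it serves the
    uniqueness proof. *)
Lemma Kop_Rop M h t : 0 < t < T -> bddJ M h ->
  Rop h t - rho ^+ 2 * Kop (- (2 * lam)) (Rop h) t = h t.
Proof.
move=> /andP[t0 _] hM; set m := rho ^+ 2 - 2 * lam.
have hK := Kop_bddJ m hM.
have -> : Rop h = (fun s => rho ^+ 2 * Kop m h s + h s).
  by apply/funext => s; rewrite /Rop addrC.
rewrite (Kop_comb _ _ (ltW t0) hK hM).
have := resolvent (- (2 * lam)) m (ltW t0) (bddJ_integrable hM).
by rewrite /m; nra.
Qed.

Lemma Rop_ge0 M h t : bddJ M h -> (forall s, 0 < s < T -> 0 <= h s) -> 0 < t < T -> 0 <= Rop h t.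
Proof.
by move=> [mh _] h0 tJ; rewrite /Rop addr_ge0 ?h0 // mulr_ge0 ?sqr_ge0 // Kop_ge0.
Qed.

(** R 1 decreases in t, and the constant is its value at t = 0, namely 1 + rho^2 (exp(m T) - 1) / m,
    with T in place of the quotient when m = 0. *)
Lemma Rop1_le t : 0 < t < T -> Rop (cst 1) t <= stab_const T rho lam.
Proof.
move=> /andP[t0 tT]; rewrite /Rop /stab_const; set m := rho ^+ 2 - 2 * lam.
have tT' : 0 <= t <= T by rewrite !ltW.
have K0 : 0 <= Kop m (cst 1) t by apply: Kop_ge0.
case: eqP => [m0|/eqP mn].
  rewrite addrC lerD2r ler_wpM2l ?sqr_ge0 // /Kop.
  have ki := kern_integrable m (ltW t0) (@integrable_cst1 R T).
  apply: le_trans (ler_norm _) _; rewrite -[leRHS]mul1r; apply: Rintegral_le_cst => // s _.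
  by rewrite mulr1 ger0_norm ?kern_ge0 // kern_le1 // /m m0 subrr.
have {}mn : m != 0 by rewrite subr_eq0.
have KE : m * Kop m (cst 1) t = expR (m * (T - t)) - 1 by exact: kern_integral_right.
have -> : Kop m (cst 1) t = (expR (m * (T - t)) - 1) / m by rewrite -KE mulrAC mulfV // mul1r.
have -> : (rho ^+ 2 * expR (m * T) - 2 * lam) / m = 1 + rho ^+ 2 * ((expR (m * T) - 1) / m).
  by rewrite /m in mn *; field.
rewrite lerD2l ler_wpM2l ?sqr_ge0 //.
have [mp|mneg|m0] := ltrgtP m 0; last by rewrite m0 eqxx in mn.
  rewrite ler_ndivrMr // divfK // lerD2r ler_expR.
  by rewrite ler_nM2l // gerBl ltW.
rewrite ler_pdivrMr // divfK // lerD2r ler_expR.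
by rewrite ler_pM2l // gerBl ltW.
Qed.

End ResolventOperator.

(** * Uniqueness, existence and the bound *)

Section WellPosedness.
Context {R : realType} (T lam rho : R).
Hypotheses (T0 : 0 < T) (lam0 : 0 < lam).
Variables (Epi Feps : completeNormedModType R).
Variables (tE : {bilinear E T -> E T -> Epi}) (tF : {bilinear F T -> F T -> Feps}).
Hypothesis tEpi : tensor_completion (pi_norm (@normE R T lam) (@normE R T lam)) tE.
Hypothesis tFeps : tensor_completion (eps_norm (@normF R T lam) (@normF R T lam)) tF.
Variables (B Delta : {bilinear Epi -> Feps -> R}).
Hypotheses (BP : B_spec tE tF lam B) (DeltaP : trace_spec tE tF Delta).
Variable l : {linear Feps -> R}.
Hypotheses (cl : continuous l) (l_spsd : spsd_functional tF l).
Local Notation mu := (muJ T).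
Local Notation bddJ := (bddJ T).
Local Notation S := (Sinv T0 lam0).
Local Notation ip := (ip T lam).
Local Notation diag_int := (diag_int tEpi).
Local Notation K := (Kop T (- (2 * lam))).
Local Notation Rop := (Rop T lam rho).
Implicit Types (x y w : E T) (h : R -> R) (M c t : R) (U : Epi) (v : Feps).

Let diag_DC U := diag_int_bounded T0 lam0 tEpi U.

Let diag_linear M h (hM : bddJ M h) : {linear Epi -> R} :=
  mk_linear (fun c U U' => diag_int_linear T0 lam0 tEpi c U U' hM).

(** U is rho^2 times the integral W of the kernel against its own diagonal functional, so D_U(h) =
    rho^2 D_U(K h). Evaluated at R h, where 1 - rho^2 K is undone, this gives D_U = 0, hence W =
    0. *)
Lemma homogeneous_solution U : (forall v, B U v = rho ^+ 2 * Delta U v) -> U = 0.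
Proof.
move=> BU; have [W [BW DW]] := kernel_integral T0 lam0 tEpi BP (diag_DC U).
have UW : U = rho ^+ 2 *: W.
  apply/eqP; rewrite -subr_eq0; apply/eqP; apply: (B_separates (T0 := T0) (lam0 := lam0) tEpi BP) => x y.
  by rewrite linearBl /= linearZl_LR /= BU (Delta_tensor T0 lam0 tEpi DeltaP) BW subrr.
have diagU M h : bddJ M h -> diag_int h U = rho ^+ 2 * diag_int (K h) U.
  move=> hM; rewrite -(DW _ _ hM) {1}UW -[LHS]/(diag_linear hM (rho ^+ 2 *: W)).
  by rewrite linearZ.
have diagU0 M h : bddJ M h -> diag_int h U = 0.
  move=> hM; have [C [C0 /(_ _ _ hM) RM]] := Rop_bddJ lam rho T0.
  have KM := Kop_bddJ T0 (- (2 * lam)) RM.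
  have cM := bddJ_comb (- rho ^+ 2) KM RM.
  have -> : diag_int h U = diag_int (fun t => - rho ^+ 2 * K (Rop h) t + Rop h t) U.
    by apply: (bf_eqJ (diag_DC U) hM cM) => t tJ; rewrite mulNr addrC (Kop_Rop _ _ _ tJ hM).
  rewrite (diag_int_linear_h T0 lam0 tEpi _ _ KM RM) (diagU _ (Rop h) RM).
  by rewrite mulNr addNr.
rewrite UW (_ : W = 0) ?scaler0 //.
apply: (B_separates (T0 := T0) (lam0 := lam0) tEpi BP) => x y.
by rewrite BW; have [M hM] := bddJ_Sinv_mul T0 lam0 x y; exact: diagU0 hM.
Qed.

Lemma solution_exists : exists U, (forall v, B U v - rho ^+ 2 * Delta U v = l v) /\
  spsd_pi tE U /\ `|U| <= stab_const T rho lam * dual_norm (fun v : Feps => `|v|) l.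
Proof.
have [U0 [cs0 [csU0 BU0 tr0]]] := spsd_solution T0 lam0 tEpi tFeps BP cl l_spsd.
have [CR [CR0 RM]] := Rop_bddJ lam rho T0; have r0 := sqr_ge0 rho.
(* The diagonal of the solution is known in advance, so the kernel can be integrated against it
   before U exists. *)
have DC : bounded_functional T (`|U0| / lam * CR) (fun h => diag_int (Rop h) U0).
  have [D0 Dl Dle] := diag_DC U0; split=> [|c M h M' h' hM hM'|M h hM].
  - exact: mulr_ge0.
  - rewrite -(Dl c _ _ _ _ (RM _ _ hM) (RM _ _ hM')).
    apply: (bf_eqJ (diag_DC U0) (RM _ _ (bddJ_comb c hM hM')) (bddJ_comb c (RM _ _ hM) (RM _ _ hM'))).
    move=> t /andP[t0 _]; rewrite /Rop (Kop_comb _ _ (ltW t0) hM hM'); ring.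
  - by rewrite -(mulrA (`|U0| / lam)); exact: Dle _ _ (RM _ _ hM).
have [W [BW DW]] := kernel_integral T0 lam0 tEpi BP DC.
pose U := rho ^+ 2 *: W + U0.
(* Consistency of the ansatz: by construction the diagonal of U is D_U0 applied to rho^2 R K h + h,
   and rho^2 R K + 1 = R on J. *)
have diagU M h : bddJ M h -> diag_int h U = diag_int (Rop h) U0.
  move=> hM; rewrite /U (diag_int_linear T0 lam0 tEpi _ _ _ hM) (DW _ _ hM).
  have RKM := RM _ _ (Kop_bddJ T0 (- (2 * lam)) hM).
  rewrite -[LHS](diag_int_linear_h T0 lam0 tEpi _ _ RKM hM).
  apply: (bf_eqJ (diag_DC U0) (bddJ_comb _ RKM hM) (RM _ _ hM)) => t tJ.
  by rewrite (Rop_Kop _ _ tJ hM) [RHS]addrC.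
have cDU : continuous (bilinear_right Delta U) := continuous_right DeltaP.1.
have rl c v v' : l (c *: v + v') + rho ^+ 2 * Delta U (c *: v + v') =
    c *: (l v + rho ^+ 2 * Delta U v : R) + (l v' + rho ^+ 2 * Delta U v').
  by rewrite linearP linearPr /GRing.scale /=; ring.
pose r := mk_linear (f := fun v => l v + rho ^+ 2 * Delta U v) rl.
have cr : continuous r.
  by move=> v; apply: cvgD; [exact: cl|apply: cvgMr; exact: cDU].
have r_spsd : spsd_functional tF r.
  have [lC l0] := l_spsd; split=> [v v'|v]; rewrite /r /=.
    have [x ->] := Sinv_surj T0 lam0 v; have [y ->] := Sinv_surj T0 lam0 v'.
    have xy : (fun t => S x t * S y t) = (fun t => S y t * S x t).
      by apply/funext => t; exact: mulrC.
    rewrite (lC (S x) (S y)).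
    by rewrite (Delta_tensor T0 lam0 tEpi DeltaP U x y) xy -(Delta_tensor T0 lam0 tEpi DeltaP U y x).
  have [x ->] := Sinv_surj T0 lam0 v; have [M hM] := bddJ_Sinv_mul T0 lam0 x x.
  rewrite addr_ge0 ?l0 // mulr_ge0 // (Delta_tensor T0 lam0 tEpi DeltaP) (diagU _ _ hM).
  apply: (diag_int_ge0 T0 lam0 tEpi csU0 (RM _ _ hM)) => t tJ.
  by apply: (Rop_ge0 _ _ hM _ tJ) => s _; rewrite -expr2 sqr_ge0.
(* The ansatz does not show U as a limit of sums of squares. Such a limit U' solves B(U', .) = l +
   rho^2 Delta(U, .), and separation identifies it with U. *)
have [U' [cs [csU BU' _]]] := spsd_solution T0 lam0 tEpi tFeps BP cr r_spsd.
have cBU : continuous (bilinear_right B U) := continuous_right BP.1.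
have BU v : B U v = r v.
  apply: (functional_eq (T0 := T0) (lam0 := lam0) tFeps (f := bilinear_right B U) cBU cr) => x y.
  rewrite [LHS](_ : _ = B U (tF (S x) (S y))) // /U linearDl linearZl_LR /= BU0 BW /r /=.
  have [M hM] := bddJ_Sinv_mul T0 lam0 x y.
  by rewrite (Delta_tensor T0 lam0 tEpi DeltaP) (diagU _ _ hM) [LHS]addrC.
have UU' : U' = U.
  apply/eqP; rewrite -subr_eq0; apply/eqP.
  apply: (B_separates (T0 := T0) (lam0 := lam0) tEpi BP) => x y.
  by rewrite linearBl /= BU' BU subrr.
rewrite {}UU' in csU BU'.
exists U; split=> [v|]; first by rewrite BU /r /= addrK.
split; first exact: (spsd_pi_limit lam0 tEpi csU).
have c1 := bddJ_cst T (1 : R).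
have Rc1 := RM _ _ c1; set C := stab_const T rho lam.
have T2 : 0 < T / 2 < T by rewrite divr_gt0 // ltr_pdivrMr // ltr_pMr // ltr1n.
have C0 : 0 <= C.
  apply: le_trans (Rop1_le lam rho T0 T2).
  by apply: (Rop_ge0 _ _ c1 _ T2) => s _; exact: ler01.
(* The trace of U is lam D_U0(R 1); since C - R 1 is nonnegative on J and D_U0 is positive, it is at
   most C times the trace of U0. *)
apply: le_trans (tensor_norm_le_diag T0 lam0 tEpi csU) _; rewrite (diagU _ _ c1).
apply: (@le_trans _ _ (C * (lam * diag_int (cst 1) U0))); last first.
  by rewrite ler_wpM2l //; exact: (diag_int_le_trace T0 lam0 tEpi csU0 tr0).
rewrite mulrCA ler_wpM2l ?(ltW lam0) //.
have c0 := bddJ_cst T (0 : R); have C1 := bddJ_comb C c1 c0.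
have -> : C * diag_int (cst 1) U0 = diag_int (fun t => C * cst 1 t + cst 0 t) U0.
  by rewrite (diag_int_linear_h T0 lam0 tEpi _ _ c1 c0) (bf_zero (h := cst 0) (diag_DC U0)) ?addr0.
rewrite -subr_ge0 addrC -mulN1r -(diag_int_linear_h T0 lam0 tEpi _ _ Rc1 C1).
apply: (diag_int_ge0 T0 lam0 tEpi csU0 (bddJ_comb (-1) Rc1 C1)) => t tJ /=.
by rewrite mulr1 addr0 mulN1r addrC subr_ge0 Rop1_le.
Qed.

End WellPosedness.

Theorem theorem2p11 (R : realType) (T lam rho : R)
  (Epi Feps : completeNormedModType R)
  (tE : {bilinear E T -> E T -> Epi}) (tF : {bilinear F T -> F T -> Feps})
  (B Delta : {bilinear Epi -> Feps -> R}) (l : {linear Feps -> R}) :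
  0 < T -> 0 < lam -> 0 <= rho ->
  tensor_completion (pi_norm (@normE R T lam) (@normE R T lam)) tE ->
  tensor_completion (eps_norm (@normF R T lam) (@normF R T lam)) tF ->
  B_spec tE tF lam B ->
  trace_spec tE tF Delta ->
  continuous l ->
  spsd_functional tF l ->
  let solution (U : Epi) :=
    forall v : Feps, B U v - rho ^+ 2 * Delta U v = l v in
  (exists! U : Epi, solution U) /\
  (forall U : Epi, solution U ->
     spsd_pi tE U /\
     `|U| <= stab_const T rho lam * dual_norm (fun v : Feps => `|v|) l).
Proof.
move=> T0 lam0 _ tEpi tFeps BP DP cl l_spsd solution.
have [U [sU bU]] := solution_exists rho T0 lam0 tEpi tFeps BP DP cl l_spsd.
have uniq U' : solution U' -> U' = U.
  move=> sU'; apply/eqP; rewrite -subr_eq0; apply/eqP.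
  apply: (homogeneous_solution (rho := rho) T0 lam0 tEpi BP DP) => v.
  by rewrite !linearBl /= mulrBr; have := sU v; have := sU' v; lra.
split; last by move=> U' /uniq ->.
by exists U; split=> // U' /uniq ->.
Qed.
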